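(* There is a universal constant $C$ such that the following holds in every execution of the MonadBFT protocol (specified in the context) with $n=3f+1$ validators of which at most $f$ are Byzantine. Let $G=[v,v+1,\dots,v+x-1]$ be a sequence of $x$ consecutive post-GST views, each led by a correct validator. Consider any correct validator $i$, and let $\tau_i^{v+x-1}$ denote the time at which $i$ receives the proposal issued by the leader of view $v+x-1$. Then: (1) by time $\tau_i^{v+x-1}$, validator $i$ commits all blocks proposed in the views of $G$, except possibly those from the last two views $v+x-2$ and $v+x-1$; (2) $\tau_i^{v+x-1}-\tau(v+1)\le C x\delta$ (i.e. it lies in $O(x\delta)$); (3) if the leader of view $v$ enters view $v$ upon accepting a QC associated with view $v-1$, then also $\tau_i^{v+x-1}-\tau(v)\le C x\delta$ (i.e. it lies in $O(x\delta)$).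
   Context: MODEL. There are $n=3f+1$ validators; at most $f$ are Byzantine (arbitrary behaviour), the others are correct and follow the protocol. Channels are point-to-point, authenticated and reliable. The network is partially synchronous: there are an unknown time GST and a known $\Delta>0$ such that a message sent at time $\tau$ between correct validators is delivered by $\max(\tau,\mathrm{GST})+\Delta$; $\delta\le\Delta$ denotes the actual network delay, i.e. such messages are in fact delivered by $\max(\tau,\mathrm{GST})+\delta$. Local clocks may drift before GST and are accurate after GST. All correct validators start the protocol before GST. ''Broadcast'' means send to all validators (including oneself). Local computation takes no time. Signatures and aggregate signatures are unforgeable; the hash function $H$ is treated as collision-free. An aggregate of $2f+1$ signatures means signatures of $2f+1$ distinct validators. Views are positive integers; leaders are assigned round-robin over the $n$ validators. A validator stores all proposals it receives; on obtaining a QC it is assumed also to obtain the proposal the QC points to (and ancestors as needed). $\bot$ denotes an absent field. A correct leader issues at most one proposal per view. Parameters: $\kappa\ge1$, $\Theta_{interval}$, $\Theta_{recovery}=(\lceil n/\kappa\rceil-1)\cdot\Theta_{interval}+2\Delta$, $\Theta_{view}=3\Delta+\Theta_{recovery}+3\Delta$. DATA. Block $B=\langle block\_view, payload, payload\_hash, qc, block\_hash\rangle$ with $block\_hash=H(block\_view,payload\_hash,qc)$; its header is $B$ without $payload$. Vote $\langle view, block\_hash, proposal\_id,\sigma\rangle$, valid if $proposal\_id=H(block\_hash,view)$ and $\sigma$ is a valid signature on the other fields. QC $\langle view, block\_hash, proposal\_id,\Sigma\rangle$, valid if $proposal\_id=H(block\_hash,view)$ and $\Sigma$ aggregates $2f+1$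 signatures on the other fields; it points to any proposal with the same $proposal\_id$. Proposal $p=\langle view, proposal\_id, block,\sigma,tc,nec\rangle$ with $proposal\_id=H(block.block\_hash,view)$, $\sigma$ the leader's signature on $proposal\_id$ ($tc,nec$ possibly $\bot$). The tip of $p$ is $p$ with its block replaced by the block header. Timeout message $M=\langle view, tip, tip\_vote, qc, last\_cer,\sigma\rangle$. Timeout certificate (TC) $\langle view, tips\_views, high\_tip, qcs\_views, high\_qc,\Sigma\rangle$, where $tips\_views,qcs\_views$ give for each of $2f+1$ contributing validators the view of the reported tip ($\bot$, counted as $0$ in maxima, if it reported a QC) and the view of the reported QC (of the QC in the tip's header if it reported a tip). No-endorsement certificate (NEC) $\langle view, high\_tip\_qc\_view,\Sigma\rangle$. There are a genesis block and a genesis tip and genesis QC of view $0$, valid without signatures; initially they are $local\_tip$ and $last\_qc$. VALIDITY. A header is valid if its $qc$ is valid and its $block\_hash$ is correct; a block is valid if additionally $payload\_hash=H(payload)$. fresh($p$): $p.block.qc.view=p.view-1$, or $p.nec\ne\bot$, or ($p.tc\neq\bot$ and $p.tc.high\_qc\ne\bot$). Valid fresh tip $T$: valid header, correct $proposal\_id$, $\sigma$ by the leader of $T.view$, $header.block\_view=T.view>header.qc.view$, and: if $T.view=header.qc.view+1$ then $T.tc=T.nec=\bot$; otherwise $T.tc\neq\bot$ is valid with $T.view=T.tc.view+1$, and either ($T.nec=\bot$, $T.tc.high\_qc\ne\bot$ and $header.qc=T.tc.high\_qc$) or ($T.nec$ is valid, $T.view=T.nec.view$ and $header.qc.view=T.nec.high\_tip\_qc\_view$).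 Valid proposal $p$: valid block, correct $proposal\_id$, $\sigma$ by the leader of $p.view$, $p.view\ge p.block.block\_view$, $p.view>p.block.qc.view$, and: if fresh($p$), the tip of $p$ is a valid fresh tip; otherwise (''reproposal'') $p.view>p.block.block\_view$, $p.tc\neq\bot$ is valid, $p.view=p.tc.view+1$, $p.tc.high\_tip\ne\bot$, and the header of $p.block$ equals $p.tc.high\_tip$'s header. (So a valid proposal is fresh iff $p.view=p.block.block\_view$.) Valid timeout message $M$: $last\_cer$ is a valid QC or TC with $last\_cer.view=M.view-1$; exactly one of $tip,qc$ is non-$\bot$; if $tip\neq\bot$: $tip\_vote$ is a valid vote with $tip\_vote.view=M.view$, $tip$ is a valid fresh tip with $tip.view\le M.view$, $\sigma$ signs $(M.view,tip.view,tip.header.qc.view)$; if $qc\ne\bot$: $qc$ is valid, $qc.view<M.view$, $\sigma$ signs $(M.view,\bot,qc.view)$. Valid TC $tc$: $\Sigma$ aggregates $2f+1$ timeout signatures certifying $view,tips\_views,qcs\_views$; and either ($high\_qc\ne\bot$ is valid, $high\_tip=\bot$, $high\_qc.view<tc.view$, $\max(tips\_views)\le high\_qc.view=\max(qcs\_views)$) or ($high\_qc=\bot$, $high\_tip$ is a valid fresh tip, $high\_tip.view\le tc.view$, $qcs\_views[i]<tips\_views[i]$ whenever $tips\_views[i]\ne\bot$, no $tips\_views[i]>high\_tip.view$, no $i$ with $tips\_views[i]=high\_tip.view$ and $qcs\_views[i]>high\_tip.header.qc.view$, and $high\_tip.view>\max(qcs\_views)$). Valid NEC: $high\_tip\_qc\_view<view-1$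 and $\Sigma$ aggregates $2f+1$ signatures on $(view,high\_tip\_qc\_view)$. LOCAL STATE of validator $i$: $cur\_view$, $local\_tip$, $highest\_voted\_view$, $last\_qc$, $last\_tc$, collected votes and timeouts, and a timer. At start every validator performs Enter(genesis QC), entering view $1$, and the leader of view 1 performs ProposeQC(genesis QC). PROCEDURES. Enter($c$) ($c$ a QC or TC): if $c.view\ge cur\_view$, set $cur\_view:=c.view+1$, restart the timer, and set $last\_qc:=c$ (QC) or $last\_tc:=c$ (TC). Commit($qc$): let $parent$ be the proposal $qc$ points to and $gp$ the proposal $parent.block.qc$ points to; if fresh($parent$), speculatively commit $parent.block$; if $qc.view=parent.block.qc.view+1$, commit $gp.block$ (and all its ancestors). ProposeQC($qc$): broadcast a proposal for $cur\_view$ with a new block $B$, $B.block\_view=cur\_view$, $B.qc=qc$, and $tc=nec=\bot$. ProposeTC($tc$): if $tc.high\_qc\neq\bot$, broadcast a proposal for $cur\_view$ with a new block with $qc=tc.high\_qc$, this $tc$, $nec=\bot$; else if the block of $tc.high\_tip$ is available, broadcast a proposal for $cur\_view$ containing that same block, this $tc$, $nec=\bot$; else run Recover($tc$): if it returns a proposal, repropose its block as before; if it returns an NEC, broadcast a proposal with a new block with $qc=tc.high\_tip.header.qc$, this $tc$, and this $nec$. Recover($tc$): broadcast $\langle\mathsf{NERequest},tc\rangle$, send $\langle\mathsf{ProposalRequest},tc\rangle$ to $\kappa$ validators and, every $\Theta_{interval}$ time, to $\kappa$ further ones; return the first received proposal with $proposal\_id=tc.high\_tip.proposal\_id$, or an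 NEC with view $tc.view+1$ and $high\_tip\_qc\_view=tc.high\_tip.header.qc.view$ once $2f+1$ validators sent valid NE signatures on this pair; abort if Recover is called for a higher view. BroadcastQC($qc$): broadcast $qc$ if not yet done. HANDLERS (messages of a view smaller than indicated, or invalid, are ignored). (1) On a valid proposal $p$ from the leader of $p.view\ge cur\_view$: Enter($p.tc$) if $p.tc\ne\bot$, else Enter($p.block.qc$); if $p.block.qc.view=p.view-1$, then BroadcastQC($p.block.qc$) if $i$ is the leader of view $p.block.qc.view$, and send $p.block.qc$ to that leader; Commit($p.block.qc$); if $p.view>highest\_voted\_view$: set $local\_tip$ to the tip of $p$ if fresh($p$) and to $p.tc.high\_tip$ otherwise, send a vote for ($cur\_view$, block hash of $local\_tip$) to the leaders of views $cur\_view$ and $cur\_view+1$, and set $highest\_voted\_view:=cur\_view$. (2) On a valid vote with view $v\ge cur\_view$, if $i$ leads $v$ or $v+1$: once $2f+1$ votes with the same $proposal\_id$ are collected, form the QC $qc$; Enter($qc$); Commit($qc$); BroadcastQC($qc$) if $i$ leads $v$, else ProposeQC($qc$). (3) On a valid QC $qc$ from $j$ with $qc.view\ge cur\_view$: if $j$ leads $qc.view$: Enter($qc$), Commit($qc$), send $qc$ to the leader of $qc.view+1$; if $i$ leads $qc.view$: BroadcastQC($qc$); if $i$ leads $qc.view+1$: Enter($qc$), Commit($qc$), ProposeQC($qc$). (4) On timing out in $cur\_view=v$ (at most once per view; when the timer reaches $\Theta_{view}$ or when triggered in (5)): $highest\_voted\_view:=v$; broadcast a timeout message for view $v$ with $last\_cer=last\_qc$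 if $last\_qc.view=v-1$ and $last\_cer=last\_tc$ otherwise; if $local\_tip.view\le last\_qc.view$ it has $qc=last\_qc$, $tip=tip\_vote=\bot$; otherwise $tip=local\_tip$, $tip\_vote$ a vote for ($v$, block hash of $local\_tip$), $qc=\bot$. (5) On a valid timeout message $M$ with $M.view\ge cur\_view$: let $c=M.last\_cer$; if $c$ is a TC and $i$ has broadcast neither a timeout message nor a TC for $c.view$, broadcast $c$; Enter($c$); if $i$ leads $c.view+1$ and has issued no proposal for it, ProposeQC($c$) or ProposeTC($c$) according to the type of $c$; if $c$ is a QC: BroadcastQC($c$) if $i$ leads $c.view$, send $c$ to the leaders of $c.view$ and $c.view+1$, Commit($c$). Then: if $M.tip\neq\bot$, record $M.tip\_vote$; if $2f+1$ tip votes with the same $proposal\_id$ are recorded, form the QC $qc$, Enter($qc$), Commit($qc$), ProposeQC($qc$) if $i$ leads $qc.view+1$, and stop. Otherwise record $M$; when $f+1$ timeout messages for $M.view$ are recorded, trigger the timeout of view $M.view$ if not yet triggered; when $2f+1$ are recorded, form a TC $tc$ (with $high\_tip$ the reported tip of highest view, ties broken by highest $header.qc.view$, if this view exceeds all reported QC views; otherwise with $high\_qc$ the highest reported QC), Enter($tc$), and ProposeTC($tc$) if $i$ leads $tc.view+1$. (6) On a valid TC $tc$ with $tc.view\ge cur\_view$: Enter($tc$); broadcast $tc$ if no TC and no timeout message was broadcast for $tc.view$; ProposeTC($tc$) if $i$ leads $tc.view+1$. (7) On $\langle\mathsf{ProposalRequest},tc\rangle$ or $\langle\mathsf{NERequest},tc\rangle$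 from the leader of $tc.view+1\ge cur\_view$, with $tc$ valid and $tc.high\_tip\neq\bot$: Enter($tc$); for a ProposalRequest, if $i$ has a proposal with $proposal\_id=tc.high\_tip.proposal\_id$, send it to that leader; for an NERequest, if $i$ has not voted for a proposal with that $proposal\_id$ and has sent no NE message in view $tc.view+1$, send that leader an NE signature on $(tc.view+1,tc.high\_tip.header.qc.view)$. TERMINOLOGY. Block $B_1$ is the parent of $B_2$ if some proposal $p$ has $p.block=B_1$ and $p.proposal\_id=B_2.qc.proposal\_id$; committing a block commits all its ancestors. A correct validator enters view $w$ at the time it sets $cur\_view:=w$; it accepts a QC or TC $c$ if its call Enter($c$) updates $cur\_view$ to $c.view+1$. $\tau(w)$ is the time at which the first correct validator enters view $w$ (every view is entered by some correct validator). A view $w$ is a post-GST view if $\tau(w)\ge\mathrm{GST}$.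
   Formalization: The formal theorem assumes f ≥ 1: for f = 0 the single validator leads all views, handler (2) then broadcasts the QC instead of proposing, and the next proposal waits for a timeout, so the O(xδ) bounds fail. *)

(* Defs.v *)
(* Real time is measured in an arbitrary [R : realType]. *)
From mathcomp Require Import all_boot all_order all_algebra reals.
From Stdlib Require List.

Set Implicit Arguments.
Unset Strict Implicit.
Unset Printing Implicit Defensive.

Import Order.TTheory GRing.Theory Num.Theory.

Section Data.
Variables (n : nat) (payload hash : Type).

(* Cryptography is symbolic: a signature is identified with its signer and the
   signed content (so it always verifies), and unforgeability is the constraint
   [unforgeable] on executions.  An aggregate is the list of its members. *)
Inductive content :=
| CVote of nat & hash & hash            (* view, block_hash, proposal_id *)
| CProposal of hash                     (* proposal_id *)
| CTimeout of nat & option nat & nat    (* view, view of the tip, view of the QC *)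
| CNE of nat & nat.                     (* view, high_tip_qc_view *)

Record sig := Sig { signer : 'I_n; signed : content }.

Record vote := Vote {
  v_view : nat; v_block_hash : hash; v_pid : hash; v_sig : sig }.

Record qc := QC {
  qc_view : nat; qc_block_hash : hash; qc_pid : hash; qc_sigs : seq sig }.

Record header := Header {
  block_view : nat; payload_hash : hash; hd_qc : qc; block_hash : hash }.

Record block := Block { hd : header; content_of : payload }.

Record nec := NEC {
  nec_view : nat; nec_high_tip_qc_view : nat; nec_sigs : seq sig }.

(* The entries of [tips_views] and [qcs_views] are listed in the order of the
   contributing signatures. *)
Inductive tip :=
| Tip (view : nat) (pid : hash) (h : header) (s : sig)
      (t : option tc) (ne : option nec)
with tc :=
| TC (view : nat) (tips_views : seq (option nat)) (high_tip : option tip)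
     (qcs_views : seq nat) (high_qc : option qc) (sigs : seq sig).

Definition tip_view (T : tip) := let: Tip v _ _ _ _ _ := T in v.
Definition tip_pid (T : tip) := let: Tip _ h _ _ _ _ := T in h.
Definition tip_hd (T : tip) := let: Tip _ _ h _ _ _ := T in h.
Definition tc_view (c : tc) := let: TC v _ _ _ _ _ := c in v.
Definition tc_high_tip (c : tc) := let: TC _ _ T _ _ _ := c in T.
Definition tc_high_qc (c : tc) := let: TC _ _ _ _ q _ := c in q.

Record proposal := Proposal {
  p_view : nat; p_pid : hash; p_block : block; p_sig : sig;
  p_tc : option tc; p_nec : option nec }.

Definition p_qc (p : proposal) : qc := hd_qc (hd (p_block p)).

Definition tip_of (p : proposal) : tip :=
  Tip (p_view p) (p_pid p) (hd (p_block p)) (p_sig p) (p_tc p) (p_nec p).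

Inductive cert := CQC of qc | CTC of tc.

Definition cert_view (c : cert) : nat :=
  match c with CQC q => qc_view q | CTC t => tc_view t end.

Record timeout := Timeout {
  to_view : nat; to_tip : option tip; to_tip_vote : option vote;
  to_qc : option qc; to_last_cer : cert; to_sig : sig }.

Definition to_tip_view (M : timeout) : option nat := omap tip_view (to_tip M).
Definition to_qc_view (M : timeout) : nat :=
  match to_tip M, to_qc M with
  | Some T, _ => qc_view (hd_qc (tip_hd T))
  | None, Some q => qc_view q
  | None, None => 0
  end.

Inductive msg :=
| MProposal of proposal
| MVote of vote
| MQC of qc
| MTimeout of timeout
| MTC of tc
| MProposalRequest of tc
| MNERequest of tc
| MNE of nat & nat & sig.               (* view, high_tip_qc_view, signature *)

Inductive preimage :=
| PrePayload of payload
| PreBlock of nat & hash & qc           (* block_view, payload_hash, qc *)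
| PreProposal of hash & nat.            (* block_hash, view *)

Definition nec_sigs_opt (ne : option nec) : seq sig :=
  if ne is Some x then nec_sigs x else [::].

Fixpoint sigs_tip (T : tip) : seq sig :=
  let: Tip _ _ h s t ne := T in
  s :: qc_sigs (hd_qc h) ++ (if t is Some c then sigs_tc c else [::])
    ++ nec_sigs_opt ne
with sigs_tc (c : tc) : seq sig :=
  let: TC _ _ T _ q ss := c in
  ss ++ (if T is Some T' then sigs_tip T' else [::])
     ++ (if q is Some q' then qc_sigs q' else [::]).

Definition sigs_cert (c : cert) : seq sig :=
  match c with CQC q => qc_sigs q | CTC t => sigs_tc t end.

Definition sigs_msg (m : msg) : seq sig :=
  match m with
  | MProposal p => sigs_tip (tip_of p)
  | MVote v => [:: v_sig v]
  | MQC q => qc_sigs q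
  | MTimeout M =>
      to_sig M :: sigs_cert (to_last_cer M)
      ++ (if to_tip M is Some T then sigs_tip T else [::])
      ++ (if to_tip_vote M is Some v then [:: v_sig v] else [::])
      ++ (if to_qc M is Some q then qc_sigs q else [::])
  | MTC t | MProposalRequest t | MNERequest t => sigs_tc t
  | MNE _ _ s => [:: s]
  end.

(* The QCs that a validator obtains from a message. *)
Definition qcs_msg (m : msg) : seq qc :=
  match m with
  | MProposal p => [:: p_qc p]
  | MQC q => [:: q]
  | MTimeout M =>
      (if to_last_cer M is CQC q then [:: q] else [::])
      ++ (if to_qc M is Some q then [:: q] else [::])
      ++ (if to_tip M is Some T then [:: hd_qc (tip_hd T)] else [::])
  | MTC t | MProposalRequest t | MNERequest t =>
      (if tc_high_qc t is Some q then [:: q] else [::])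
      ++ (if tc_high_tip t is Some T then [:: hd_qc (tip_hd T)] else [::])
  | MVote _ | MNE _ _ _ => [::]
  end.

Definition fresh (p : proposal) : Prop :=
  [\/ (qc_view (p_qc p)).+1 = p_view p,
      p_nec p <> None
    | exists t q, p_tc p = Some t /\ tc_high_qc t = Some q].

(* [chain K h q]: among the proposals satisfying [K], [q] has proposal_id [h], or
   is reached from a proposal with that proposal_id by repeatedly following the
   QC of the block.  The blocks of these proposals are the block designated by
   [h] and all its ancestors. *)
Inductive chain (K : proposal -> Prop) (h : hash) : proposal -> Prop :=
| chain_here p : K p -> p_pid p = h -> chain K h p
| chain_parent p q :
    chain K h p -> K q -> p_pid q = qc_pid (p_qc p) -> chain K h q.

Inductive fact :=
| Stored of proposal
| GotVote of vote
| GotTipVote of vote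
| GotTimeout of timeout
| GotNE of sig
| VotedFor of hash              (* proposal_id of a vote that was cast *)
| Issued of proposal            (* own proposal, as leader of its view *)
| SentTimeout of nat
| SentTC of nat
| SentQC of qc                  (* by BroadcastQC *)
| SentNE of nat
| SpecCommitted of block
| Committed of block.

Inductive action :=
| Send of 'I_n & msg
| Sign of sig
| Accept of cert.

Variable R : realType.

(* A run of Recover; times are readings of the local clock. *)
Record recovery := Recovery {
  rec_tc : tc; rec_tip : tip; rec_asked : {set 'I_n}; rec_tick : R }.

(* [cur_view = 0] means that the validator has not started yet; [timer] is the
   reading of the local clock at the last restart of the timer; [log] is the list
   of the actions performed at the last event. *)
Record lstate := LState {
  cur_view : nat; timer : R; local_tip : tip; highest_voted : nat;
  last_qc : qc; last_tc : option tc; recov : option recovery;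
  mem : fact -> Prop; log : seq action }.

End Data.

Arguments CTimeout {hash} _ _ _.
Arguments CNE {hash} _ _.
Arguments MVote {n payload hash} _.
Arguments MQC {n payload hash} _.
Arguments MTimeout {n payload hash} _.
Arguments MTC {n payload hash} _.
Arguments MProposalRequest {n payload hash} _.
Arguments MNERequest {n payload hash} _.
Arguments MNE {n payload hash} _ _ _.
Arguments PrePayload {n payload hash} _.
Arguments PreBlock {n payload hash} _ _ _.
Arguments PreProposal {n payload hash} _ _.
Arguments GotVote {n payload hash} _.
Arguments GotTipVote {n payload hash} _.
Arguments GotTimeout {n payload hash} _.
Arguments GotNE {n payload hash} _.
Arguments VotedFor {n payload hash} _.
Arguments SentTimeout {n payload hash} _.
Arguments SentTC {n payload hash} _.
Arguments SentQC {n payload hash} _.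
Arguments SentNE {n payload hash} _.
Arguments Sign {n payload hash} _.
Arguments Accept {n payload hash} _.

(* There is at least one tolerated fault.  For n = 1 the only validator leads
   all views: when it forms a QC it executes BroadcastQC rather than ProposeQC,
   the QC is outdated when it reaches its sender again, and no proposal is made
   before the next timeout. *)
Record protocol (R : realType) := Protocol {
  faults : nat;
  kappa : nat;
  bigDelta : R;
  interval : R;
  payload_t : Type;
  hash_t : Type;
  H : preimage (3 * faults).+1 payload_t hash_t -> hash_t;
  genesis_payload : payload_t;
  faults_gt0 : (0 < faults)%N;
  kappa_gt0 : (0 < kappa)%N;
  bigDelta_gt0 : (0 < bigDelta)%R;
  interval_ge0 : (0 <= interval)%R;
  H_inj : injective H }.

Section Protocol.
Variables (R : realType) (P : protocol R).

Local Notation f := (faults P).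
Local Notation n := ((3 * f).+1).
Local Notation V := ('I_n).
Local Notation hash := (hash_t P).
Local Notation content := (Defs.content hash).
Local Notation sig := (Defs.sig n hash).
Local Notation vote := (Defs.vote n hash).
Local Notation qc := (Defs.qc n hash).
Local Notation header := (Defs.header n hash).
Local Notation block := (Defs.block n (payload_t P) hash).
Local Notation nec := (Defs.nec n hash).
Local Notation tip := (Defs.tip n hash).
Local Notation tc := (Defs.tc n hash).
Local Notation cert := (Defs.cert n hash).
Local Notation proposal := (Defs.proposal n (payload_t P) hash).
Local Notation timeout := (Defs.timeout n hash).
Local Notation msg := (Defs.msg n (payload_t P) hash).
Local Notation fact := (Defs.fact n (payload_t P) hash).
Local Notation action := (Defs.action n (payload_t P) hash).
Local Notation recovery := (Defs.recovery n hash R).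
Local Notation lstate := (Defs.lstate n (payload_t P) hash R).

Definition leader (w : nat) : V := inord (w %% n).

Definition theta_recovery : R :=
  ((((n + kappa P).-1 %/ kappa P).-1)%:R * interval P + bigDelta P *+ 2)%R.

Definition theta_view : R :=
  (bigDelta P *+ 3 + theta_recovery + bigDelta P *+ 3)%R.

Definition pid_of (bh : hash) (w : nat) : hash := H (PreProposal bh w).

Definition new_block (w : nat) (x : payload_t P) (q : qc) : block :=
  let ph := H (PrePayload x) in
  Block (Header w ph q (H (PreBlock w ph q))) x.

(* The QC field of the genesis block is a dummy whose proposal_id is not the
   proposal_id of any proposal. *)
Definition null_qc : qc :=
  let h := H (PrePayload (genesis_payload P)) in QC 0 h h [::].

Definition genesis_block : block := new_block 0 (genesis_payload P) null_qc.

Definition genesis_proposal : proposal :=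
  let h := pid_of (block_hash (hd genesis_block)) 0 in
  Proposal 0 h genesis_block (Sig (leader 0) (CProposal h)) None None.

Definition genesis_qc : qc :=
  QC 0 (block_hash (hd genesis_block)) (p_pid genesis_proposal) [::].

Definition genesis_tip : tip := tip_of genesis_proposal.

Definition distinct_quorum (ss : seq sig) : Prop :=
  size ss = (2 * f).+1 /\ uniq [seq signer s | s <- ss].

Definition aggregates (ss : seq sig) (c : content) : Prop :=
  distinct_quorum ss /\ [seq signed s | s <- ss] = nseq (size ss) c.

Definition valid_vote (v : vote) : Prop :=
  v_pid v = pid_of (v_block_hash v) (v_view v) /\
  signed (v_sig v) = CVote (v_view v) (v_block_hash v) (v_pid v).

Definition valid_qc (q : qc) : Prop :=
  q = genesis_qc \/
  (qc_pid q = pid_of (qc_block_hash q) (qc_view q) /\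
   aggregates (qc_sigs q) (CVote (qc_view q) (qc_block_hash q) (qc_pid q))).

Definition valid_header (h : header) : Prop :=
  valid_qc (hd_qc h) /\
  block_hash h = H (PreBlock (block_view h) (payload_hash h) (hd_qc h)).

Definition valid_block (b : block) : Prop :=
  valid_header (hd b) /\
  payload_hash (hd b) = H (PrePayload (content_of b)).

Definition valid_nec (ne : nec) : Prop :=
  (nec_high_tip_qc_view ne).+1 < nec_view ne /\
  aggregates (nec_sigs ne) (CNE (nec_view ne) (nec_high_tip_qc_view ne)).

Definition max_tips (ts : seq (option nat)) : nat :=
  \max_(t <- ts) odflt 0 t.

Definition max_qcs (qs : seq nat) : nat := \max_(q <- qs) q.

(* The genesis tip does not satisfy [valid_tip]: it is only an initial value, and
   no correct validator ever sends it. *)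
Fixpoint valid_tip (T : tip) : Prop :=
  let: Tip w h hdr s t ne := T in
  let qv := qc_view (hd_qc hdr) in
  [/\ valid_header hdr,
      h = pid_of (block_hash hdr) w,
      s = Sig (leader w) (CProposal h),
      block_view hdr = w /\ qv < w
    & if w == qv.+1 then t = None /\ ne = None
      else match t with
           | None => False
           | Some c =>
               [/\ valid_tc c,
                   w = (tc_view c).+1
                 & match ne with
                   | None => tc_high_qc c = Some (hd_qc hdr)
                   | Some x => [/\ valid_nec x, w = nec_view x
                                 & qv = nec_high_tip_qc_view x]
                   end]
           end]
with valid_tc (c : tc) : Prop :=
  let: TC w ts T qs q ss := c in
  [/\ distinct_quorum ss,
      size ts = (2 * f).+1 /\ size qs = (2 * f).+1,
      [seq signed s | s <- ss] =
        [seq CTimeout w tq.1 tq.2 | tq <- zip ts qs]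
    & match q, T with
      | Some q', None =>
          [/\ valid_qc q', qc_view q' < w, max_tips ts <= qc_view q'
            & qc_view q' = max_qcs qs]
      | None, Some T' =>
          [/\ valid_tip T', tip_view T' <= w, max_qcs qs < tip_view T'
            & forall (tv v : nat), (Some tv, v) \in zip ts qs ->
                [/\ v < tv, tv <= tip_view T'
                  & tv = tip_view T' -> v <= qc_view (hd_qc (tip_hd T'))]]
      | _, _ => False
      end].

Definition valid_cert (c : cert) : Prop :=
  match c with CQC q => valid_qc q | CTC t => valid_tc t end.

Definition valid_proposal (p : proposal) : Prop :=
  let b := p_block p in
  [/\ valid_block b,
      p_pid p = pid_of (block_hash (hd b)) (p_view p),
      p_sig p = Sig (leader (p_view p)) (CProposal (p_pid p)),
      block_view (hd b) <= p_view p /\ qc_view (p_qc p) < p_view p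
    & (fresh p /\ valid_tip (tip_of p)) \/
      (~ fresh p /\ block_view (hd b) < p_view p /\
       exists t T, [/\ p_tc p = Some t, valid_tc t, p_view p = (tc_view t).+1,
                       tc_high_tip t = Some T & hd b = tip_hd T])].

(* Votes and timeout messages are valid only if they bear the signature of the
   validator [src] that sent them on its authenticated channel. *)
Definition valid_timeout (src : V) (M : timeout) : Prop :=
  [/\ valid_cert (to_last_cer M),
      (cert_view (to_last_cer M)).+1 = to_view M,
      to_sig M = Sig src (CTimeout (to_view M) (to_tip_view M) (to_qc_view M))
    & match to_tip M, to_qc M with
      | Some T, None =>
          valid_tip T /\ tip_view T <= to_view M /\
          exists2 v, to_tip_vote M = Some v
            & [/\ valid_vote v, signer (v_sig v) = src & v_view v = to_view M]
      | None, Some q => valid_qc q /\ qc_view q < to_view M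
      | _, _ => False
      end].

Definition valid_msg (src : V) (m : msg) : Prop :=
  match m with
  | MProposal p => valid_proposal p
  | MVote v => valid_vote v /\ signer (v_sig v) = src
  | MQC q => valid_qc q
  | MTimeout M => valid_timeout src M
  | MTC t => valid_tc t
  | MProposalRequest t | MNERequest t => valid_tc t /\ tc_high_tip t <> None
  | MNE w v s => s = Sig src (CNE w v)
  end.

(* The procedures and handlers are nondeterministic commands: relations between
   the state before and the state after. *)
Definition cmd := lstate -> lstate -> Prop.

Definition skip : cmd := fun s s' => s' = s.
Definition upd (g : lstate -> lstate) : cmd := fun s s' => s' = g s.
Definition seqc (c1 c2 : cmd) : cmd := fun s s' => exists2 t, c1 s t & c2 t s'.
Definition ifc (b : lstate -> Prop) (c1 c2 : cmd) : cmd :=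
  fun s s' => (b s /\ c1 s s') \/ (~ b s /\ c2 s s').
Definition when b (c : cmd) : cmd := ifc b c skip.
Definition choose (A : Type) (c : A -> cmd) : cmd := fun s s' => exists a, c a s s'.
(* Continue with some [a] such that [b s a]; if there is none, do [c2]. *)
Definition ifsome (A : Type) (b : lstate -> A -> Prop) (c1 : A -> cmd) (c2 : cmd)
    : cmd :=
  fun s s' => (exists2 a, b s a & c1 a s s') \/ ((forall a, ~ b s a) /\ c2 s s').
Definition onstate (c : lstate -> cmd) : cmd := fun s => c s s.

Local Notation "c1 ;; c2" := (seqc c1 c2) (at level 61, right associativity).

Definition set_mem (F : fact -> Prop) (s : lstate) : lstate :=
  LState (cur_view s) (timer s) (local_tip s) (highest_voted s) (last_qc s)
    (last_tc s) (recov s) F (log s).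
Definition set_log (l : seq action) (s : lstate) : lstate :=
  LState (cur_view s) (timer s) (local_tip s) (highest_voted s) (last_qc s)
    (last_tc s) (recov s) (mem s) l.
Definition set_recov (r : option recovery) (s : lstate) : lstate :=
  LState (cur_view s) (timer s) (local_tip s) (highest_voted s) (last_qc s)
    (last_tc s) r (mem s) (log s).
Definition set_highest_voted (w : nat) (s : lstate) : lstate :=
  LState (cur_view s) (timer s) (local_tip s) w (last_qc s)
    (last_tc s) (recov s) (mem s) (log s).
Definition set_local_tip (T : tip) (s : lstate) : lstate :=
  LState (cur_view s) (timer s) T (highest_voted s) (last_qc s)
    (last_tc s) (recov s) (mem s) (log s).

Definition note_all (F : lstate -> fact -> Prop) : cmd :=
  upd (fun s => set_mem (fun x => mem s x \/ F s x) s).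
Definition note (x : fact) : cmd := note_all (fun _ y => y = x).
Definition act (a : action) : cmd := upd (fun s => set_log (rcons (log s) a) s).
Definition send (j : V) (m : msg) : cmd := act (Send j m).
Definition send_all (A : {set V}) (m : msg) : cmd :=
  upd (fun s => set_log (log s ++ [seq Send j m | j <- enum A]) s).
Definition broadcast (m : msg) : cmd := send_all [set: V] m.

Definition stored (s : lstate) (p : proposal) : Prop := mem s (Stored p).

Definition initial : lstate :=
  LState 0 0%R genesis_tip 0 genesis_qc None None
    (fun x => x = Stored genesis_proposal) [::].

(* [q] is a QC with proposal_id [h] aggregating votes that satisfy [W]. *)
Definition forms_qc (W : vote -> Prop) (h : hash) (q : qc) : Prop :=
  [/\ qc_pid q = h,
      aggregates (qc_sigs q) (CVote (qc_view q) (qc_block_hash q) (qc_pid q))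
    & forall s, List.In s (qc_sigs q) ->
        W (Vote (qc_view q) (qc_block_hash q) (qc_pid q) s)].

(* [k] timeout messages of view [w] from distinct validators. *)
Definition timeouts_of (W : timeout -> Prop) (w k : nat) (Ms : seq timeout) : Prop :=
  [/\ size Ms = k, uniq [seq signer (to_sig M) | M <- Ms]
    & forall M, List.In M Ms -> W M /\ to_view M = w].

Definition forms_tc (W : timeout -> Prop) (w : nat) (c : tc) : Prop :=
  exists (Ms : seq timeout) (T : option tip) (q : option qc),
  let ts := [seq to_tip_view M | M <- Ms] in
  let qs := [seq to_qc_view M | M <- Ms] in
  [/\ timeouts_of W w (2 * f).+1 Ms,
      c = TC w ts T qs q [seq to_sig M | M <- Ms]
    & if max_qcs qs < max_tips ts then
        q = None /\
        exists T', [/\ T = Some T',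
          exists2 M, List.In M Ms & to_tip M = Some T'
        & forall M T2, List.In M Ms -> to_tip M = Some T2 ->
            tip_view T2 < tip_view T' \/
            (tip_view T2 = tip_view T' /\
             qc_view (hd_qc (tip_hd T2)) <= qc_view (hd_qc (tip_hd T')))]
      else
        T = None /\
        exists q', [/\ q = Some q',
          exists2 M, List.In M Ms & to_tip M = None /\ to_qc M = Some q'
        & qc_view q' = max_qcs qs]].

Section Handlers.
(* [clk] is the current reading of the local clock of [me], and [known] the set
   of the proposals stored by correct validators, from which the proposals that
   a QC points to are obtained. *)
Variables (me : V) (clk : R) (known : proposal -> Prop).

Definition enter (c : cert) : cmd :=
  when (fun s => cur_view s <= cert_view c)
    (upd (fun s => LState (cert_view c).+1 clk (local_tip s) (highest_voted s)
       (if c is CQC q then q else last_qc s)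
       (if c is CTC t then Some t else last_tc s)
       (recov s) (mem s) (rcons (log s) (Accept c)))).

Definition obtain (q : qc) : cmd :=
  note_all (fun s x => exists2 p,
    x = Stored p & chain (fun p' => known p' \/ stored s p') (qc_pid q) p).

Definition commit (q : qc) : cmd :=
  obtain q ;;
  note_all (fun s x => exists parent : proposal,
    [/\ stored s parent, p_pid parent = qc_pid q
      & (fresh parent /\ x = SpecCommitted (p_block parent)) \/
        (qc_view q = (qc_view (p_qc parent)).+1 /\
         exists2 p, chain (stored s) (qc_pid (p_qc parent)) p
                  & x = Committed (p_block p))]).

Definition has_issued (w : nat) (s : lstate) : Prop :=
  exists2 p : proposal, mem s (Issued p) & p_view p = w.

(* At most one proposal is issued per view. *)
Definition issue (b : block) (t : option tc) (ne : option nec) : cmd :=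
  onstate (fun s =>
    let w := cur_view s in
    let h := pid_of (block_hash (hd b)) w in
    let sg := Sig me (CProposal h) in
    let p := Proposal w h b sg t ne in
    when (fun s => ~ has_issued w s)
      (act (Sign sg) ;; note (Issued p) ;; broadcast (MProposal p))).

Definition issue_new (q : qc) (t : option tc) (ne : option nec) : cmd :=
  choose (fun x : payload_t P =>
    onstate (fun s => issue (new_block (cur_view s) x q) t ne)).

Definition propose_qc (q : qc) : cmd := issue_new q None None.

(* [kappa] validators that have not been asked yet, or all those that remain. *)
Definition next_asked (asked A : {set V}) : Prop :=
  [disjoint asked & A] /\ #|A| = minn (kappa P) #|~: asked|.

(* A call for a view for which Recover is already running is ignored. *)
Definition recover (t : tc) (T : tip) : cmd :=
  when (fun s => forall r, recov s = Some r -> tc_view (rec_tc r) < tc_view t)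
    (ifsome (fun _ A => next_asked set0 A)
       (fun A =>
          upd (set_recov (Some (Recovery t T A clk))) ;;
          broadcast (MNERequest t) ;;
          send_all A (MProposalRequest t))
       skip).

Definition propose_tc (t : tc) : cmd :=
  match tc_high_qc t, tc_high_tip t with
  | Some q, _ => issue_new q (Some t) None
  | None, Some T =>
      ifsome (fun s p => stored s p /\ hd (p_block p) = tip_hd T)
        (fun p => issue (p_block p) (Some t) None)
        (recover t T)
  | None, None => skip
  end.

Definition broadcast_qc (q : qc) : cmd :=
  when (fun s => ~ mem s (SentQC q))
    (note (SentQC q) ;; broadcast (MQC q)).

Definition is_leader (w : nat) (c : cmd) : cmd := when (fun _ => me = leader w) c.

Definition make_vote (w : nat) (bh : hash) : vote :=
  let h := pid_of bh w in Vote w bh h (Sig me (CVote w bh h)).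

Definition sign_vote (v : vote) : cmd :=
  act (Sign (v_sig v)) ;; note (VotedFor (v_pid v)).

Definition cast_vote : cmd :=
  onstate (fun s =>
    let w := cur_view s in
    let v := make_vote w (block_hash (tip_hd (local_tip s))) in
    sign_vote v ;;
    send (leader w) (MVote v) ;;
    send (leader w.+1) (MVote v)).

Definition on_proposal (src : V) (p : proposal) : cmd :=
  when (fun s => src = leader (p_view p) /\ cur_view s <= p_view p)
    (enter (if p_tc p is Some t then CTC t else CQC (p_qc p)) ;;
     when (fun _ => (qc_view (p_qc p)).+1 = p_view p)
       (is_leader (qc_view (p_qc p)) (broadcast_qc (p_qc p)) ;;
        send (leader (qc_view (p_qc p))) (MQC (p_qc p))) ;;
     commit (p_qc p) ;;
     when (fun s => highest_voted s < p_view p)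
       (ifc (fun _ => fresh p)
          (upd (set_local_tip (tip_of p)))
          (if obind (@tc_high_tip _ _) (p_tc p) is Some T
           then upd (set_local_tip T) else skip) ;;
        cast_vote ;;
        upd (fun s => set_highest_voted (cur_view s) s))).

Definition on_vote (v : vote) : cmd :=
  when (fun s => cur_view s <= v_view v /\
                 (me = leader (v_view v) \/ me = leader (v_view v).+1))
    (note (GotVote v) ;;
     ifsome (fun s => forms_qc (fun x => mem s (GotVote x)) (v_pid v))
       (fun q => enter (CQC q) ;; commit q ;;
          ifc (fun _ => me = leader (v_view v)) (broadcast_qc q) (propose_qc q))
       skip).

Definition on_qc (src : V) (q : qc) : cmd :=
  when (fun s => cur_view s <= qc_view q)
    (when (fun _ => src = leader (qc_view q))
       (enter (CQC q) ;; commit q ;; send (leader (qc_view q).+1) (MQC q)) ;;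
     is_leader (qc_view q) (broadcast_qc q) ;;
     is_leader (qc_view q).+1 (enter (CQC q) ;; commit q ;; propose_qc q)).

(* [last_tc] is present whenever it is used here. *)
Definition last_cer (s : lstate) : cert :=
  if (qc_view (last_qc s)).+1 == cur_view s then CQC (last_qc s)
  else odflt (CQC (last_qc s)) (omap (fun t => CTC t) (last_tc s)).

Definition time_out : cmd :=
  onstate (fun s =>
    let w := cur_view s in
    let T := local_tip s in
    let qT := qc_view (hd_qc (tip_hd T)) in
    let q := last_qc s in
    upd (set_highest_voted w) ;;
    note (SentTimeout w) ;;
    if tip_view T <= qc_view q then
      let sg := Sig me (CTimeout w None (qc_view q)) in
      act (Sign sg) ;;
      broadcast (MTimeout (Timeout w None None (Some q) (last_cer s) sg))
    else
      let v := make_vote w (block_hash (tip_hd T)) in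
      let sg := Sig me (CTimeout w (Some (tip_view T)) qT) in
      sign_vote v ;; act (Sign sg) ;;
      broadcast (MTimeout
        (Timeout w (Some T) (Some v) None (last_cer s) sg))).

Definition relay_tc (t : tc) : cmd :=
  when (fun s => ~ mem s (SentTimeout (tc_view t)) /\
                 ~ mem s (SentTC (tc_view t)))
    (note (SentTC (tc_view t)) ;; broadcast (MTC t)).

Definition on_timeout (M : timeout) : cmd :=
  let c := to_last_cer M in
  let w := to_view M in
  let got s x := mem s (GotTimeout x) in
  when (fun s => cur_view s <= w)
    ((if c is CTC t then relay_tc t else skip) ;;
     enter c ;;
     when (fun s => me = leader (cert_view c).+1 /\
                    ~ has_issued (cert_view c).+1 s)
       (match c with CQC q => propose_qc q | CTC t => propose_tc t end) ;;
     (if c is CQC q then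
        is_leader (qc_view q) (broadcast_qc q) ;;
        send (leader (qc_view q)) (MQC q) ;;
        send (leader (qc_view q).+1) (MQC q) ;;
        commit q
      else skip) ;;
     (if to_tip_vote M is Some v then
        when (fun _ => to_tip M <> None) (note (GotTipVote v))
      else skip) ;;
     ifsome (fun s q => exists v, [/\ to_tip M <> None, to_tip_vote M = Some v
               & forms_qc (fun x => mem s (GotTipVote x)) (v_pid v) q])
       (fun q => enter (CQC q) ;; commit q ;;
          is_leader (qc_view q).+1 (propose_qc q))
       (note (GotTimeout M) ;;
        when (fun s => (exists Ms, timeouts_of (got s) w f.+1 Ms) /\
                       ~ mem s (SentTimeout w))
          time_out ;;
        ifsome (fun s => forms_tc (got s) w)
          (fun t => enter (CTC t) ;; is_leader (tc_view t).+1 (propose_tc t))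
          skip)).

Definition on_tc (t : tc) : cmd :=
  when (fun s => cur_view s <= tc_view t)
    (enter (CTC t) ;; relay_tc t ;; is_leader (tc_view t).+1 (propose_tc t)).

Definition on_proposal_request (src : V) (t : tc) : cmd :=
  when (fun s => src = leader (tc_view t).+1 /\ cur_view s <= (tc_view t).+1)
    (enter (CTC t) ;;
     if tc_high_tip t is Some T then
       ifsome (fun s p => stored s p /\ p_pid p = tip_pid T)
         (fun p => send src (MProposal p)) skip
     else skip).

Definition on_ne_request (src : V) (t : tc) : cmd :=
  let w := (tc_view t).+1 in
  when (fun s => src = leader w /\ cur_view s <= w)
    (enter (CTC t) ;;
     if tc_high_tip t is Some T then
       let qv := qc_view (hd_qc (tip_hd T)) in
       let sg := Sig me (CNE w qv) in
       when (fun s => ~ mem s (VotedFor (tip_pid T)) /\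
                      ~ mem s (SentNE w))
         (act (Sign sg) ;; note (SentNE w) ;; send src (MNE w qv sg))
     else skip).

(* The two ways in which Recover returns.  The result is used only if the
   validator is still in the view for which Recover was called. *)
Definition recover_proposal (p : proposal) : cmd :=
  onstate (fun s =>
    match recov s with
    | Some r =>
        when (fun _ => p_pid p = tip_pid (rec_tip r))
          (upd (set_recov None) ;;
           when (fun s => cur_view s = (tc_view (rec_tc r)).+1)
             (issue (p_block p) (Some (rec_tc r)) None))
    | None => skip
    end).

Definition recover_nec : cmd :=
  onstate (fun s =>
    match recov s with
    | Some r =>
        let w := (tc_view (rec_tc r)).+1 in
        let q := hd_qc (tip_hd (rec_tip r)) in
        ifsome (fun s ne =>
            [/\ nec_view ne = w, nec_high_tip_qc_view ne = qc_view q,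
                aggregates (nec_sigs ne) (CNE w (qc_view q))
              & forall x, List.In x (nec_sigs ne) -> mem s (GotNE x)])
          (fun ne =>
             upd (set_recov None) ;;
             when (fun s => cur_view s = w)
               (issue_new q (Some (rec_tc r)) (Some ne)))
          skip
    | None => skip
    end).

Definition on_start : cmd :=
  enter (CQC genesis_qc) ;; is_leader 1 (propose_qc genesis_qc).

Definition on_deliver (src : V) (m : msg) : cmd :=
  when (fun _ => valid_msg src m)
    (note_all (fun s x => exists q p,
       [/\ x = Stored p, List.In q (qcs_msg m)
         & chain (fun p' => known p' \/ stored s p') (qc_pid q) p]) ;;
     match m with
     | MProposal p => note (Stored p) ;; recover_proposal p ;; on_proposal src p
     | MVote v => on_vote v
     | MQC q => on_qc src q
     | MTimeout M => on_timeout M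
     | MTC t => on_tc t
     | MProposalRequest t => on_proposal_request src t
     | MNERequest t => on_ne_request src t
     | MNE _ _ s => note (GotNE s) ;; recover_nec
     end).

Definition timer_due (s : lstate) : Prop :=
  [/\ 0 < cur_view s, ~ mem s (SentTimeout (cur_view s))
    & (theta_view <= clk - timer s)%R].

Definition on_timer : cmd := fun s s' => timer_due s /\ time_out s s'.

Definition tick_due (r : recovery) (s : lstate) : Prop :=
  [/\ recov s = Some r, rec_asked r != setT
    & (interval P <= clk - rec_tick r)%R].

Definition on_tick : cmd := fun s s' =>
  exists r A, [/\ tick_due r s, next_asked (rec_asked r) A
    & (upd (set_recov (Some (Recovery (rec_tc r) (rec_tip r)
                                      (rec_asked r :|: A) clk))) ;;
       send_all A (MProposalRequest (rec_tc r))) s s'].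

End Handlers.

(* Every event is an event at a correct validator; the behaviour of the
   Byzantine validators consists of the messages they get delivered. *)
Inductive event :=
| Idle
| Start of V
| Timer of V
| Tick of V
| Deliver of V & V & msg.               (* sender, receiver, message *)

Definition actor (e : event) : option V :=
  match e with
  | Idle => None
  | Start i | Timer i | Tick i | Deliver _ i _ => Some i
  end.

(* Event [k] occurs at time [time k] and leads from the local states [st k] to
   the local states [st k.+1].  The states of Byzantine validators are
   irrelevant. *)
Record execution := Execution {
  gst : R;
  delta : R;
  byz : {set V};
  clock : V -> R -> R;
  time : nat -> R;
  ev : nat -> event;
  st : nat -> V -> lstate }.

Section Execution.
Variable E : execution.

Definition correct (i : V) : Prop := i \notin byz E.

Definition known_at (k : nat) (p : proposal) : Prop :=
  exists2 j, correct j & stored (st E k j) p.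

Definition transition (k : nat) : Prop :=
  let clk i := clock E i (time E k) in
  let run i c := [/\ correct i, c (set_log [::] (st E k i)) (st E k.+1 i)
                   & forall j, j != i -> st E k.+1 j = st E k j] in
  match ev E k with
  | Idle => forall j, st E k.+1 j = st E k j
  | Start i => cur_view (st E k i) = 0 /\
               run i (on_start i (clk i))
  | Timer i => run i (on_timer i (clk i))
  | Tick i => run i (on_tick (clk i))
  | Deliver j i m => 0 < cur_view (st E k i) /\
                     run i (on_deliver i (clk i) (known_at k) j m)
  end.

Definition acts (k : nat) (i : V) (a : action) : Prop :=
  actor (ev E k) = Some i /\ List.In a (log (st E k.+1 i)).

Definition well_timed : Prop :=
  [/\ forall k, (time E k <= time E k.+1)%R,
      forall t, exists k, (t <= time E k)%R
    & forall i, correct i ->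
        (forall t u, (t <= u)%R -> (clock E i t <= clock E i u)%R) /\
        (forall t u, (gst E <= t)%R -> (t <= u)%R ->
           clock E i u - clock E i t = u - t)%R].

(* Time does not advance while a timer of a correct validator is due. *)
Definition timers_served : Prop :=
  forall k i t, correct i -> (time E k <= t)%R ->
    (timer_due (clock E i t) (st E k.+1 i) \/
     exists r, tick_due (clock E i t) r (st E k.+1 i)) ->
    (time E k.+1 <= t)%R.

Definition reliable_network : Prop :=
  (forall k i j m, correct i -> correct j -> acts k i (Send j m) ->
     exists k', [/\ k < k', ev E k' = Deliver i j m
       & (time E k' <= Num.max (time E k) (gst E) + delta E)%R]) /\
  (forall k i j m, correct i -> ev E k = Deliver i j m ->
     exists2 k', k' < k & acts k' i (Send j m)).

Definition unforgeable : Prop :=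
  forall k b i m s, ev E k = Deliver b i m -> List.In s (sigs_msg m) ->
    correct (signer s) -> exists2 k', k' < k & acts k' (signer s) (Sign s).

Definition is_execution : Prop :=
  [/\ #|byz E| <= f /\ (0 < delta E <= bigDelta P)%R,
      (forall i, correct i -> st E 0 i = initial) /\
      (forall k, transition k),
      forall i, correct i -> exists2 k, ev E k = Start i & (time E k < gst E)%R,
      well_timed /\ timers_served
    & reliable_network /\ unforgeable].

Definition accepts (k : nat) (i : V) (c : cert) : Prop := acts k i (Accept c).

Definition enters (k : nat) (i : V) (w : nat) : Prop :=
  exists2 c, accepts k i c & (cert_view c).+1 = w.

Definition is_tau (w : nat) (t : R) : Prop :=
  (exists k i, [/\ correct i, enters k i w & time E k = t]) /\
  (forall k i, correct i -> enters k i w -> (t <= time E k)%R).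

Definition post_gst (w : nat) : Prop := exists2 t, is_tau w t & (gst E <= t)%R.

Definition issued_in (w : nat) (p : proposal) : Prop :=
  p_view p = w /\ exists k, mem (st E k (leader w)) (Issued p).

(* [t] is the time at which [i] (first) receives the proposal issued by the leader
   of view [w]. *)
Definition receives_proposal (i : V) (w : nat) (t : R) : Prop :=
  let receives k := exists2 p, issued_in w p
                             & ev E k = Deliver (leader w) i (MProposal p) in
  (exists2 k, receives k & time E k = t) /\
  (forall k, receives k -> (t <= time E k)%R).

Definition commits_by (i : V) (t : R) (b : block) : Prop :=
  exists2 k, (time E k <= t)%R & mem (st E k.+1 i) (Committed b).

End Execution.

End Protocol.

(* Main.v *)
(* A certificate for view w contains signatures of f + 1 correct validators made in
   view w.  Hence views are entered one after the other, and no correct validator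
   times out in a view u >= v before tau(v) + theta_view.

   By tau(v) + 2 delta the leader of v is in view v: the first validator to enter v
   either passes its certificate on to the leader or has timed out like f + 1 other
   correct validators, whose timeout messages then make every correct validator in
   view v - 1 time out.  If the leader lacks the block of the high tip, Recover
   succeeds in time: a correct validator that voted for the tip has the block, and
   if there is none, all correct validators send NE messages.

   Once the proposal of a view w of G is issued, within delta every correct validator
   votes for it or has passed w.  Within another delta the next leader therefore has
   the votes of 2f + 1 validators, or the QC of w from a validator that has passed w,
   and issues its proposal.  So consecutive proposals are 2 delta apart and no TC of
   a view of G exists, which makes the QCs of the proposals consecutive: the Commit
   by which a validator handles the last proposal, or by which it has already left
   the last view, commits all blocks up to the third view from the end. *)
From mathcomp Require Import all_boot all_order all_algebra reals boolp zify ring lra.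
From Stdlib Require List.
Require Import Defs.

Set Implicit Arguments.
Unset Strict Implicit.
Unset Printing Implicit Defensive.
Import Order.TTheory GRing.Theory Num.Theory.

(** The obstacle is that a correct validator also signs votes inside timeout messages, for proposal
    ids that no proposal need have. So a QC of view u leads back to a proposal of u only while no
    correct validator has timed out in u, and every statement must be kept ahead of a deadline.
    [theta_view] is the time for all batches of proposal requests plus 8 [bigDelta]; the first
    proposal takes the batches plus 4 [delta], and 3 [delta] more suffice to issue the next one and
    deliver it, after which nobody can time out in the old view.

    Progress is proved by contradiction. A handler leaves the view as soon as a quorum is complete,
    so between events no validator holds a complete quorum of a view that it has not passed; it is
    enough to show that the messages of a quorum have arrived.

    Recover does not count in (2), because the proposal of v exists by tau(v + 1): without timeouts,
    v is left only through a QC of v. *)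

(** * Lists, maxima and choice *)

Lemma mem_map_In (A : Type) (B : eqType) (g : A -> B) (l : seq A) (b : B) :
  b \in [seq g a | a <- l] -> exists2 a, List.In a l & g a = b.
Proof.
elim: l => [|a l IH] //=; rewrite inE => /orP[/eqP-> | /IH[a' ? ?]].
  by exists a; [left|].
by exists a'; [right|].
Qed.

Lemma In_map_inv (A B : Type) (g : A -> B) (l : seq A) (b : B) :
  List.In b [seq g a | a <- l] -> exists2 a, List.In a l & g a = b.
Proof.
elim: l => [|a l IH] //= [<- | /IH[a' ? ?]]; first by exists a; [left|].
by exists a'; [right|].
Qed.

Lemma In_map (A B : Type) (g : A -> B) (l : seq A) (a : A) :
  List.In a l -> List.In (g a) [seq g a | a <- l].
Proof. by elim: l => [|a' l IH] //= [-> | /IH]; [left|right]. Qed.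

Lemma In_cat (A : Type) (l1 l2 : seq A) (a : A) :
  List.In a (l1 ++ l2) <-> List.In a l1 \/ List.In a l2.
Proof. by elim: l1 => [|a' l IH] /=; [tauto | rewrite IH; tauto]. Qed.

Lemma In_rcons (A : Type) (l : seq A) (a b : A) :
  List.In a (rcons l b) <-> List.In a l \/ a = b.
Proof.
rewrite -cats1 In_cat /=; split=> [[|[|//]]|[|]]; auto.
Qed.

Lemma In_mem (A : eqType) (l : seq A) (a : A) : List.In a l <-> a \in l.
Proof.
elim: l => [|b l IH] //=; rewrite inE IH; split=> [[->|->]|/orP[/eqP->|]];
by rewrite ?eqxx ?orbT; auto.
Qed.

Lemma list_max (A : Type) (r : A -> A -> Prop) (l : seq A) :
  (forall a b, r a b \/ r b a) -> (forall a b c, r a b -> r b c -> r a c) ->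
  l <> [::] -> exists2 a, List.In a l & forall b, List.In b l -> r b a.
Proof.
move=> tot tr; elim: l => [|a l IH] // _.
case: l IH => [|a' l] IH.
  exists a; first by left.
  by move=> b [->|//]; case: (tot b b).
have [//|m ml mmax] := IH.
have [am|ma] := tot a m.
  by exists m; [right | move=> b [<-|/mmax]].
exists a; first by left.
move=> b [<-|/mmax bm]; first by case: (tot a a).
exact: tr bm ma.
Qed.

Lemma nseq_In (A B : Type) (g : A -> B) (l : seq A) (k : nat) (b : B) (a : A) :
  [seq g a | a <- l] = nseq k b -> List.In a l -> g a = b.
Proof.
elim: l k => [|a' l IH] [|k] //= [e /IH h] [<-|/h] //.
Qed.

Lemma map_nseq_const (A B : Type) (g : A -> B) (l : seq A) (b : B) :
  (forall a, List.In a l -> g a = b) -> [seq g a | a <- l] = nseq (size l) b.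
Proof.
elim: l => [|a l IH] h //=; rewrite h; last by left.
by rewrite IH // => a' ?; apply: h; right.
Qed.

Lemma bigmax_In (A : Type) (F : A -> nat) (l : seq A) a :
  List.In a l -> (F a <= \max_(b <- l) F b)%N.
Proof.
elim: l => [|b l IH] //=; rewrite big_cons leq_max => -[->|/IH->];
by rewrite ?leqnn ?orbT.
Qed.

Lemma bigmax_attained (A : Type) (F : A -> nat) (l : seq A) :
  l <> [::] -> exists2 a, List.In a l & F a = \max_(b <- l) F b.
Proof.
elim: l => [|a l IH] // _; rewrite big_cons.
case: leqP => le; last by exists a; [left|].
case: l IH le => [|a' l] IH le.
  by exists a; [left | rewrite big_nil in le *; lia].
by have [//|b bl e] := IH; exists b; [right | rewrite e].
Qed.

(** Finds the event that makes [Q] true: the arrival of the last missing message, or the noting of a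
    fact. *)
Lemma first_flip (Q : nat -> Prop) (K : nat) :
  ~ Q 0 -> Q K -> exists k, [/\ k < K, ~ Q k & Q k.+1]%N.
Proof.
elim: K => [|K IH] // nQ0 QK1.
have [QK|nQK] := pselect (Q K); last by exists K.
by have [k [? ? ?]] := IH nQ0 QK; exists k; split=> //; apply: ltnW.
Qed.

Lemma list_choice (A : Type) (I : eqType) (g : A -> I) (Q : A -> Prop) (l : seq I) :
  (forall i, i \in l -> exists2 a, Q a & g a = i) ->
  exists2 al : seq A, [seq g a | a <- al] = l & forall a, List.In a al -> Q a.
Proof.
elim: l => [|i l IH] h; first by exists [::].
have [|al <- hal] := IH; first by move=> j jl; apply: h; rewrite inE jl orbT.
have [|a Qa <-] := h i; first by rewrite inE eqxx.
by exists (a :: al) => //= b [<-|/hal].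
Qed.

Section MonadBFT.
Variables (R : realType) (P : protocol R).

Local Notation f := (faults P).
Local Notation n := ((3 * f).+1).
Local Notation V := ('I_n).
Local Notation hash := (hash_t P).
Local Notation content := (Defs.content hash).
Local Notation sig := (Defs.sig n hash).
Local Notation vote := (Defs.vote n hash).
Local Notation qc := (Defs.qc n hash).
Local Notation header := (Defs.header n hash).
Local Notation block := (Defs.block n (payload_t P) hash).
Local Notation nec := (Defs.nec n hash).
Local Notation tip := (Defs.tip n hash).
Local Notation tc := (Defs.tc n hash).
Local Notation cert := (Defs.cert n hash).
Local Notation proposal := (Defs.proposal n (payload_t P) hash).
Local Notation timeout := (Defs.timeout n hash).
Local Notation msg := (Defs.msg n (payload_t P) hash).
Local Notation fact := (Defs.fact n (payload_t P) hash).
Local Notation action := (Defs.action n (payload_t P) hash).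
Local Notation recovery := (Defs.recovery n hash R).
Local Notation lstate := (Defs.lstate n (payload_t P) hash R).
Local Notation leader := (leader P).
Local Notation cmd := (@Defs.cmd R P).
Local Notation skip := (@Defs.skip R P).
Local Notation "c1 ;; c2" := (seqc c1 c2) (at level 61, right associativity).
Local Notation mem := (@Defs.mem n (payload_t P) hash R).
Local Notation broadcast := (@Defs.broadcast R P).
Local Notation send_all := (@Defs.send_all R P).
Local Notation send := (@Defs.send R P).
Local Notation act := (@Defs.act R P).
Local Notation note := (@Defs.note R P).
Local Notation enter := (@Defs.enter R P).
Local Notation relay_tc := (@Defs.relay_tc R P).
Local Notation broadcast_qc := (@Defs.broadcast_qc R P).
Local Notation set_recov := (@Defs.set_recov R P).
Local Notation set_log := (@Defs.set_log R P).
Local Notation set_mem := (@Defs.set_mem R P).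
Local Notation stored := (@Defs.stored R P).
Local Notation has_issued := (@Defs.has_issued R P).
Implicit Types (s : lstate) (q : qc) (p : proposal).

(** * Valid messages and quorums *)

Lemma pid_inj (b b' : hash) w w' :
  pid_of b w = pid_of b' w' -> b = b' /\ w = w'.
Proof. by move/(@H_inj _ P) => -[]. Qed.

Lemma header_inj (h h' : header) :
  valid_header h -> valid_header h' -> block_hash h = block_hash h' -> h = h'.
Proof.
case: h h' => [v p q b] [v' p' q' b'] [/= _ ->] [/= _ ->] e.
by have /= [-> -> ->] := H_inj e.
Qed.

Lemma block_inj (b b' : block) :
  valid_block b -> valid_block b' -> hd b = hd b' -> b = b'.
Proof.
case: b b' => [h c] [h' c'] [/= _ e] [/= _ e'] eh; move: e e'; rewrite -eh.
by move=> -> /(@H_inj _ P)[->].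
Qed.

(** Needs more than one validator. A leader that completes a QC of its own view only broadcasts it,
    so the next proposal must be the task of another validator. *)
Lemma leader_succ w : leader w <> leader w.+1.
Proof.
have f0 := faults_gt0 P.
move/(congr1 val); rewrite /= !inordK ?ltn_pmod //.
move=> e; have := modn_small (isT : 0 < n)%N.
have: (1 %% n = 0)%N.
  have : (w + 1 = w + 0 %[mod n])%N by rewrite addn1 addn0.
  by move/eqP; rewrite eqn_modDl mod0n => /eqP.
by rewrite modn_small //; lia.
Qed.

Lemma valid_tcE (c : tc) : valid_tc c ->
  (0 < tc_view c)%N /\
  ((exists q, [/\ tc_high_qc c = Some q, tc_high_tip c = None,
                  valid_qc q & qc_view q < tc_view c]%N) \/
   (exists T, [/\ tc_high_qc c = None, tc_high_tip c = Some T,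
                  valid_tip T & tip_view T <= tc_view c]%N)).
Proof.
case: c => w ts [T|] qs [q|] ss //= [_ _ _ H] //.
  case: H => vT le lt _; split; last by right; exists T.
  by apply: leq_trans le; apply: leq_ltn_trans lt.
case: H => vq lt _ _; split; last by left; exists q.
by apply: leq_ltn_trans lt.
Qed.

Lemma valid_tipE (T : tip) : valid_tip T ->
  [/\ valid_header (tip_hd T), tip_pid T = pid_of (block_hash (tip_hd T)) (tip_view T),
      block_view (tip_hd T) = tip_view T &
      (qc_view (hd_qc (tip_hd T)) < tip_view T)%N].
Proof. by case: T => w h hdr s t ne /= [? ? ? [? ?] _]. Qed.

Lemma valid_tip_gt0 (T : tip) : valid_tip T -> (0 < tip_view T)%N.
Proof. by move/valid_tipE => [_ _ _]; apply: leq_ltn_trans. Qed.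

Lemma valid_proposalE (p : proposal) : valid_proposal p ->
  [/\ valid_block (p_block p),
      p_pid p = pid_of (block_hash (hd (p_block p))) (p_view p),
      p_sig p = Sig (leader (p_view p)) (CProposal (p_pid p)),
      (qc_view (p_qc p) < p_view p)%N & valid_qc (p_qc p)].
Proof.
by move=> [vb ? ? [? ?] _]; split=> //; case: vb => -[].
Qed.

(** The certificate with which [on_proposal] calls [enter] is of the preceding view, so a valid
    proposal leads exactly to its own view. *)
Lemma valid_proposal_cert (p : proposal) : valid_proposal p ->
  match p_tc p with
  | Some t => valid_tc t /\ p_view p = (tc_view t).+1
  | None => p_view p = (qc_view (p_qc p)).+1
  end.
Proof.
move=> [_ _ _ _ [[_ /=]|[_ [_ [t [T [-> ? ? _ _]]]]]]] //.
move=> [_ _ _ _]; case: eqP => [-> [-> _] // |_].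
by case: (p_tc p) => // c [].
Qed.

Lemma valid_proposal_pos (p : proposal) : valid_proposal p -> (0 < p_view p)%N.
Proof. by move=> /valid_proposalE[_ _ _ lt _]; apply: leq_ltn_trans lt. Qed.

Lemma valid_proposal_tip (p : proposal) : valid_proposal p ->
  (fresh p /\ valid_tip (tip_of p)) \/
  (~ fresh p /\ exists t T, [/\ p_tc p = Some t, valid_tc t,
      p_view p = (tc_view t).+1, tc_high_tip t = Some T &
      [/\ hd (p_block p) = tip_hd T, valid_tip T & tip_view T < p_view p]%N]).
Proof.
move=> [_ _ _ _ [[? ?]|[nf [_ [t [T [et vt ev eT eh]]]]]]]; first by left.
right; split=> //; exists t, T; split=> //.
by have [_ [[q [_ e _ _]]|[T' [_ e vT' le]]]] := valid_tcE vt;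
  move: e; rewrite eT // => -[e]; subst T'; split=> //; rewrite ev ltnS.
Qed.

Section NewProposals.
Variables (w : nat) (b : block) (t : option tc) (ne : option nec).
Let p := let h := pid_of (block_hash (hd b)) w in
  Proposal w h b (Sig (leader w) (CProposal h)) t ne.

Lemma valid_propose_qc x (q : qc) : valid_qc q -> w = (qc_view q).+1 ->
  b = new_block w x q -> t = None -> ne = None -> valid_proposal p.
Proof.
move=> vq ew eb et ene; rewrite /p eb et ene ew; split=> //; left; split; first by constructor 1.
by split=> //=; rewrite eqxx.
Qed.

Lemma valid_propose_tc_qc x (q : qc) (c : tc) : valid_tc c -> w = (tc_view c).+1 ->
  tc_high_qc c = Some q -> b = new_block w x q -> t = Some c -> ne = None ->
  valid_proposal p.
Proof.
move=> vc ew eq eb et ene.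
have [_ [[q' [eq' _ vq lt]]|[? [e _ _ _]]]] := valid_tcE vc; last by rewrite e in eq.
move: eq'; rewrite eq => -[e]; subst q'.
have wq : (qc_view q < w)%N by lia.
rewrite /p eb et ene; split=> //.
left; split; first by constructor 3; exists c, q.
by split=> //=; rewrite (_ : (w == _) = false) //; lia.
Qed.

Lemma valid_propose_nec x (c : tc) (T : tip) (e : nec) :
  valid_tc c -> w = (tc_view c).+1 -> tc_high_tip c = Some T ->
  b = new_block w x (hd_qc (tip_hd T)) -> t = Some c -> ne = Some e ->
  nec_view e = w -> nec_high_tip_qc_view e = qc_view (hd_qc (tip_hd T)) ->
  aggregates (nec_sigs e) (CNE w (qc_view (hd_qc (tip_hd T)))) ->
  valid_proposal p.
Proof.
move=> vc ew eT eb et ene e1 e2 agg.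
have [_ [[q' [_ e' _ _]]|[T' [_ e' vT lt]]]] := valid_tcE vc; rewrite e' // in eT.
case: eT => eT; subst T'.
have [[vq _] _ _ ltq] := valid_tipE vT.
have wq : (qc_view (hd_qc (tip_hd T)) < w)%N by lia.
rewrite /p eb et ene; split=> //.
left; split; first by constructor 2.
split=> //=; rewrite (_ : (w == _) = false); last by lia.
split=> //; split=> //; split; first by rewrite e1 e2; lia.
by rewrite e1 e2.
Qed.

(** Such a proposal is never fresh: the QC of the block is older than the tip, the tip is at most of
    the view of the TC, and a TC with a high tip has no high QC. *)
Lemma valid_repropose (c : tc) (T : tip) : valid_block b ->
  valid_tc c -> w = (tc_view c).+1 -> tc_high_tip c = Some T ->
  hd b = tip_hd T -> t = Some c -> ne = None -> valid_proposal p.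
Proof.
move=> vb vc ew eT eh et ene.
have [_ [[q' [_ e' _ _]]|[T' [eq e' vT lt]]]] := valid_tcE vc; rewrite e' // in eT.
case: eT => eT; subst T'.
have [_ _ bv ltq] := valid_tipE vT.
have bvw : (block_view (hd b) < w)%N by rewrite eh bv ew ltnS.
have qvw : ((qc_view (hd_qc (hd b))).+1 < w)%N by rewrite eh; lia.
rewrite /p et ene; split=> //=.
  by split; [apply: ltnW | apply: ltnW].
right; split; last by split=> //; exists c, T; split.
move=> [/= e|//|[c' [q [[<-] e]]]]; last by rewrite eq in e.
by move: qvw; rewrite /p_qc /= in e *; rewrite e ltnn.
Qed.

End NewProposals.

Lemma quorum_correct (B : {set V}) (ss : seq sig) :
  (#|B| <= f)%N -> distinct_quorum ss ->
  exists A : {set V}, (f < #|A|)%N /\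
    forall i, i \in A -> i \notin B /\ exists2 sg, List.In sg ss & signer sg = i.
Proof.
move=> Bf [sz un].
exists ([set i in [seq signer sg | sg <- ss]] :\: B); split; last first.
  move=> i; rewrite in_setD inE => /andP[-> /mem_map_In[sg ? ?]].
  by split=> //; exists sg.
have c : #|[set i in [seq signer sg | sg <- ss]]| = (2 * f).+1.
  by rewrite cardsE (card_uniqP un) size_map sz.
rewrite cardsD c ltn_subRL addnC -addSn mul2n -addnn -addSn leq_add2l.
exact: leq_trans (subset_leq_card (subsetIr _ B)) Bf.
Qed.

Lemma set_take (A : {set V}) (k : nat) : (k <= #|A|)%N ->
  exists l : seq V, [/\ size l = k, uniq l & {subset l <= A}].
Proof.
move=> le; exists (take k (enum A)); split.
- by rewrite size_take -cardE; case: ltnP => // ge; apply/eqP; rewrite eqn_leq ge le.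
- exact/take_uniq/enum_uniq.
- by move=> i /mem_take; rewrite mem_enum.
Qed.

Lemma correct_quorum (B : {set V}) : (#|B| <= f)%N -> (2 * f < #|~: B|)%N.
Proof. by move=> le; have := cardsC B; rewrite card_ord => e; lia. Qed.

(** * Elementary commands *)

Section Within.
Variable rel : lstate -> lstate -> Prop.
Hypothesis rel_refl : forall s, rel s s.
Hypothesis rel_trans : forall s t u, rel s t -> rel t u -> rel s u.

(** Since [rel] is a preorder, a compound command inherits this from its primitive parts. *)
Definition within (c : cmd) := forall s s', c s s' -> rel s s'.

Lemma within_skip : within skip.
Proof. by move=> s s' ->. Qed.

Lemma within_seq c1 c2 : within c1 -> within c2 -> within (c1 ;; c2).
Proof. by move=> h1 h2 s s' [t /h1 r1 /h2 r2]; apply: rel_trans r2. Qed.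

Lemma within_ifc b c1 c2 : within c1 -> within c2 -> within (ifc b c1 c2).
Proof. by move=> h1 h2 s s' [[_ /h1]|[_ /h2]]. Qed.

Lemma within_when b c : within c -> within (when b c).
Proof. by move=> h; apply: within_ifc => //; apply: within_skip. Qed.

Lemma within_choose A (c : A -> cmd) : (forall a, within (c a)) -> within (Defs.choose c).
Proof. by move=> h s s' [a /h]. Qed.

Lemma within_ifsome A b (c1 : A -> cmd) c2 :
  (forall a, within (c1 a)) -> within c2 -> within (ifsome b c1 c2).
Proof. by move=> h1 h2 s s' [[a _ /h1]|[_ /h2]]. Qed.

Lemma within_onstate c : (forall s, within (c s)) -> within (onstate c).
Proof. by move=> h s s' /h. Qed.

End Within.

(** The facts from which quorums are built; only [on_vote] and [on_timeout] note them. *)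
Definition is_got (x : fact) : Prop :=
  match x with GotVote _ | GotTipVote _ | GotTimeout _ => True | _ => False end.

Definition grows (s s' : lstate) : Prop :=
  [/\ cur_view s <= cur_view s', forall x, mem s x -> mem s' x
    & forall a, List.In a (log s) -> List.In a (log s')].

(** Satisfied by every command except [enter] and the recording of votes and timeout messages. New
    quorums and newly accepted certificates therefore need attention at those places only. *)
Definition calm (s s' : lstate) : Prop :=
  [/\ cur_view s' = cur_view s, last_qc s' = last_qc s, grows s s',
      forall x, is_got x -> mem s' x -> mem s x
    & forall c, List.In (Accept c) (log s') -> List.In (Accept c) (log s)].

Lemma grows_refl s : grows s s. Proof. by []. Qed.

Lemma grows_trans s t u : grows s t -> grows t u -> grows s u.
Proof.
by move=> [a b c] [a' b' c']; split; [apply: leq_trans a' | auto | auto].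
Qed.

Lemma calm_refl s : calm s s. Proof. by []. Qed.

Lemma calm_trans s t u : calm s t -> calm t u -> calm s u.
Proof.
move=> [a b c d e] [a' b' c' d' e']; split; [congruence | congruence | | auto | auto].
exact: grows_trans c'.
Qed.

Lemma calm_grows s s' : calm s s' -> grows s s'. Proof. by case. Qed.

Lemma calm_note_all F : (forall s x, F s x -> ~ is_got x) -> within calm (note_all F).
Proof.
move=> h s _ ->; split=> //=; first by split=> //=; left.
by move=> x gx [//|/h].
Qed.

Lemma grows_note_all F : within grows (note_all F).
Proof. by move=> s _ ->; split=> //=; left. Qed.

Lemma calm_act a : (forall c, a <> Accept c) -> within calm (act a).
Proof.
move=> na s _ ->; split=> //=; first by split=> //= b; rewrite In_rcons; left.
by move=> c; rewrite In_rcons => -[//|/esym/na].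
Qed.

Lemma In_sends (a : action) m l :
  List.In a [seq Send j m | j <- l] -> exists j, a = Send j m.
Proof. by move=> h; have [j _ <-] := In_map_inv h; exists j. Qed.

Lemma In_send (A : {set V}) (m : msg) j :
  j \in A -> List.In (Send j m : action) [seq Send j m | j <- enum A].
Proof.
by move=> jA; apply: (@In_map _ _ (fun j : V => Send j m)); apply/In_mem; rewrite mem_enum.
Qed.

Lemma calm_send_all A m : within calm (send_all A m).
Proof.
move=> s _ ->; split=> //=; first by split=> //= b; rewrite In_cat; left.
by move=> c; rewrite In_cat => -[//|/In_sends[]].
Qed.

Lemma calm_set_mem_free g :
  (forall s, [/\ cur_view (g s) = cur_view s, last_qc (g s) = last_qc s,
    mem (g s) = mem s & log (g s) = log s]) -> within calm (upd g).
Proof.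
move=> h s _ ->; have [e1 e2 e3 e4] := h s.
by split=> //; rewrite ?e3 ?e4 //; split; rewrite ?e1 ?e3 ?e4.
Qed.

Section Handlers.
Variables (me : V) (clk : R) (known : proposal -> Prop).

Ltac calm_tac :=
  repeat first
  [ assumption
  | match goal with
    | |- within _ (_ ;; _) => apply: (within_seq calm_trans)
    | |- within _ (when _ _) => apply: (within_when calm_refl)
    | |- within _ (ifc _ _ _) => apply: within_ifc
    | |- within _ (Defs.choose _) => apply: within_choose => ?
    | |- within _ (ifsome _ _ _) => apply: within_ifsome => [?|]
    | |- within _ (onstate _) => apply: within_onstate => ?
    | |- within _ skip => apply: (within_skip calm_refl)
    | |- within _ (act _) => by apply: calm_act
    | |- within _ (send _ _) => by apply: calm_act
    | |- within _ (send_all _ _) => apply: calm_send_all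
    | |- within _ (broadcast _) => apply: calm_send_all
    | |- within _ (note _) => by apply: calm_note_all => ? ? ->
    | |- within _ (upd _) => apply: calm_set_mem_free => //
    end ].

Lemma calm_obtain q : within calm (obtain known q).
Proof. by apply: calm_note_all => s x [p -> _]. Qed.

Lemma calm_commit q : within calm (commit known q).
Proof.
apply: (within_seq calm_trans); first exact: calm_obtain.
by apply: calm_note_all => s x [p [_ _ [[_ ->]|[_ [p' _ ->]]]]].
Qed.

Lemma calm_issue b t ne : within calm (issue me b t ne).
Proof. rewrite /issue; calm_tac. Qed.

Lemma calm_issue_new q t ne : within calm (issue_new me q t ne).
Proof. by rewrite /issue_new; calm_tac; apply: calm_issue. Qed.

Lemma calm_recover t T : within calm (recover clk t T).
Proof. by rewrite /recover; calm_tac. Qed.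

Lemma calm_propose_tc t : within calm (propose_tc me clk t).
Proof.
rewrite /propose_tc; case: tc_high_qc => [q|]; first exact: calm_issue_new.
case: tc_high_tip => [T|]; calm_tac; [exact: calm_issue | exact: calm_recover].
Qed.

Lemma calm_broadcast_qc q : within calm (broadcast_qc q).
Proof. by rewrite /broadcast_qc; calm_tac. Qed.

Lemma calm_relay_tc t : within calm (relay_tc t).
Proof. by rewrite /relay_tc; calm_tac. Qed.

Lemma calm_cast_vote : within calm (cast_vote me).
Proof. by rewrite /cast_vote /sign_vote; calm_tac. Qed.

Lemma calm_time_out : within calm (time_out me).
Proof.
rewrite /time_out; apply: within_onstate => s; calm_tac.
by case: ifP => _; rewrite /sign_vote; calm_tac.
Qed.

Lemma calm_recover_proposal p : within calm (recover_proposal me p).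
Proof.
rewrite /recover_proposal; calm_tac; case: recov => [r|]; calm_tac.
exact: calm_issue.
Qed.

Lemma calm_recover_nec : within calm (recover_nec me).
Proof.
rewrite /recover_nec; calm_tac; case: recov => [r|]; calm_tac.
exact: calm_issue_new.
Qed.

Lemma grows_enter (c : cert) : within grows (enter clk c).
Proof.
move=> s s' [[le ->]|[_ ->]] //; split=> //=; first exact: leqW.
by move=> a ina; rewrite In_rcons; left.
Qed.

Lemma enter_view (c : cert) s s' : enter clk c s s' ->
  cert_view c < cur_view s' /\
  (cur_view s <= (cert_view c).+1 -> cur_view s' = (cert_view c).+1).
Proof.
move=> [[le ->]|[/negP gt ->]] //=; rewrite -ltnNge in gt.
by split=> // le; apply/eqP; rewrite eqn_leq gt le.
Qed.

Lemma enter_fields (c : cert) s s' : enter clk c s s' ->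
  [/\ mem s' = mem s, local_tip s' = local_tip s, highest_voted s' = highest_voted s,
      recov s' = recov s &
      forall a, List.In a (log s') -> List.In a (log s) \/ a = Accept c].
Proof.
move=> [[le ->]|[_ ->]] /=; first by split=> // a; rewrite In_rcons.
by split=> //; left.
Qed.

End Handlers.

(* If the largest reported tip view does not exceed the largest reported QC view,
   then a message reporting the latter has no tip: the QC of a valid tip has a
   smaller view than the tip. *)
Lemma forms_tc_exists (W : timeout -> Prop) w Ms :
  timeouts_of W w (2 * f).+1 Ms ->
  (forall M, List.In M Ms -> exists j, valid_timeout j M) ->
  exists c, forms_tc W w c.
Proof.
move=> TO vM; pose ts := [seq to_tip_view M | M <- Ms].
pose qs := [seq to_qc_view M | M <- Ms].
have Ms0 : Ms <> [::] by move=> e; case: TO; rewrite e.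
case: (ltnP (max_qcs qs) (max_tips ts)) => [lt|ge]; last first.
  have [M MM eM] := bigmax_attained (@to_qc_view n hash) Ms0.
  have eq : to_qc_view M = max_qcs qs by rewrite eM /max_qcs big_map.
  have [q [eT eq']] : exists q, to_tip M = None /\ to_qc M = Some q.
    have [j [_ _ _]] := vM _ MM.
    case eT: (to_tip M) => [T|]; case eqq: (to_qc M) => [q|] //; last by exists q.
    move=> [/valid_tipE[_ _ _ lt] _].
    have le : tip_view T <= max_tips ts.
      rewrite /max_tips big_map.
      have := bigmax_In (fun M => odflt 0 (to_tip_view M)) MM.
      by rewrite {1}/to_tip_view eT.
    by move: eq; rewrite /to_qc_view eT => eq; lia.
  exists (TC w ts None qs (Some q) [seq to_sig M | M <- Ms]); exists Ms, None, (Some q).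
  rewrite /= -/ts -/qs ltnNge ge /=; split=> //; split=> //; exists q; split=> //.
    by exists M.
  by rewrite -eq /to_qc_view eT eq'.
pose tips := pmap (@to_tip _ _) Ms.
have in_tips T : List.In T tips <-> exists2 M, List.In M Ms & to_tip M = Some T.
  rewrite /tips; elim: (Ms) => [|M l IH] /=; first by split=> // -[].
  case eT: (to_tip M) => [T'|] /=; rewrite ?IH.
    split=> [[<-|[M' ? ?]]|[M' [<-|?] e]].
    - by exists M; [left|].
    - by exists M'; [right|].
    - by left; rewrite eT in e; case: e.
    - by right; exists M'.
  split=> [[M' ? ?]|[M' [<-|?] e]]; [by exists M'; [right|] | | by exists M'].
  by rewrite eT in e.
have [M MM eM] := bigmax_attained (fun M => odflt 0 (to_tip_view M)) Ms0.
have [T0 eT0] : exists T0, to_tip M = Some T0.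
  move: lt; rewrite /max_tips big_map -eM /to_tip_view.
  by case: (to_tip M) => [T0|//] _; exists T0.
have tips0 : tips <> [::].
  by move=> e; have /in_tips : exists2 M, List.In M Ms & to_tip M = Some T0;
    [exists M | rewrite e].
pose r (T2 T1 : tip) := tip_view T2 < tip_view T1 \/ (tip_view T2 = tip_view T1 /\
  qc_view (hd_qc (tip_hd T2)) <= qc_view (hd_qc (tip_hd T1))).
have [||T inT maxT] := list_max (r := r) _ _ tips0.
- move=> T1 T2; rewrite /r.
  case: (ltngtP (tip_view T1) (tip_view T2)); [by left; left | by right; left |].
  move=> ->; case: (leqP (qc_view (hd_qc (tip_hd T1))) (qc_view (hd_qc (tip_hd T2)))).
    by left; right.
  by move/ltnW; right; right.
- by rewrite /r => T1 T2 T3; lia.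
exists (TC w ts (Some T) qs None [seq to_sig M | M <- Ms]); exists Ms, (Some T), None.
rewrite /= -/ts -/qs lt; split=> //; split=> //; exists T; split=> //.
  exact/in_tips.
by move=> M' T2 M'M e; apply: maxT; apply/in_tips; exists M'.
Qed.

(** The last part traces the signatures nested in the new TC back to the timeout messages it was
    formed from, from which they inherit their authenticity. *)
Lemma forms_tc_valid (W : timeout -> Prop) w c :
  (forall M, W M -> valid_timeout (signer (to_sig M)) M) -> forms_tc W w c ->
  [/\ valid_tc c, tc_view c = w &
      exists Ms, [/\ timeouts_of W w (2 * f).+1 Ms,
        sigs_tc c = [seq to_sig M | M <- Ms] ++
          (if tc_high_tip c is Some T then sigs_tip T else [::]) ++
          (if tc_high_qc c is Some q then qc_sigs q else [::]),
        (forall T, tc_high_tip c = Some T ->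
           exists2 M, List.In M Ms & to_tip M = Some T) &
        (forall q, tc_high_qc c = Some q ->
           exists2 M, List.In M Ms & to_qc M = Some q)]].
Proof.
move=> vW [Ms [T [q [[sz un inW] -> H]]]].
have vM M : List.In M Ms -> valid_timeout (signer (to_sig M)) M /\ to_view M = w.
  by move=> /inW[/vW].
have Ms0 : Ms <> [::] by move=> e; move: sz; rewrite e.
have dq : distinct_quorum (P:=P) [seq to_sig M | M <- Ms].
  by split; rewrite ?size_map // -map_comp.
have szs : size [seq to_tip_view M | M <- Ms] = (2 * f).+1 /\
           size [seq to_qc_view M | M <- Ms] = (2 * f).+1.
  by rewrite !size_map.
have esg : [seq signed sg | sg <- [seq to_sig M | M <- Ms]] =
    [seq @CTimeout hash w tq.1 tq.2
      | tq <- zip [seq to_tip_view M | M <- Ms] [seq to_qc_view M | M <- Ms]].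
  elim: (Ms) vM => [|M l IH] h //=; rewrite IH; last by move=> M' ?; apply: h; right.
  by have [|[_ _ -> _] ->] := h M; [left|].
have mt T' : (forall M T2, List.In M Ms -> to_tip M = Some T2 ->
    tip_view T2 <= tip_view T') -> max_tips [seq to_tip_view M | M <- Ms] <= tip_view T'.
  move=> h; rewrite /max_tips big_map.
  have [M MM <-] := bigmax_attained (fun M => odflt 0 (to_tip_view M)) Ms0.
  by rewrite /to_tip_view; case e: (to_tip M) => [T2|] //=; apply: h e.
have zipM tv v : (tv, v) \in
    zip [seq to_tip_view M | M <- Ms] [seq to_qc_view M | M <- Ms] ->
    exists2 M, List.In M Ms & to_tip_view M = tv /\ to_qc_view M = v.
  elim: (Ms) => [|M l IH] //=; rewrite inE => /orP[/eqP[-> ->]|/IH[M' ? ?]].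
    by exists M; [left|].
  by exists M'; [right|].
case: ifP H => [lt|ge] [-> ].
  move=> [T' [-> [M MM eM] maxT]]; split=> //; last first.
    by exists Ms; split=> //= [T2 [<-]]; exists M.
  have [vMM wM] := vM _ MM.
  have [_ _ _] := vMM; rewrite eM; case: (to_qc M) => // -[vT [leT _]].
  have mtT : max_tips [seq to_tip_view M | M <- Ms] <= tip_view T'.
    by apply: mt => M' T2 /maxT h /h; lia.
  split=> //.
  split=> //; rewrite -?wM //; first exact: leq_trans lt mtT.
  move=> tv v /zipM[M' M'M []].
  rewrite /to_tip_view /to_qc_view; case e: (to_tip M') => [T2|] //= [<-] <-.
  have [[_ _ _ +] _] := vM _ M'M; rewrite e; case: (to_qc M') => //.
  move=> [/valid_tipE[_ _ _ lt2] _].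
  by split=> //; have := maxT _ _ M'M e; lia.
move=> [q' [-> [M MM [eT eq]] eqv]]; split=> //; last first.
  by exists Ms; split=> //= q2 [<-]; exists M.
have [[_ _ _ +] wM] := vM _ MM; rewrite eT eq => -[vq ltq].
by split=> //; split=> //; rewrite -?wM // eqv leqNgt ge.
Qed.

(** * The local invariant *)

Section Validator.

(* [past] holds of the actions of [me] at earlier events, [auth] of the signatures
   that are not forged, [rc] of the messages delivered to [me] so far; [s0] is the
   state before the current event, and [why u] a reason to time out in view [u]. *)
Variables (me : V) (clk : R) (known : proposal -> Prop) (past : action -> Prop)
  (auth : sig -> Prop) (rc : V -> msg -> Prop) (s0 : lstate) (why : nat -> Prop).

(** Unforgeability speaks of delivered messages only, but a proposal may also be obtained through a
    QC from another validator. Keeping the authenticity of all nested signatures with each stored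
    proposal makes the QCs and TCs inside it usable later. *)
Definition sound (p : proposal) : Prop :=
  p = genesis_proposal P \/
  (valid_proposal p /\ forall sg, List.In sg (sigs_tip (tip_of p)) -> auth sg).

Hypothesis known_sound : forall p, known p -> sound p.

Definition did (s : lstate) (a : action) : Prop := past a \/ List.In a (log s).

(** What a signature of a correct validator proves. A vote of view u is either cast on a proposal of
    u, which is then stored, or is the tip vote of a timeout message of u, and then no proposal need
    have its id. *)
Definition signed_ok (s : lstate) (c : content) : Prop :=
  match c with
  | CVote u bh h => h = pid_of bh u /\ 0 < u <= cur_view s /\
      (mem s (SentTimeout u) \/ exists p, [/\ stored s p, valid_proposal p,
                                             p_view p = u & p_pid p = h])
  | CProposal h => exists2 p, mem s (Issued p) & p_pid p = h
  | CTimeout u _ _ => mem s (SentTimeout u)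
  | CNE _ _ => True
  end.

(** The [i_] fields describe the state. The [m_] fields compare it with [s0], the state before the
    event, and become trivial when [inv_restart] makes [s] the new [s0]. [i_tipst] and [i_voted] let
    a validator that voted for a valid tip answer a proposal request. [i_req] and [m_lead] say that
    a run of Recover ends, within its own view, only by issuing a proposal. *)
Record inv (s : lstate) : Prop := Inv {
  i_lqc : valid_qc (last_qc s);
  i_ltc : forall t, last_tc s = Some t -> valid_tc t;
  i_lqv : qc_view (last_qc s) <= (cur_view s).-1;
  i_lcer : 0 < cur_view s -> (qc_view (last_qc s)).+1 = cur_view s \/
     exists2 t, last_tc s = Some t & (tc_view t).+1 = cur_view s;
  i_tip : local_tip s = genesis_tip P \/ valid_tip (local_tip s);
  i_tipv : tip_view (local_tip s) <= cur_view s;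
  i_tipst : 0 < cur_view s -> tip_view (local_tip s) = cur_view s ->
    exists2 p, stored s p & p_pid p = tip_pid (local_tip s);
  i_stored : forall p, stored s p -> sound p;
  i_hv : highest_voted s <= cur_view s;
  i_voted : forall h T, mem s (VotedFor h) -> valid_tip T -> tip_pid T = h ->
    exists2 p, stored s p & p_pid p = h;
  i_hvs : 0 < highest_voted s ->
    mem s (SentTimeout (highest_voted s)) \/
    exists bh, let x := make_vote me (highest_voted s) bh in
      [/\ did s (Sign (v_sig x)), did s (Send (leader (highest_voted s)) (MVote x))
        & did s (Send (leader (highest_voted s).+1) (MVote x))];
  i_gv : forall x, mem s (GotVote x) -> valid_vote x /\ auth (v_sig x);
  i_gtv : forall x, mem s (GotTipVote x) -> valid_vote x /\ auth (v_sig x);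
  i_gto : forall M, mem s (GotTimeout M) ->
    [/\ valid_timeout (signer (to_sig M)) M
      & forall sg, List.In sg (sigs_msg (MTimeout M : msg)) -> auth sg];
  i_acc : forall c, did s (Accept c) ->
    [/\ valid_cert c, forall sg, List.In sg (sigs_cert c) -> auth sg
      & cert_view c < cur_view s];
  i_cur : 0 < cur_view s -> exists2 c, did s (Accept c) & (cert_view c).+1 = cur_view s;
  i_sgn : forall sg, did s (Sign sg) -> signer sg = me /\ signed_ok s (signed sg);
  i_to : forall u, mem s (SentTimeout u) -> 0 < u <= cur_view s /\
    exists M, [/\ valid_timeout me M, to_view M = u
                & forall j, did s (Send j (MTimeout M))];
  i_iss : forall p, mem s (Issued p) ->
    [/\ valid_proposal p, p_view p <= cur_view s
      & forall j, did s (Send j (MProposal p))];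
  i_uniq : forall p p1, mem s (Issued p) -> mem s (Issued p1) ->
    p_view p = p_view p1 -> p = p1;
  i_req : forall j t, did s (Send j (MNERequest t)) -> tc_view t < cur_view s /\
    ((tc_view t).+1 = cur_view s -> has_issued (cur_view s) s \/
       exists2 r, recov s = Some r & rec_tc r = t);
  i_preq : forall j t, did s (Send j (MProposalRequest t)) -> tc_view t < cur_view s;
  i_rec : forall r, recov s = Some r ->
    [/\ [/\ tc_view (rec_tc r) < cur_view s, valid_tc (rec_tc r),
            tc_high_tip (rec_tc r) = Some (rec_tip r)
          & me = leader (tc_view (rec_tc r)).+1],
        forall sg, List.In sg (sigs_tc (rec_tc r)) -> auth sg,
        forall j, did s (Send j (MNERequest (rec_tc r))),
        forall j, j \in rec_asked r -> did s (Send j (MProposalRequest (rec_tc r)))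
      & minn (kappa P) n <= #|rec_asked r|];
  i_ne : forall w, mem s (SentNE w) ->
    exists t T, [/\ rc (leader w) (MNERequest t), (tc_view t).+1 = w,
      tc_high_tip t = Some T
    & let qv := qc_view (hd_qc (tip_hd T)) in
      did s (Send (leader w) (MNE w qv (Sig me (CNE w qv))))];
  i_mne : forall j w qv sg, did s (Send j (MNE w qv sg)) -> mem s (SentNE w);
  i_stc : forall w, mem s (SentTC w) -> exists t, [/\ valid_tc t, tc_view t = w
    & forall j, did s (Send j (MTC t))];
  i_sqc : forall q, mem s (SentQC q) -> forall j, did s (Send j (MQC q));
  m_cv : cur_view s0 <= cur_view s;
  m_mem : forall x, mem s0 x -> mem s x;
  m_time : (cur_view s = cur_view s0 /\ timer s = timer s0) \/
    [/\ cur_view s0 < cur_view s, timer s = clk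
      & exists2 c, List.In (Accept c) (log s) & (cert_view c).+1 = cur_view s];
  m_acc : forall c, List.In (Accept c) (log s) ->
    List.In (Accept c) (log s0) \/ cur_view s0 <= cert_view c;
  m_accq : forall q, List.In (Accept (CQC q)) (log s) ->
    List.In (Accept (CQC q)) (log s0) \/
    ((qc_view q).+1 = cur_view s -> last_qc s = q);
  m_last : cur_view s = cur_view s0 -> last_qc s = last_qc s0;
  m_lead : forall r, cur_view s = cur_view s0 -> recov s0 = Some r ->
    (tc_view (rec_tc r)).+1 = cur_view s0 -> has_issued (cur_view s) s \/
    exists r', [/\ recov s = Some r', rec_tc r' = rec_tc r, rec_tip r' = rec_tip r
      & r' = r \/ minn (#|rec_asked r| + kappa P) n <= #|rec_asked r'|];
  m_tick : forall r, recov s = Some r -> recov s0 = Some r \/ rec_tick r = clk;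
  m_voted : forall h, mem s (VotedFor h) -> mem s0 (VotedFor h) \/
    exists bh u, h = pid_of bh u /\ cur_view s0 <= u;
  m_tout : forall u, mem s (SentTimeout u) -> mem s0 (SentTimeout u) \/
    (cur_view s0 <= u /\ why u)
}.

Definition new_fact (s : lstate) (x : fact) : Prop :=
  match x with
  | Stored p => sound p
  | GotVote v | GotTipVote v => valid_vote v /\ auth (v_sig v)
  | GotTimeout M => valid_timeout (signer (to_sig M)) M /\
      forall sg, List.In sg (sigs_msg (MTimeout M : msg)) -> auth sg
  | SentTC w => exists t, [/\ valid_tc t, tc_view t = w
                  & forall j, List.In (Send j (MTC t)) (log s)]
  | SentQC q => forall j, List.In (Send j (MQC q)) (log s)
  | GotNE _ | SpecCommitted _ | Committed _ => True
  | _ => False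
  end.

Definition new_action (a : action) : Prop :=
  match a with
  | Send _ (MNERequest _) | Send _ (MProposalRequest _) | Send _ (MNE _ _ _) => False
  | Send _ _ => True
  | _ => False
  end.

(* [ext] covers the harmless steps and is transitive; the others satisfy [step] below. *)
Record ext (s s' : lstate) : Prop := Ext {
  x_cv : cur_view s' = cur_view s;
  x_timer : timer s' = timer s;
  x_tip : local_tip s' = local_tip s;
  x_hv : highest_voted s' = highest_voted s;
  x_lqc : last_qc s' = last_qc s;
  x_ltc : last_tc s' = last_tc s;
  x_rec : recov s' = recov s;
  x_mem : forall x, mem s x -> mem s' x;
  x_log : forall a, List.In a (log s) -> List.In a (log s');
  x_new : forall x, mem s' x -> mem s x \/ new_fact s' x;
  x_act : forall a, List.In a (log s') -> List.In a (log s) \/ new_action a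
}.

Lemma ext_refl s : ext s s.
Proof. by split=> //; left. Qed.

Lemma ext_trans s t u : ext s t -> ext t u -> ext s u.
Proof.
move=> h1 h2; split.
all: try by rewrite ?(x_cv h2) ?(x_timer h2) ?(x_tip h2) ?(x_hv h2) ?(x_lqc h2)
  ?(x_ltc h2) ?(x_rec h2); case: h1.
- by move=> x /(x_mem h1)/(x_mem h2).
- by move=> x /(x_log h1)/(x_log h2).
- move=> x /(x_new h2)[/(x_new h1)[|]|]; [by left | | by right].
  move=> nx; right; case: x nx => //=; last by move=> q h j; apply/(x_log h2)/h.
  by move=> w [c [? ? h]]; exists c; split=> // j; apply/(x_log h2)/h.
- by move=> a /(x_act h2)[/(x_act h1)[|]|]; [left|right|right].
Qed.

Lemma did_mono s s' a : (forall b, List.In b (log s) -> List.In b (log s')) ->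
  did s a -> did s' a.
Proof. by move=> h [|/h]; [left|right]. Qed.

Definition delicate_fact (s s' : lstate) (x : fact) : Prop :=
  match x with
  | VotedFor h =>
      (forall T, valid_tip T -> tip_pid T = h -> exists2 p, stored s' p & p_pid p = h) /\
      exists bh u, h = pid_of bh u /\ cur_view s <= u
  | Issued p =>
      [/\ valid_proposal p, p_view p = cur_view s, ~ has_issued (p_view p) s,
          forall p1, mem s' (Issued p1) -> p_view p1 = p_view p -> p1 = p
        & forall j, List.In (Send j (MProposal p)) (log s')]
  | SentTimeout u =>
      [/\ u = cur_view s, 0 < u, why u
        & exists M, [/\ valid_timeout me M, to_view M = u
                      & forall j, List.In (Send j (MTimeout M)) (log s')]]
  | SentNE w =>
      exists t T, [/\ rc (leader w) (MNERequest t), (tc_view t).+1 = w,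
        tc_high_tip t = Some T
      & let qv := qc_view (hd_qc (tip_hd T)) in
        List.In (Send (leader w) (MNE w qv (Sig me (CNE w qv)))) (log s')]
  | _ => new_fact s' x
  end.

Definition delicate_action (s' : lstate) (a : action) : Prop :=
  match a with
  | Sign sg => signer sg = me /\ signed_ok s' (signed sg)
  | Send _ (MNERequest t) => (tc_view t).+1 = cur_view s' /\
      exists2 r, recov s' = Some r & rec_tc r = t
  | Send _ (MProposalRequest t) => tc_view t < cur_view s'
  | Send _ (MNE w _ _) => mem s' (SentNE w)
  | Send _ _ => True
  | Accept _ => False
  end.

Definition recovery_ok (s' : lstate) (r : recovery) : Prop :=
  [/\ [/\ tc_view (rec_tc r) < cur_view s', valid_tc (rec_tc r),
          tc_high_tip (rec_tc r) = Some (rec_tip r)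
        & me = leader (tc_view (rec_tc r)).+1],
      forall sg, List.In sg (sigs_tc (rec_tc r)) -> auth sg,
      forall j, did s' (Send j (MNERequest (rec_tc r))),
      forall j, j \in rec_asked r -> did s' (Send j (MProposalRequest (rec_tc r)))
    & minn (kappa P) n <= #|rec_asked r|].

(** Compares the two ends of a whole block such as [issue], [voting] or [time_out]. In between the
    invariant fails, since a signature, the fact that justifies it and the messages that the fact
    promises come one after the other. *)
Record step (s s' : lstate) : Prop := Step {
  t_cv : cur_view s' = cur_view s;
  t_timer : timer s' = timer s;
  t_lqc : last_qc s' = last_qc s;
  t_ltc : last_tc s' = last_tc s;
  t_mem : forall x, mem s x -> mem s' x;
  t_log : forall a, List.In a (log s) -> List.In a (log s');
  t_new : forall x, mem s' x -> mem s x \/ delicate_fact s s' x;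
  t_act : forall a, List.In a (log s') -> List.In a (log s) \/ delicate_action s' a;
  t_tip : local_tip s' = local_tip s \/
    [/\ valid_tip (local_tip s'), tip_view (local_tip s') <= cur_view s'
      & tip_view (local_tip s') = cur_view s' ->
        exists2 p, stored s' p & p_pid p = tip_pid (local_tip s')];
  t_hv : highest_voted s' = highest_voted s \/
    highest_voted s' <= cur_view s' /\
    (mem s' (SentTimeout (highest_voted s')) \/
     exists bh, let x := make_vote me (highest_voted s') bh in
      [/\ did s' (Sign (v_sig x)), did s' (Send (leader (highest_voted s')) (MVote x))
        & did s' (Send (leader (highest_voted s').+1) (MVote x))]);
  t_rec : [\/ recov s' = recov s,
      recov s' = None /\ forall r, recov s = Some r ->
        (tc_view (rec_tc r)).+1 = cur_view s -> has_issued (cur_view s) s'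
    | exists r', [/\ recov s' = Some r', recovery_ok s' r', rec_tick r' = clk
        & forall r, recov s = Some r -> (tc_view (rec_tc r)).+1 < cur_view s \/
            [/\ rec_tc r' = rec_tc r, rec_tip r' = rec_tip r
              & minn (#|rec_asked r| + kappa P) n <= #|rec_asked r'|]]]
}.

Lemma signed_ok_mono s s' c : cur_view s <= cur_view s' ->
  (forall x, mem s x -> mem s' x) -> signed_ok s c -> signed_ok s' c.
Proof.
move=> le Mm; case: c => [u bh h|h|u a b|//] /=; last exact: Mm.
  move=> [-> [/andP[-> h1] h2]]; split=> //; split; first exact: leq_trans h1 le.
  case: h2 => [/Mm|[p [/Mm a b c d]]]; first by left.
  by right; exists p; split.
by move=> [p /Mm a b]; exists p.
Qed.

Lemma inv_step s s' : inv s -> step s s' -> inv s'.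
Proof.
move=> I X.
have D a : did s a -> did s' a by apply: did_mono; apply: t_log X.
have D' a : did s' a -> did s a \/ delicate_action s' a.
  by case=> [|/(t_act X)[]]; [left; left | left; right | right].
have N := t_new X; have Mm := t_mem X.
have HI w : has_issued w s -> has_issued w s' by move=> [p /Mm ? ?]; exists p.
split; rewrite ?(t_cv X) ?(t_timer X) ?(t_lqc X) ?(t_ltc X); try by case: I.
- by case: (t_tip X) => [->|[]]; [case: I | right].
- by case: (t_tip X) => [->|[]]; [case: I | rewrite (t_cv X)].
- move=> c0; case: (t_tip X) => [-> e|[_ _]]; last by rewrite (t_cv X).
  by have [p ? ?] := i_tipst I c0 e; exists p; [exact: Mm|].
- by move=> p /N[/(i_stored I)|].
- by case: (t_hv X) => [->|[]]; [case: I | rewrite (t_cv X)].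
- move=> h T /N[m|/= [h1 _]] vT e; last exact: h1 vT e.
  by have [p ? ?] := i_voted I m vT e; exists p; [exact: Mm|].
- case: (t_hv X) => [->|[_ //]] h0.
  case: (i_hvs I h0) => [h|[bh [/D a /D b /D c]]]; first by left; exact: Mm.
  by right; exists bh.
- by move=> x /N[/(i_gv I)|].
- by move=> x /N[/(i_gtv I)|].
- by move=> M /N[/(i_gto I)|[]].
- by move=> c /D'[/(i_acc I)|].
- by move=> c0; have [c /D ? ?] := i_cur I c0; exists c.
- move=> sg /D'[/(i_sgn I)[-> h]|//]; split=> //.
  by apply: signed_ok_mono h; rewrite ?(t_cv X).
- move=> u /N[/(i_to I)[-> [M [? ? h]]]|[-> -> _ [M [? ? h]]]].
    by split=> //; exists M; split=> // j; apply: D.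
  by split; [rewrite leqnn | exists M; split=> // j; right].
- move=> p /N[/(i_iss I)[? ? h]|[? -> _ _ h]].
    by split=> // j; apply: D.
  by split=> // j; right.
- move=> p q mp mq e.
  have [op|[_ _ _ h _]] := N _ mp; last by symmetry; apply: h.
  have [oq|[_ _ _ h _]] := N _ mq; last exact: h.
  exact: i_uniq I _ _ op oq e.
- move=> j t /D'[/(i_req I)[h1 h]|/= []]; last by rewrite (t_cv X) => <- h; split=> // _; right.
  split=> // e; have [/HI|[r er ert]] := h e; first by left.
  case: (t_rec X) => [->|[-> h2]|[r' [-> _ _ h2]]]; first by right; exists r.
    by left; apply: h2 er _; rewrite ert.
  have [lt|[e1 _ _]] := h2 _ er; first by move: lt; rewrite ert e ltnn.
  by right; exists r' => //; rewrite e1.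
- by move=> j t /D'[/(i_preq I)|/=]; rewrite ?(t_cv X).
- move=> r; case: (t_rec X) => [->|[-> _]|[r' [-> h _ _]]] //; last first.
    by move=> [<-]; case: h => -[]; rewrite (t_cv X).
  by move=> /(i_rec I)[? ? h h' ?]; split=> // j; [apply: D | move/h'/D].
- move=> w /N[/(i_ne I)[t [T [? ? ? h]]]|[t [T [? ? ? h]]]].
    by exists t, T; split=> //; apply: D.
  by exists t, T; split=> //; right.
- by move=> j w qv sg /D'[/(i_mne I)/Mm|].
- move=> w /N[/(i_stc I)[t [? ? h]]|[t [? ? h]]]; exists t; split=> // j.
    exact: D.
  by right.
- by move=> q /N[/(i_sqc I) h j|h j]; [apply: D | right].
- by move=> x /(m_mem I)/Mm.
- case: (m_time I) => [|[? ? [c ? ?]]]; [by left | right; split=> //].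
  by exists c => //; apply: t_log X _ _.
- by move=> c /(t_act X)[/(m_acc I)|].
- by move=> q /(t_act X)[/(m_accq I)|].
- move=> r e er etc; have [/HI|[r1 [er1 e1 e2 h1]]] := m_lead I e er etc; first by left.
  case: (t_rec X) => [->|[-> h2]|[r' [-> _ _ h2]]]; first by right; exists r1.
    by left; apply: h2 er1 _; rewrite e1 e.
  have [lt|[e3 e4 h3]] := h2 _ er1; first by move: lt; rewrite e1 etc e ltnn.
  right; exists r'; split; rewrite ?e3 ?e4 //; right.
  case: h1 h3 => [->//|h1] h3; apply: leq_trans h1 (leq_trans _ h3).
  rewrite leq_min -[X in _ && (_ <= X)](card_ord n) max_card andbT.
  exact: leq_addr.
- move=> r; case: (t_rec X) => [->|[-> _]|[r' [-> _ e _]]] //; last first.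
    by move=> [<-]; right.
  exact: (m_tick I).
- move=> h /N[/(m_voted I)//|/= [_ [bh [u [-> le]]]]].
  by right; exists bh, u; split=> //; apply: leq_trans (m_cv I) le.
- move=> u /N[/(m_tout I)//|[-> _ ? _]]; right; split=> //; exact: (m_cv I).
Qed.

Lemma inv_ext s s' : inv s -> ext s s' -> inv s'.
Proof.
move=> I X; apply: (inv_step I); split; first [exact: x_cv X | exact: x_timer X
  | exact: x_lqc X | exact: x_ltc X | exact: x_mem X | exact: x_log X
  | by left; exact: x_tip X | by left; exact: x_hv X | by constructor 1; exact: x_rec X | idtac].
- by move=> x /(x_new X)[|]; [left | case: x; right].
- by move=> a /(x_act X)[|na]; [left | right; case: a na => [j []||]].
Qed.

Lemma ext_note_all F : (forall s x, inv s -> F s x -> new_fact s x /\ (forall w, x <> SentTC w) /\ (forall q, x <> SentQC q)) ->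
  forall s s', inv s -> note_all F s s' -> ext s s'.
Proof.
move=> h s s' I ->; split=> //=; first by left.
  move=> x [|/(h s x I)[nx [n1 n2]]]; [by left | right].
  by case: x nx n1 n2 => //= [w ? /(_ w)|q ? _ /(_ q)].
by left.
Qed.

Lemma ext_note x : new_fact (initial P) x -> within ext (note x).
Proof.
move=> h s _ ->; split=> //=; [by left | | by left].
move=> y [|->]; [by left | right].
by case: x h => //= w [t [_ _ /(_ me)]].
Qed.

Lemma ext_send j m : new_action (Send j m) -> within ext (send j m).
Proof.
move=> h s _ ->; split=> //=; try by left.
  by move=> a; rewrite In_rcons; left.
by move=> a; rewrite In_rcons => -[|->]; [left|right].
Qed.

Lemma broadcast_log m s s' : broadcast m s s' -> forall j, List.In (Send j m) (log s').
Proof.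
by move=> -> j; rewrite /= In_cat; right; apply: In_send; rewrite inE.
Qed.

Lemma chain_sound (K : proposal -> Prop) h p :
  (forall p, K p -> sound p) -> chain K h p -> sound p.
Proof. by move=> h1; case=> [p1 /h1|p1 r _ /h1]. Qed.

Lemma ext_obtain q s s' : inv s -> obtain known q s s' -> ext s s'.
Proof.
move=> I0; apply: ext_note_all I0 => s2 x I [p -> ch]; split=> //=.
by apply: chain_sound ch => r [/known_sound|/(i_stored I)].
Qed.

Lemma ext_commit q s s' : inv s -> commit known q s s' -> ext s s'.
Proof.
move=> I [t h1 h2]; have x1 := ext_obtain I h1.
apply: (ext_trans x1); apply: (ext_note_all _ (inv_ext I x1) h2).
by move=> s2 x _ [p [_ _ [[_ ->]|[_ [p' _ ->]]]]].
Qed.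

Lemma ext_broadcast_qc q : within ext (broadcast_qc q).
Proof.
move=> s s' [[_ [t h1 h2]]|[_ ->]]; last exact: ext_refl.
have b := broadcast_log h2.
rewrite h1 in h2; rewrite h2 in b *; split=> //=.
- by left.
- by move=> a ha; rewrite In_cat; left.
- by move=> x [|->]; [left | right=> /=].
- by move=> a; rewrite In_cat => -[|/In_sends[j ->]]; [left|right].
Qed.

Lemma ext_relay_tc t : valid_tc t -> within ext (relay_tc t).
Proof.
move=> vt s s' [[_ [u h1 h2]]|[_ ->]]; last exact: ext_refl.
have b := broadcast_log h2.
rewrite h1 in h2; rewrite h2 in b *; split=> //=.
- by left.
- by move=> a ha; rewrite In_cat; left.
- by move=> x [|->]; [left | right; exists t].
- by move=> a; rewrite In_cat => -[|/In_sends[j ->]]; [left|right].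
Qed.

Lemma inv_enter (c : cert) s s' : inv s -> valid_cert c ->
  (forall sg, List.In sg (sigs_cert c) -> auth sg) -> enter clk c s s' -> inv s'.
Proof.
move=> I vc ac [[le ->]|[_ ->]] //.
have lt : cur_view s < (cert_view c).+1 by [].
set t1 := LState _ _ _ _ _ _ _ _ _.
have D a : did s a -> did t1 a.
  by apply: did_mono => b; rewrite /= In_rcons; left.
have D' a : did t1 a -> did s a \/ a = Accept c.
  by case=> [|/=]; [left; left | rewrite In_rcons => -[|]; [left; right | right]].
(* The view has strictly grown, which makes the fields about an unchanged view vacuous. *)
have ncv T : cur_view t1 = cur_view s0 -> T.
  by move=> e; exfalso; have := m_cv I; rewrite -e leqNgt /= lt.
split=> //=; try by case: I.
- by destruct c => //; apply: i_lqc I.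
- by move=> t; destruct c as [q|c] => /=; [exact: (i_ltc I) | case=> <-].
- destruct c as [q|c] => //=.
  by apply: leq_trans (i_lqv I) _; apply: leq_trans (leq_pred _) le.
- by move=> _; destruct c as [q|c]; [left | right; exists c].
- exact: leq_trans (i_tipv I) (ltnW lt).
- by move=> _ e; have := i_tipv I; rewrite e leqNgt lt.
- exact: leq_trans (i_hv I) (ltnW lt).
- move=> h0; case: (i_hvs I h0) => [h|[bh [/D a /D b /D c']]]; first by left.
  by right; exists bh.
- by move=> c' /D'[/(i_acc I)[? ? h]|[->]]; split=> //; apply: ltn_trans lt.
- by move=> _; exists c => //; right; rewrite /= In_rcons; right.
- move=> sg /D'[/(i_sgn I)[-> h]|//]; split=> //; move: h; rewrite /signed_ok.
  case: (signed sg) => [u bh h|h|u a b|//] //.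
  by move=> [-> [/andP[-> h1] h2]]; do 2!split=> //; exact: leq_trans h1 (ltnW lt).
- move=> u /(i_to I)[/andP[-> h] [M [? ? h']]]; split; first exact: leq_trans h (ltnW lt).
  by exists M; split=> // j; apply: D.
- move=> p /(i_iss I)[? h ?]; split=> //; first exact: leq_trans h (ltnW lt).
  by move=> j; apply: D.
- move=> j t /D'[/(i_req I)[h _]|//]; split; first exact: ltn_trans lt.
  by move=> [e]; move: h; rewrite e ltnNge le.
- by move=> j t /D'[/(i_preq I) h|//]; apply: ltn_trans lt.
- move=> r /(i_rec I)[[h ? ? ?] ? h1 h2 ?]; split=> //; first by split=> //; apply: ltn_trans lt.
    by move=> j; apply: D.
  by move=> j /h2/D.
- by move=> w /(i_ne I)[t [T [? ? ? h]]]; exists t, T; split=> //; apply: D.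
- by move=> j w qv sg /D'[/(i_mne I)|].
- by move=> w /(i_stc I)[t [? ? h]]; exists t; split=> // j; apply: D.
- by move=> q /(i_sqc I) h j; apply: D.
- exact: leq_trans (m_cv I) (ltnW lt).
- right; split=> //; first exact: leq_ltn_trans (m_cv I) lt.
  by exists c => //; rewrite In_rcons; right.
- move=> c'; rewrite In_rcons => -[/(m_acc I)//|[->]]; right.
  exact: leq_trans (m_cv I) le.
(* A QC accepted earlier has a view below the old current view, so it is not the one that led to the
   new view. *)
- move=> q; rewrite In_rcons => -[ac'|[<-]]; last by right.
  by right=> e; have [_ _ /=] := i_acc I (or_intror ac'); rewrite e /= ltnNge le.
- exact: ncv.
- by move=> r; apply: ncv.
Qed.

Let pid_of_block (b : block) w := pid_of (block_hash (hd b)) w.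

Definition own_proposal w (b : block) t ne : proposal :=
  Proposal w (pid_of_block b w) b (Sig me (CProposal (pid_of_block b w))) t ne.

(** The parameter [o] joins to [issue] the clearing of [recov] that precedes it when Recover
    returns: between the two the leader has neither a proposal nor a running Recover, and the
    invariant fails. *)
Lemma step_issue o b t ne s s' : (o = recov s \/ o = None) ->
  valid_proposal (own_proposal (cur_view s) b t ne) ->
  issue me b t ne (set_recov o s) s' ->
  step s s' /\ has_issued (cur_view s) s'.
Proof.
move=> ho vp [|[]]; last first.
  move=> nn; have hi : has_issued (cur_view s) s by apply: contrapT => h; apply: nn.
  move=> ->; split=> //; split=> //=; try by left.
  by case: ho => ->; [constructor 1 | constructor 2].
move=> [nh [s1 e1 [s2 e2 e3]]].
rewrite {}e1 in e2; rewrite {}e2 in e3; rewrite {}e3.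
have hi : has_issued (cur_view s) (set_log
  (log (set_mem (fun x => mem s x \/ x = Issued (own_proposal (cur_view s) b t ne)) s) ++
    [::]) (set_mem (fun x => mem s x \/ x = Issued (own_proposal (cur_view s) b t ne)) s)).
  by exists (own_proposal (cur_view s) b t ne) => //; right.
split=> //; split=> //=.
- by left.
- by move=> a ha; rewrite In_cat In_rcons; left; left.
- move=> x [|->]; [by left | right].
  split=> //.
    move=> q [mq|[<-]] // e; exfalso; apply: nh; exists q => //.
  move=> j; rewrite In_cat; right.
  by apply: In_send; rewrite inE.
- move=> a; rewrite In_cat In_rcons => -[[|->]|/In_sends[j ->]]; [by left | right | by right].
  split=> //=; exists (own_proposal (cur_view s) b t ne) => //; by right.
- by left.
- by left.
- by case: ho => ->; [constructor 1 | constructor 2].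
Qed.

Lemma set_recov_id s : set_recov (recov s) s = s.
Proof. by case: s. Qed.

Lemma inv_issue b t ne s s' : inv s ->
  valid_proposal (own_proposal (cur_view s) b t ne) ->
  issue me b t ne s s' -> inv s' /\ has_issued (cur_view s) s'.
Proof.
move=> I vp h; have h1 : issue me b t ne (set_recov (recov s) s) s' by rewrite set_recov_id.
have [st hi] := step_issue (or_introl erefl) vp h1.
by split=> //; apply: inv_step st.
Qed.

Lemma inv_propose_qc q s s' : inv s -> valid_qc q -> me = leader (cur_view s) ->
  cur_view s = (qc_view q).+1 -> propose_qc me q s s' ->
  inv s' /\ has_issued (cur_view s) s'.
Proof.
move=> I vq l e [x]; apply: inv_issue => //.
by rewrite /own_proposal l; apply: valid_propose_qc e _ _ _.
Qed.

(** The one stored proposal that may have an invalid block is the genesis proposal, and its view 0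
    is not the view of a valid tip. *)
Lemma stored_block s p T : inv s -> stored s p -> valid_tip T ->
  hd (p_block p) = tip_hd T -> valid_block (p_block p).
Proof.
move=> I /(i_stored I)[->|[/valid_proposalE[] //]] vT e.
have [_ _ bv _] := valid_tipE vT.
by have := valid_tip_gt0 vT; rewrite -bv -e.
Qed.

Lemma next_asked_exists (B : {set V}) :
  exists A, next_asked B A /\ minn (#|B| + kappa P) n <= #|B :|: A|.
Proof.
have [l [sl ul hl]] := set_take (geq_minr (kappa P) #|~: B|).
have dj : [disjoint B & [set i in l]].
  rewrite disjoint_sym disjoint_subset; apply/subsetP => i; rewrite inE => /hl.
  by rewrite !inE.
have ca : #|[set i in l]| = minn (kappa P) #|~: B| by rewrite cardsE (card_uniqP ul).
exists [set i in l]; split; first by split.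
rewrite cardsU (_ : B :&: _ = set0); last by apply/eqP; rewrite setI_eq0.
rewrite cards0 subn0 ca; have := cardsC B; rewrite card_ord; lia.
Qed.

Lemma next_asked_card (B A : {set V}) : next_asked (P:=P) B A ->
  minn (#|B| + kappa P) n <= #|B :|: A|.
Proof.
move=> [dj ca]; rewrite cardsU (_ : B :&: _ = set0); last by apply/eqP; rewrite setI_eq0.
by rewrite cards0 subn0 ca; have := cardsC B; rewrite card_ord; lia.
Qed.

Lemma inv_recover t T s s' : inv s -> valid_tc t ->
  (forall sg, List.In sg (sigs_tc t) -> auth sg) -> me = leader (cur_view s) ->
  cur_view s = (tc_view t).+1 -> tc_high_tip t = Some T -> recover clk t T s s' ->
  inv s' /\ exists2 r, recov s' = Some r & (tc_view (rec_tc r)).+1 = cur_view s.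
Proof.
(* If the call is ignored, the running Recover has a TC at least as high as [t] and below the
   current view, hence belongs to the current view. *)
move=> I vt at_ l e eT [[g]|[g ->]]; last first.
  split=> //; have [r [er nlt]] : exists r, recov s = Some r /\ ~ tc_view (rec_tc r) < tc_view t.
    apply: contrapT => h; apply: g => r er; apply: contrapT => h2; apply: h.
    by exists r.
  exists r => //; have [[lt _ _ _] _ _ _ _] := i_rec I er.
  by move/negP: nlt; rewrite -leqNgt; lia.
have [A0 [nA0 _]] := next_asked_exists set0.
case=> [[A [dj ca] [s1 -> [s2 -> ->]]]|[h _]]; last by case: (h A0).
split; last by exists (Recovery t T A clk).
apply: (inv_step I); split=> //=; try by left.
- by move=> a; rewrite !In_cat; left; left.
- move=> a; rewrite !In_cat => -[[|/In_sends[j ->]]|/In_sends[j ->]]; [by left | right | right].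
    by split=> //; exists (Recovery t T A clk).
  by rewrite /= e.
- constructor 3; exists (Recovery t T A clk); split=> //=.
    split=> //=.
    + by split=> //; rewrite ?e // -e.
    + move=> j; right; rewrite /= !In_cat; left; right.
      by apply: In_send; rewrite inE.
    + move=> j jA; right; rewrite /= !In_cat; right.
      by apply: In_send.
    + by rewrite ca setC0 cardsT card_ord.
  by move=> r /g; rewrite e; left.
Qed.

Lemma inv_propose_tc t s s' : inv s -> valid_tc t ->
  (forall sg, List.In sg (sigs_tc t) -> auth sg) -> me = leader (cur_view s) ->
  cur_view s = (tc_view t).+1 -> propose_tc me clk t s s' ->
  inv s' /\ (has_issued (cur_view s) s' \/
             exists2 r, recov s' = Some r & (tc_view (rec_tc r)).+1 = cur_view s).
Proof.
move=> I vt at_ l e; rewrite /propose_tc.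
have [_ [[q [eq eT vq lt]]|[T [eq eT vT le]]]] := valid_tcE vt; rewrite eq ?eT.
  move=> [x] h; have [|I' hi] := inv_issue I _ h; last by split=> //; left.
  by rewrite /own_proposal l; apply: valid_propose_tc_qc e eq _ _ _.
move=> [[p [sp ep] h]|[_ h]]; last first.
  by have [I' h'] := inv_recover I vt at_ l e eT h; split=> //; right.
have [|I' hi] := inv_issue I _ h; last by split=> //; left.
rewrite /own_proposal l; exact: (valid_repropose (stored_block I sp vT ep) vt e eT ep).
Qed.

Lemma inv_recover_proposal p s s' : inv s -> valid_proposal p ->
  recover_proposal me p s s' -> inv s' /\
  forall r, recov s = Some r -> p_pid p = tip_pid (rec_tip r) ->
    cur_view s = (tc_view (rec_tc r)).+1 -> has_issued (cur_view s) s'.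
Proof.
move=> I vp; rewrite /recover_proposal /onstate; case er: (recov s) => [r|]; last by move=> ->.
have [[lt vt eT l] at_ _ _ _] := i_rec I er.
move=> [[ep [s1 e1]]|[nep ->]]; last by split=> // r' [<-].
rewrite e1 => -[[/= ev h]|[/= nv ->]]; last first.
  split; last by move=> r' [<-] _ e; case: nv.
  apply: (inv_step I); split=> //=; try by left.
  by constructor 2; split=> // r'; rewrite er => -[<-] e; case: nv.
have [_ [[? [_ e _ _]]|[T [eq eT' vT le]]]] := valid_tcE vt; first by rewrite e in eT.
move: eT'; rewrite eT => -[eT']; subst T.
have [vh1 pT bv _] := valid_tipE vT.
have [vb epid _ _ _] := valid_proposalE vp.
(* The proposal id fixes the block hash and this fixes the header, so the received block is the one
   that the tip stands for. *)
have [ebh _] : block_hash (hd (p_block p)) = block_hash (tip_hd (rec_tip r)) /\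
    p_view p = tip_view (rec_tip r) by apply: pid_inj; rewrite -epid ep pT.
have ehd : hd (p_block p) = tip_hd (rec_tip r) by apply: header_inj ebh => //; case: vb.
have [|st hi] := step_issue (o := None) (s := s) (or_intror erefl) _ h.
  rewrite /own_proposal l -ev.
  exact: (valid_repropose vb vt ev eT ehd).
by split; [apply: inv_step st | move=> *].
Qed.

Lemma inv_recover_nec s s' : inv s -> recover_nec me s s' -> inv s' /\
  forall r, recov s = Some r -> cur_view s = (tc_view (rec_tc r)).+1 ->
    (exists ne : nec,
      let q := hd_qc (tip_hd (rec_tip r)) in
      [/\ nec_view ne = cur_view s, nec_high_tip_qc_view ne = qc_view q,
          aggregates (nec_sigs ne) (CNE (cur_view s) (qc_view q))
        & forall x, List.In x (nec_sigs ne) -> mem s (GotNE x)]) ->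
    has_issued (cur_view s) s'.
Proof.
move=> I; rewrite /recover_nec /onstate; case er: (recov s) => [r|]; last by move=> ->.
have [[lt vt eT l] at_ _ _ _] := i_rec I er.
move=> [[ne [e1 e2 agg gne] [s1 es1]]|[nne ->]]; last first.
  split=> // r' [<-] e [ne]; rewrite e => -[h1 h2 h3 h4].
  by case: (nne ne).
rewrite es1 => -[[/= ev h]|[/= nv ->]]; last first.
  split; last by move=> r' [<-] e; case: nv.
  apply: (inv_step I); split=> //=; try by left.
  by constructor 2; split=> // r'; rewrite er => -[<-] e; case: nv.
have [x h'] := h.
have [|st hi] := step_issue (o := None) (s := s) (or_intror erefl) _ h'.
  rewrite /own_proposal l -ev.
  by apply: (valid_propose_nec (x := x) vt ev eT); rewrite ?ev.
by split; [apply: inv_step st | move=> *].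
Qed.

Definition voting (p : proposal) : cmd :=
  when (fun s => highest_voted s < p_view p)
       (ifc (fun _ => fresh p)
          (upd (set_local_tip (tip_of p)))
          (if obind (@tc_high_tip _ _) (p_tc p) is Some T
           then upd (set_local_tip T) else skip) ;;
        cast_vote me ;;
        upd (fun s => set_highest_voted (cur_view s) s)).

Lemma inv_voting p s s' : inv s -> valid_proposal p -> stored s p ->
  cur_view s = p_view p -> voting p s s' ->
  inv s' /\ p_view p <= highest_voted s'.
Proof.
move=> I vp sp ev [[lt [s1 h1 [s2 h2 ->]]]|[/negP nlt ->]]; last by split=> //; rewrite leqNgt.
have [T [e1 [vT leT tT eh]]] : exists T, s1 = set_local_tip T s /\
    [/\ valid_tip T, tip_view T <= p_view p,
        tip_view T = p_view p -> p_pid p = tip_pid T & hd (p_block p) = tip_hd T].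
  have [[fr vT]|[nfr [t [T [et vt ev' eT [eh vT ltT]]]]]] := valid_proposal_tip vp.
    by case: h1 => [[_ ->]|[/(_ fr)]] //; exists (tip_of p).
  case: h1 => [[/nfr]|[_]] //; rewrite et /= eT => ->; exists T; split=> //.
  by split=> //; [exact: ltnW | move=> e; rewrite e ltnn in ltT].
have [vb epid _ _ _] := valid_proposalE vp.
have [s3 [t1 -> ->] [s4 -> ->]] := h2; rewrite e1 /= {e1 h1 h2 s1 s2 s3 s4 t1}.
(* For a reproposal the vote is computed from the older tip [T]; as [T] has the same header, the
   vote still carries the id of [p]. *)
have ex : pid_of (block_hash (tip_hd T)) (cur_view s) = p_pid p by rewrite epid ev eh.
have p0 := valid_proposal_pos vp.
split; last by rewrite /= ev.
apply: (inv_step I); split=> //=; try by left.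
- by move=> a ha; rewrite !In_rcons; do 3!left.
- move=> y [|->]; [by left | right]; rewrite /= ex; split.
    by move=> T' _ _; exists p => //; left.
  by exists (block_hash (hd (p_block p))), (p_view p); rewrite epid ev.
- move=> a; rewrite !In_rcons => -[[[|->]|->]|->]; [by left | right | by right | by right].
  split=> //=; split=> //; rewrite ev p0 leqnn; split=> //; right; exists p.
  by split=> //; [left | rewrite -ex ev].
- right; split=> //; rewrite ev // => /tT e; exists p => //; by left.
- right; split=> //; right; exists (block_hash (tip_hd T)).
  by split; right; rewrite /= !In_rcons; [do 2!left; right | left; right | right].
- by constructor 1.
Qed.

Lemma inv_time_out s s' : inv s -> 0 < cur_view s -> why (cur_view s) ->
  time_out me s s' -> inv s' /\ mem s' (SentTimeout (cur_view s)).
Proof.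
move=> I c0 wy.
have qlt : qc_view (last_qc s) < cur_view s by have := i_lqv I; lia.
have [vc ec] : valid_cert (last_cer s) /\ (cert_view (last_cer s)).+1 = cur_view s.
  rewrite /last_cer; case: eqP => [e|ne]; first by split=> //; apply: (i_lqc I).
  have [//|[t et e]] := i_lcer I c0.
  by rewrite et; split=> //; apply: (i_ltc I).
move=> [s1 -> [s2 ->]]; case: ifP => [le|/negbT gt].
  move=> [s3 -> ->]; split; last by right.
  apply: (inv_step I); split=> //=; try by left.
  - by move=> a ha; rewrite In_cat In_rcons; do 2!left.
  - move=> x [|->]; [by left | right; split=> //].
    eexists; split; last first.
    + move=> j; rewrite In_cat; right.
      by apply: In_send; rewrite inE.
    + by [].
    + by split=> //=; split=> //; apply: (i_lqc I).
  - move=> a; rewrite In_cat In_rcons => -[[|->]|/In_sends[j ->]]; [by left| right | by right].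
    by split=> //=; right.
  - by right; split=> //; left; right.
  - by constructor 1.
rewrite -ltnNge in gt.
have vT : valid_tip (local_tip s) by case: (i_tip I) gt => // ->.
have [vh _ bv _] := valid_tipE vT.
move=> [s3 [s4 -> ->] [s5 -> ->]] /=; split; last by left; right.
apply: (inv_step I); split=> //=.
- by left; left.
- by move=> a ha; rewrite In_cat !In_rcons; do 3!left.
- move=> x [[|->]|->]; [by left | right | right].
    split=> //; eexists; split; last first.
    + move=> j; rewrite In_cat; right.
      by apply: In_send; rewrite inE.
    + by [].
    + split=> //=; split=> //; split; first exact: i_tipv I.
      by eexists; first by [].
  split; last by eexists _, _.
  (* A tip vote counts as a vote for its id, so the proposal must be at hand if a valid tip has that
     id. Such a tip shares its block with [local_tip], and a valid tip has the view of its block; so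
     [local_tip] is from the current view and [i_tipst] applies. *)
  move=> T' vT' eT'.
  have [vh' pT' bv' _] := valid_tipE vT'.
  have [eb ew] : block_hash (tip_hd T') = block_hash (tip_hd (local_tip s)) /\
     tip_view T' = cur_view s by apply: pid_inj; rewrite -pT'.
  have eh := header_inj vh' vh eb.
  have [|p sp ep] := i_tipst I c0; first by rewrite -bv -eh bv'.
  have [_ pT _ _] := valid_tipE vT.
  exists p; first by do 2!left.
  by rewrite ep pT -eb -bv -eh bv' ew.
- move=> a; rewrite In_cat !In_rcons => -[[[|->]|->]|/In_sends[j ->]];
    [by left| right | right | by right].
    by split=> //=; rewrite c0 leqnn; do 2!split=> //; left; left; right.
  by split=> //=; left; right.
- by left.
- by right; split=> //; left; left; right.
- by constructor 1.
Qed.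

Lemma inv_tick s s' : inv s -> on_tick clk s s' -> inv s'.
Proof.
move=> I [r [A [[er nT _] [dj ca] [s1 -> ->]]]].
have [[lt vt eT l] at_ h1 h2 h3] := i_rec I er.
have L (j : V) m l0 : j \in A -> List.In (Send j m : action) (l0 ++ [seq Send j m | j <- enum A]).
  move=> jA; rewrite In_cat; right.
  by apply: In_send.
apply: (inv_step I); split=> //=; try by left.
- by move=> a; rewrite !In_cat; left.
- by move=> a; rewrite !In_cat => -[|/In_sends[j ->]]; [left | right].
- constructor 3; exists (Recovery (rec_tc r) (rec_tip r) (rec_asked r :|: A) clk).
  split=> //=; last first.
    by move=> r'; rewrite er => -[<-]; right; split=> //; apply: next_asked_card.
  split=> //=; last exact: leq_trans h3 (subset_leq_card (subsetUl _ _)).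
    by move=> j; case: (h1 j); [left | right; rewrite /= In_cat; left].
  move=> j; rewrite in_setU => /orP[/h2[]|jA]; [by left | |].
    by right; rewrite /= In_cat; left.
  by right; exact: L.
Qed.

Definition answer_ne src (t : tc) (T : tip) : cmd :=
  let w := (tc_view t).+1 in
  let qv := qc_view (hd_qc (tip_hd T)) in
  let sg := Sig me (CNE w qv) in
  when (fun s => ~ mem s (VotedFor (tip_pid T)) /\ ~ mem s (SentNE w))
    (act (Sign sg) ;; note (SentNE w) ;; send src (MNE w qv sg)).

Lemma inv_answer_ne src t T s s' : inv s -> src = leader (tc_view t).+1 ->
  rc src (MNERequest t) -> tc_high_tip t = Some T -> answer_ne src t T s s' ->
  inv s' /\ (mem s' (VotedFor (tip_pid T)) \/ mem s' (SentNE (tc_view t).+1)).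
Proof.
move=> I esrc hrc eT [[_ [s1 -> [s2 -> ->]]]|[ng ->]]; last first.
  split=> //; apply: contrapT => h; apply: ng.
  by split=> h'; apply: h; [left | right].
split; last by right; right.
apply: (inv_step I); split=> //=; try by left.
- by move=> a ha; rewrite !In_rcons; do 2!left.
- move=> x [|->]; [by left | right].
  exists t, T; split=> //; first by rewrite -esrc.
  by rewrite /= In_rcons -esrc; right.
- by move=> a; rewrite !In_rcons => -[[|->]|->]; [left | right | right=> /=; right].
- by constructor 1.
Qed.

(** * Handlers *)

Definition quiet (s s' : lstate) : Prop :=
  grows s s' /\ forall x, is_got x -> mem s' x -> mem s x.

Lemma quiet_trans s t u : quiet s t -> quiet t u -> quiet s u.
Proof. by move=> [g h] [g' h']; split; [apply: grows_trans g' | auto]. Qed.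

Lemma calm_quiet s s' : calm s s' -> quiet s s'.
Proof. by move=> [_ _ g h _]; split. Qed.

Lemma enter_quiet (c : cert) s s' : enter clk c s s' -> quiet s s'.
Proof. by move=> h; split; [apply: grows_enter h | move=> x _; case: (enter_fields h) => ->]. Qed.

(** No quorum of view u is left without its consequence. Progress arguments exhibit a quorum that
    contradicts this. The last clause lets tip votes be counted as timeout messages. *)
Definition quorum_ok (u : nat) (s : lstate) : Prop :=
  [/\ me = leader u \/ me = leader u.+1 ->
        forall bh q, ~ forms_qc (fun x => mem s (GotVote x)) (pid_of bh u) q,
      forall Ms, timeouts_of (fun M => mem s (GotTimeout M)) u f.+1 Ms ->
        mem s (SentTimeout u),
      forall Ms, ~ timeouts_of (fun M => mem s (GotTimeout M)) u (2 * f).+1 Ms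
    & forall x, mem s (GotTipVote x) -> v_view x = u ->
        exists2 M, mem s (GotTimeout M) &
          to_view M = u /\ signer (to_sig M) = signer (v_sig x)].

Definition quorums_ok (s : lstate) : Prop :=
  forall u, cur_view s <= u -> quorum_ok u s.

Lemma forms_qc_sub (W W' : vote -> Prop) h q : (forall x, W x -> W' x) ->
  forms_qc W h q -> forms_qc W' h q.
Proof. by move=> sub [a b c]; split=> // sg /c/sub. Qed.

Lemma timeouts_of_sub (W W' : timeout -> Prop) w k Ms : (forall x, W x -> W' x) ->
  timeouts_of (P:=P) W w k Ms -> timeouts_of (P:=P) W' w k Ms.
Proof. by move=> sub [a b c]; split=> // M /c[/sub]. Qed.

Lemma timeouts_of_take (W : timeout -> Prop) w k k' Ms : k' <= k ->
  timeouts_of (P:=P) W w k Ms -> timeouts_of (P:=P) W w k' (take k' Ms).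
Proof.
move=> le [a b c]; split.
- by rewrite size_take a; case: ltnP => // ge; apply/eqP; rewrite eqn_leq le ge.
- by rewrite map_take take_uniq.
- move=> M h; apply: c; rewrite -(cat_take_drop k' Ms) In_cat; by left.
Qed.

Lemma quorum_ok_quiet u s s' : quiet s s' -> quorum_ok u s -> quorum_ok u s'.
Proof.
move=> [[_ g _] h] [q1 q2 q3 q4]; split.
- move=> l bh q fq; apply: (q1 l bh q); apply: forms_qc_sub fq => x; exact: h.
- move=> Ms ts; apply/g/(q2 Ms); apply: timeouts_of_sub ts => x; exact: h.
- move=> Ms ts; apply: (q3 Ms); apply: timeouts_of_sub ts => x; exact: h.
- by move=> x /h h1 /(q4 _ (h1 I))[M /g m ?]; exists M.
Qed.

Lemma quorums_ok_quiet s s' : quiet s s' -> quorums_ok s -> quorums_ok s'.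
Proof.
move=> qs Q u le; apply: (quorum_ok_quiet qs); apply: Q.
by case: qs => -[le' _ _] _; apply: leq_trans le' le.
Qed.

(** A leader that accepts a QC proposes at once; only a TC can leave it without a proposal, and then
    Recover is running. The inequality records that the view was not entered by a QC, which is what
    (3) rests on. *)
Definition lead_ok (s : lstate) : Prop := 0 < cur_view s ->
  me = leader (cur_view s) -> has_issued (cur_view s) s \/
  (qc_view (last_qc s)).+1 < cur_view s /\
  exists2 r, recov s = Some r & (tc_view (rec_tc r)).+1 = cur_view s.

Definition timeout_quorum (u : nat) : Prop :=
  exists2 A : {set V}, 2 * f < #|A| & forall i, i \in A ->
    exists a b, auth (Sig i (CTimeout u a b)).

(* How the current view was entered, and why its leader will learn about it. *)
Inductive entry (s : lstate) (u : nat) : Prop :=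
| EntryProposal p of valid_proposal p & rc (leader u) (MProposal p) & p_view p = u
| EntryRequest t of rc (leader u) (MProposalRequest t) \/ rc (leader u) (MNERequest t)
    & (tc_view t).+1 = u
| EntryLeader of me = leader u
| EntryQC q of valid_qc q & (qc_view q).+1 = u & did s (Send (leader u) (MQC q))
| EntryTC t of valid_tc t & (tc_view t).+1 = u & did s (Send (leader u) (MTC t))
| EntryTimeout of mem s (SentTimeout u.-1) & timeout_quorum u.-1.

Lemma entry_grows s s' u : grows s s' -> entry s u -> entry s' u.
Proof.
move=> [_ g1 g2]; have D a : did s a -> did s' a by apply: did_mono.
case.
- by move=> p *; exact: (EntryProposal _ (p := p)).
- by move=> t *; exact: (EntryRequest _ (t := t)).
- by move=> *; exact: EntryLeader.
- by move=> q ? ? /D *; exact: (EntryQC (q := q)).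
- by move=> q ? ? /D *; exact: (EntryTC (t := q)).
- by move=> /g1 *; exact: EntryTimeout.
Qed.

Definition entry_ok (s : lstate) : Prop := 1 < cur_view s -> entry s (cur_view s).

(** Ancestors range over the proposals known to any correct validator, since [commit] first obtains
    everything that the QC leads to. *)
Definition commits (q : qc) (s : lstate) : Prop :=
  forall parent p, known parent -> p_pid parent = qc_pid q ->
    qc_view q = (qc_view (p_qc parent)).+1 -> chain known (qc_pid (p_qc parent)) p ->
    mem s (Committed (p_block p)).

Lemma commits_grows q s s' : grows s s' -> commits q s -> commits q s'.
Proof. by move=> [_ g _] h parent p a b c d; apply/g/(h parent). Qed.

Lemma chain_sub (K K' : proposal -> Prop) h p :
  (forall p, K p -> K' p) -> chain K h p -> chain K' h p.
Proof.
move=> sub; elim=> [p' /sub k e|p' p1 _ ch /sub k e]; first exact: chain_here.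
exact: chain_parent ch k e.
Qed.

Lemma chain_trans (K : proposal -> Prop) h p1 p :
  chain K h p1 -> chain K (qc_pid (p_qc p1)) p -> chain K h p.
Proof.
move=> c1; elim=> [p' k e|p' p2 _ ch k e]; first exact: chain_parent c1 k e.
exact: chain_parent ch k e.
Qed.

Lemma chain_stored (K K' : proposal -> Prop) h p :
  (forall p, chain K h p -> K' p) -> chain K h p -> chain K' h p.
Proof.
move=> sub; elim=> [p' k e|p' p1 c ch k e].
  by apply: (chain_here _ e); apply: sub; apply: chain_here.
by apply: (chain_parent ch _ e); apply: sub; exact: (chain_parent c k e).
Qed.

Lemma commit_commits q s s' : commit known q s s' -> commits q s'.
Proof.
move=> [t -> ->] parent p kp e1 e2 ch.
have st p1 : chain known (qc_pid q) p1 -> stored (set_mem (fun x => mem s x \/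
   (exists2 p, x = Stored p & chain (fun p' => known p' \/ stored s p') (qc_pid q) p)) s) p1.
  by move=> c; right; exists p1 => //; apply: chain_sub c => *; left.
have cp : chain known (qc_pid q) parent by apply: chain_here.
right; exists parent; split=> //; first exact: st.
right; split=> //; exists p => //.
by apply: chain_stored ch => p1 ch; apply: st; apply: chain_trans ch.
Qed.

(* The log holds the actions of the current event: the QCs accepted so far, except
   possibly [o], have been followed by a Commit. *)
Definition committed_but (o : option qc) (s : lstate) : Prop :=
  forall q, List.In (Accept (CQC q)) (log s) -> o = Some q \/ commits q s.

Lemma committed_calm o s s' : calm s s' -> committed_but o s -> committed_but o s'.
Proof.
move=> [_ _ g _ h] C q /h/C[|]; [by left | right].
exact: commits_grows g _.
Qed.

Lemma committed_enter_qc q s s' : enter clk (CQC q) s s' ->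
  committed_but None s -> committed_but (Some q) s'.
Proof.
move=> h C q1; have g := grows_enter h.
have [_ _ _ _ hl] := enter_fields h; move/hl=> [/C[//|c]|[->]]; last by left.
by right; apply: commits_grows c.
Qed.

Lemma committed_enter_tc (t : tc) s s' : enter clk (CTC t) s s' ->
  committed_but None s -> committed_but None s'.
Proof.
move=> h C q1; have g := grows_enter h.
have [_ _ _ _ hl] := enter_fields h; move/hl=> [/C[//|c]|//].
by right; apply: commits_grows c.
Qed.

Lemma committed_commit q s s' : commit known q s s' ->
  committed_but (Some q) s -> committed_but None s'.
Proof.
move=> h C q1 i1; have cm := calm_commit h.
have [[e]|?] := committed_calm cm C i1; last by right.
by right; rewrite -e; apply: commit_commits h.
Qed.

Lemma forms_qc_valid (W : vote -> Prop) bh w q :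
  (forall x, W x -> valid_vote x /\ auth (v_sig x)) -> forms_qc W (pid_of bh w) q ->
  [/\ valid_qc q, qc_view q = w, forall sg, List.In sg (qc_sigs q) -> auth sg
    & forall sg, List.In sg (qc_sigs q) -> signed sg = CVote w bh (pid_of bh w)].
Proof.
move=> hW [e agg hq].
have [sg isg] : exists sg, List.In sg (qc_sigs q).
  by case: (qc_sigs q) agg => [[[]]//|sg l _]; exists sg; left.
have [[/= e1 _] _] := hW _ (hq _ isg).
have [ebh ew] : qc_block_hash q = bh /\ qc_view q = w by apply: pid_inj; rewrite -e1.
split=> //; first by right.
  by move=> sg' /hq/hW[].
move=> sg' i'; have [_ agg2] := agg; have := nseq_In agg2 i'.
by rewrite ebh ew e.
Qed.

Hypothesis auth_own : forall sg, auth sg -> signer sg = me -> past (Sign sg).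
Hypothesis rc_own : forall m, rc me m -> past (Send me m).
Hypothesis inv0 : inv s0.
Hypothesis lead0 : lead_ok s0.
Hypothesis entry0 : entry_ok s0.

Definition entered_ok (s : lstate) : Prop := lead_ok s /\ entry_ok s.

Lemma entered_same s : inv s -> grows s0 s -> cur_view s = cur_view s0 -> entered_ok s.
Proof.
move=> I g e; have [_ g1 g2] := g; split; last first.
  by rewrite /entry_ok e => h; exact: (entry_grows g (entry0 h)).
rewrite /lead_ok e => c0 l; have [[p m ev]|[h1 [r er etc]]] := lead0 c0 l.
  by left; exists p => //; apply: g1.
have [|[r' [er' e1 _ _]]] := m_lead I e er etc; first by rewrite e; left.
by right; rewrite (m_last I e); split=> //; exists r' => //; rewrite e1.
Qed.

(** By unforgeability, a leader that enters its view on a proposal for that view has signed this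
    proposal before, hence has issued it. *)
Lemma own_proposal_issued p u s : inv s -> valid_proposal p ->
  (forall sg, List.In sg (sigs_tip (tip_of p)) -> auth sg) ->
  p_view p = u -> me = leader u -> has_issued u s.
Proof.
move=> I vp ap ev l; have [_ epid esg _ _] := valid_proposalE vp.
have a : past (Sign (p_sig p)).
  by apply: auth_own; [apply: ap; left | rewrite esg ev].
have [_] := i_sgn I (or_introl a); rewrite esg /= => -[p' m' e'].
exists p' => //; have [vp' _ _] := i_iss I m'.
have [_ epid' _ _ _] := valid_proposalE vp'.
by rewrite epid' epid in e'; have [_ ->] := pid_inj e'.
Qed.

Lemma on_proposal_spec src p s s' : inv s -> grows s0 s -> cur_view s = cur_view s0 ->
  valid_proposal p -> stored s p -> rc src (MProposal p) ->
  (forall sg, List.In sg (sigs_tip (tip_of p)) -> auth sg) ->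
  committed_but None s -> on_proposal me clk known src p s s' ->
  [/\ inv s', entered_ok s', quiet s s', committed_but None s'
    & src = leader (p_view p) -> p_view p < cur_view s' \/
      [/\ cur_view s' = p_view p, p_view p <= highest_voted s' & commits (p_qc p) s']].
Proof.
move=> I g0 ecv vp sp hrc ap C0 [[[esrc le]]|[ng ->]]; last first.
  split=> //; first exact: entered_same.
  by move=> e; left; rewrite ltnNge; apply/negP => h; apply: ng.
move=> [s1 h1 [s2 h2 [s3 h3 h4]]].
set c := (if _ is Some _ then _ else _) in h1.
have [vc ac ec] : [/\ valid_cert c, forall sg, List.In sg (sigs_cert c) -> auth sg
    & (cert_view c).+1 = p_view p].
  have := valid_proposal_cert vp; rewrite /c; case et: (p_tc p) => [t|] /=.
    move=> [vt ev]; split=> // sg isg; apply: ap; right; rewrite /= et !In_cat; tauto.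
  move=> ev; have [_ _ _ _ vq] := valid_proposalE vp; split=> // sg isg.
  by apply: ap; right; rewrite /= !In_cat; tauto.
have I1 := inv_enter I vc ac h1.
have [_ ev1] := enter_view h1; rewrite ec in ev1.
have {}ev1 : cur_view s1 = p_view p by apply: ev1.
have q1 := enter_quiet h1.
have [x2 c2] : ext s1 s2 /\ calm s1 s2.
  case: h2 => [[_ [t k1 k2]]|[_ ->]]; last by split=> //; exact: ext_refl.
  have [x c3] : ext s1 t /\ calm s1 t.
    case: k1 => [[_ k]|[_ ->]]; last by split=> //; exact: ext_refl.
    by split; [exact: (ext_broadcast_qc k) | exact: calm_broadcast_qc k].
  split; first by apply: (ext_trans x); by apply: (ext_send _ k2).
  by apply: calm_trans c3 _; apply: calm_act k2.
have I2 := inv_ext I1 x2.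
have x3 := ext_commit I2 h3.
have c3 := calm_commit h3; have I3 := inv_ext I2 x3.
have m3 : mem s3 (Stored p).
  case: q1 c2 c3 => -[_ g1 _] _ [_ _ [_ g2 _] _ _] [_ _ [_ g3 _] _ _].
  exact/g3/g2/g1.
have ev3 : cur_view s3 = p_view p by rewrite (x_cv x3) (x_cv x2).
have [I4 hv4] := inv_voting I3 vp m3 ev3 h4.
have c4 : calm s3 s'.
  case: h4 => [[_ [t1 k1 [t2 /calm_cast_vote k2 ->]]]|[_ ->]] //.
  have : calm s3 t1.
    case: k1 => [[_ ->]|[_]] //; by case: obind => [T|] ->.
  move=> k1'; apply: calm_trans (calm_trans k1' k2) _.
  by case: t2 {k2}.
have c13 := calm_trans (calm_trans c2 c3) c4.
have ev' : cur_view s' = p_view p by case: c13 => ->.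
have gg : grows s s' by apply: (grows_trans (grows_enter h1)); case: c13.
split=> //; last 1 first.
- move=> _; right; split=> //.
  by apply: commits_grows (commit_commits h3); case: c4.
- have [e|ne] := eqVneq (cur_view s') (cur_view s0).
    by apply: entered_same => //; apply: grows_trans gg.
  split=> [_ l|_]; rewrite ev'; last by apply: (EntryProposal _ vp) => //; rewrite -esrc.
  by left; apply: (own_proposal_issued I4 vp ap) => //; rewrite -ev'.
- exact: quiet_trans q1 (calm_quiet c13).
- rewrite /c in h1; case et: (p_tc p) h1 => [t|] h1.
    by apply: committed_calm c13 _; apply: committed_enter_tc h1 C0.
  apply: committed_calm c4 _; apply: committed_commit h3 _.
  by apply: committed_calm c2 _; apply: committed_enter_qc h1 C0.
Qed.

Lemma broadcast_qc_sent q s s' : broadcast_qc q s s' -> mem s' (SentQC q).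
Proof.
move=> [[_ [t -> ->]]|[h ->]]; first by right.
by apply: contrapT.
Qed.

Lemma quorum_note_vote u x s s' : inv s -> valid_vote x -> auth (v_sig x) -> v_view x <> u ->
  note (GotVote x) s s' -> quorum_ok u s -> quorum_ok u s'.
Proof.
move=> I vx ax ne -> [q1 q2 q3 q4]; split=> /=.
- move=> l bh q fq; apply: (q1 l bh q); move: (fq) => [a b c]; split=> // sg isg.
  have [//|[e]] := c _ isg.
  have [|_ e2 _ _] := forms_qc_valid _ fq.
    by move=> y [/(i_gv I)|[->]].
  by case: ne; rewrite -e /=.
- move=> Ms ts; left; apply: (q2 Ms); apply: timeouts_of_sub ts; by move=> y [|].
- move=> Ms ts; apply: (q3 Ms); apply: timeouts_of_sub ts; by move=> y [|].
- by move=> y [/q4 h /h[M ? ?]|//]; exists M => //; left.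
Qed.

Lemma quorum_note_timeout u M s s' : to_view M <> u ->
  note (GotTimeout M) s s' -> quorum_ok u s -> quorum_ok u s'.
Proof.
move=> ne -> [q1 q2 q3 q4]; split=> /=.
- by move=> l bh q fq; apply: (q1 l bh q); apply: forms_qc_sub fq => y [].
- move=> Ms ts; left; apply: (q2 Ms); case: ts => a b c; split=> // M' /c[[//|[->]] //].
- move=> Ms ts; apply: (q3 Ms); case: ts => a b c; split=> // M' /c[[//|[->]] //].
- by move=> y [/q4 h /h[M' ? ?]|//]; exists M' => //; left.
Qed.

Lemma committed_log o s s' : grows s s' -> log s' = log s ->
  committed_but o s -> committed_but o s'.
Proof.
move=> g e C q; rewrite e => /C[|]; [by left | right].
exact: (commits_grows g).
Qed.

Lemma on_vote_spec x s s' : inv s -> grows s0 s -> cur_view s = cur_view s0 ->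
  valid_vote x -> auth (v_sig x) -> committed_but None s ->
  on_vote me clk known x s s' ->
  [/\ inv s', entered_ok s', quorums_ok s -> quorums_ok s', committed_but None s'
    & me = leader (v_view x) \/ me = leader (v_view x).+1 ->
      v_view x < cur_view s' \/ mem s' (GotVote x)].
Proof.
move=> I g0 ecv vx ax C0 [[[le lm] [s1 h1 h2]]|[ng ->]]; last first.
  split=> //; first by apply: (entered_same I).
  by move=> lm; left; rewrite ltnNge; apply/negP => h; apply: ng.
have x1 : ext s s1 by apply: ext_note h1.
have I1 := inv_ext I x1.
have m1 : mem s1 (GotVote x) by rewrite h1; right.
have g01 : grows s s1 by apply: grows_note_all h1.
have C1 : committed_but None s1 by apply: (committed_log g01 _ C0); rewrite h1.
have g1 : grows s0 s1 by exact: grows_trans g0 g01.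
have ev1 : cur_view s1 = cur_view s0 by rewrite (x_cv x1).
have hW y : mem s1 (GotVote y) -> valid_vote y /\ auth (v_sig y) by exact: (i_gv I1).
have [epid _] := vx.
case: h2 => [[q fq [t1 k1 [t2 k2 k3]]]|[nq ->]]; last first.
  split=> //; [exact: (entered_same I1) | | by right].
  move=> Q u; rewrite ev1 -ecv => leu; have qu := Q _ leu.
  have [eu|ne] := eqVneq (v_view x) u; last first.
    by apply: (quorum_note_vote I vx ax _ h1 qu); apply/eqP.
  move: qu; rewrite h1 => -[q1 q2 q3 q4]; split=> /=.
  - move=> l bh q fq.
    (* A QC for another block hash does not contain the new vote, so it could have been formed
       before. *)
    have [ebh|nebh] := pselect (bh = v_block_hash x).
      by apply: (nq q); rewrite h1 epid eu -ebh.
    apply: (q1 l bh q); move: (fq) => [a b c]; split=> // sg isg.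
    have [//|[e]] := c _ isg.
    by case: nebh; move: epid; rewrite -e /= a => /pid_inj[].
  - move=> Ms ts; left; apply: (q2 Ms); apply: timeouts_of_sub ts; by move=> y [|].
  - move=> Ms ts; apply: (q3 Ms); apply: timeouts_of_sub ts; by move=> y [|].
  - by move=> y [/q4 h /h[M ? ?]|//]; exists M => //; left.
rewrite epid in fq; have [vq eqv aq _] := forms_qc_valid hW fq.
have I2 := inv_enter (c := CQC q) I1 vq aq k1.
have [_ ev2] := enter_view k1; rewrite /= eqv in ev2.
have {}ev2 : cur_view t1 = (v_view x).+1 by apply: ev2; rewrite ev1 -ecv; exact: leqW.
have I3 := inv_ext I2 (ext_commit I2 k2).
have c2 := calm_commit k2.
have ev3 : cur_view t2 = (v_view x).+1 by case: c2 => ->.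
have C3 := committed_commit k2 (committed_enter_qc k1 C1).
have [I4 c4 en] : [/\ inv s', calm t2 s' & entered_ok s'].
  case: k3 => [[l k]|[nl k]].
    have x4 := ext_broadcast_qc k; have I4 := inv_ext I3 x4.
    split=> //; first exact: calm_broadcast_qc k.
    split; rewrite /lead_ok /entry_ok (x_cv x4) ev3.
      (* The validator that merely broadcasts the QC does not lead the view it enters, so it owes no
         proposal there. *)
      by move=> _ l'; case: (@leader_succ (v_view x)); rewrite -l -l'.
    move=> _; apply: (EntryQC vq); first by rewrite eqv.
    exact: (i_sqc I4 (broadcast_qc_sent k)).
  have l : me = leader (v_view x).+1 by case: lm.
  have [I4 hi] : inv s' /\ has_issued (cur_view t2) s'.
    by apply: (inv_propose_qc I3 vq _ _ k); rewrite ?ev3 ?eqv.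
  have c4 := calm_issue_new k; have [e4 _ _ _ _] := c4.
  split=> //; split; rewrite /lead_ok /entry_ok e4 ev3.
    by rewrite -ev3; left.
  by move=> _; apply: EntryLeader.
have ev4 : cur_view s' = (v_view x).+1 by case: c4 => ->.
split=> //; [ | exact: committed_calm c4 C3 | by left; rewrite ev4].
move=> Q u; rewrite ev4 => ltu.
have qq : quiet s1 s'.
  apply: (quiet_trans (enter_quiet k1)); apply: calm_quiet.
  exact: calm_trans c2 c4.
apply: (quorum_ok_quiet qq); apply: (quorum_note_vote I vx ax _ h1).
  by move=> e; rewrite e ltnn in ltu.
by apply: Q; apply: leq_trans le (ltnW ltu).
Qed.

Lemma enter_past (c : cert) s s' : enter clk c s s' -> cert_view c < cur_view s -> s' = s.
Proof. by move=> [[le _]|[_ ->]] // lt; rewrite leqNgt lt in le. Qed.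

Lemma on_qc_spec src q s s' : inv s -> grows s0 s -> cur_view s = cur_view s0 ->
  valid_qc q -> (forall sg, List.In sg (qc_sigs q) -> auth sg) -> committed_but None s ->
  on_qc me clk known src q s s' ->
  [/\ inv s', entered_ok s', quiet s s', committed_but None s'
    & me = leader (qc_view q).+1 -> qc_view q < cur_view s'].
Proof.
move=> I g0 ecv vq aq C0 [[le [s1 h1 [s2 h2 h3]]]|[ng ->]]; last first.
  split=> //; first by apply: (entered_same I).
  by move=> lm; rewrite ltnNge; apply/negP => h; apply: ng.
have [I1 C1 q1 cases] : [/\ inv s1, committed_but None s1, quiet s s1 &
   (src <> leader (qc_view q) /\ s1 = s) \/
   (cur_view s1 = (qc_view q).+1 /\ did s1 (Send (leader (qc_view q).+1) (MQC q)))].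
  case: h1 => [[esrc [t1 k1 [t2 k2 k3]]]|[ne ->]]; last by split=> //; left.
  have I1 := inv_enter (c := CQC q) I vq aq k1.
  have [_ ev1] := enter_view k1; have {}ev1 := ev1 (leqW le).
  have I2 := inv_ext I1 (ext_commit I1 k2).
  have c2 := calm_commit k2.
  have x3 : ext t2 s1 by apply: (ext_send _ k3).
  have c3 : calm t2 s1 by apply: calm_act k3.
  split; [exact: inv_ext x3 | | |].
  - by apply: (committed_calm c3); exact: committed_commit k2 (committed_enter_qc k1 C0).
  - apply: (quiet_trans (enter_quiet k1)); apply: calm_quiet; exact: calm_trans c2 c3.
  - right; split; first by rewrite (x_cv x3); case: c2 => ->.
    by rewrite k3; right; rewrite /= In_rcons; right.
have [x2 c2] : ext s1 s2 /\ calm s1 s2.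
  case: h2 => [[_ k]|[_ ->]]; last by split=> //; exact: ext_refl.
  by split; [exact: (ext_broadcast_qc k) | exact: calm_broadcast_qc k].
have I2 := inv_ext I1 x2.
have C2 := committed_calm c2 C1.
have q2 := quiet_trans q1 (calm_quiet c2).
case: h3 => [[l [t1 k1 [t2 k2 k3]]]|[nl ->]].
  have I3 := inv_enter (c := CQC q) I2 vq aq k1.
  have le2 : cur_view s2 <= (qc_view q).+1.
    by rewrite (x_cv x2); case: cases => [[_ ->]|[-> //]]; exact: leqW.
  have [_ ev3] := enter_view k1; have {}ev3 := ev3 le2.
  have c4 := calm_commit k2.
  have I4 := inv_ext I3 (ext_commit I3 k2).
  have ev4 : cur_view t2 = (qc_view q).+1 by case: c4 => ->.
  have [I5 hi] : inv s' /\ has_issued (cur_view t2) s'.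
    by apply: (inv_propose_qc I4 vq _ _ k3); rewrite ev4.
  have c5 := calm_issue_new k3; have [e5 _ _ _ _] := c5.
  split=> //; last by rewrite e5 ev4.
  - split; rewrite /lead_ok /entry_ok e5 ev4; last by move=> _; apply: EntryLeader.
    by rewrite -ev4; left.
  - apply: (quiet_trans q2); apply: (quiet_trans (enter_quiet k1)); apply: calm_quiet.
    exact: calm_trans c4 c5.
  - apply: (committed_calm c5); apply: (committed_commit k2).
    exact: committed_enter_qc k1 C2.
split=> //.
case: cases => [[_ e1]|[ev1 d1]].
  subst s1; apply: (entered_same I2); last by rewrite (x_cv x2).
  by apply: (grows_trans g0); case: q2.
have g2 := calm_grows c2; have [_ _ gl] := g2.
split; rewrite /lead_ok /entry_ok (x_cv x2) ev1; first by move=> _ /nl.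
move=> _; apply: (EntryQC vq) => //.
exact: (did_mono gl d1).
Qed.

Lemma last_qc_tc (t : tc) s s' : inv s -> cur_view s <= tc_view t -> 0 < tc_view t ->
  enter clk (CTC t) s s' -> (qc_view (last_qc s')).+1 < cur_view s'.
Proof. by move=> I le lt [[_ ->]|[/(_ le)]] //=; have := i_lqv I; lia. Qed.

Lemma relay_tc_sent (t : tc) s s' : relay_tc t s s' ->
  mem s' (SentTimeout (tc_view t)) \/ mem s' (SentTC (tc_view t)).
Proof.
move=> [[_ [u -> ->]]|[h ->]]; first by right; right.
by apply: contrapT => h'; apply: h; split=> h2; apply: h'; [left | right].
Qed.

Lemma tc_quorum (t : tc) : valid_tc t ->
  (forall sg, List.In sg (sigs_tc t) -> auth sg) -> timeout_quorum (tc_view t).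
Proof.
case: t => w ts T qs q ss /= [[sz un] [e1 e2] esg _] at_.
exists [set i in [seq signer sg | sg <- ss]].
  by rewrite cardsE (card_uniqP un) size_map sz.
move=> i; rewrite inE => /mem_map_In[sg isg ei].
have : List.In (signed sg) [seq signed sg | sg <- ss] by apply: In_map.
rewrite esg => h; have [[a b] _ e] := In_map_inv h.
exists a, b; rewrite /= in e; rewrite e -ei.
by case: sg isg {ei h e} => i' c isg; apply: at_; rewrite In_cat; left.
Qed.

(** [relay_tc] may send nothing. Then either some TC of that view, perhaps another one, has been
    broadcast before, or the validator has timed out in that view and [t] shows that a quorum has
    too. *)
Lemma relay_entry (t : tc) s' u : inv s' -> valid_tc t ->
  (forall sg, List.In sg (sigs_tc t) -> auth sg) -> (tc_view t).+1 = u ->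
  mem s' (SentTimeout (tc_view t)) \/ mem s' (SentTC (tc_view t)) -> entry s' u.
Proof.
move=> I vt at_ <- [h|h]; first by apply: EntryTimeout; [ | exact: tc_quorum].
have [t' [vt' e h']] := i_stc I h.
by apply: (EntryTC vt'); rewrite ?e.
Qed.

Lemma on_tc_spec (t : tc) s s' : inv s -> grows s0 s -> cur_view s = cur_view s0 ->
  valid_tc t -> (forall sg, List.In sg (sigs_tc t) -> auth sg) -> committed_but None s ->
  on_tc me clk t s s' ->
  [/\ inv s', entered_ok s', quiet s s', committed_but None s'
    & tc_view t < cur_view s'].
Proof.
move=> I g0 ecv vt at_ C0 [[le [s1 h1 [s2 h2 h3]]]|[ng ->]]; last first.
  split=> //; first by apply: (entered_same I).
  by rewrite ltnNge; apply/negP => h; apply: ng.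
have I1 := inv_enter (c := CTC t) I vt at_ h1.
have [_ ev1] := enter_view h1; have {}ev1 := ev1 (leqW le).
have [t0 _] := valid_tcE vt.
have lq1 := last_qc_tc I le t0 h1.
have x2 := ext_relay_tc vt h2; have I2 := inv_ext I1 x2.
have c2 := calm_relay_tc h2.
have ev2 : cur_view s2 = (tc_view t).+1 by rewrite (x_cv x2).
have [I3 c3 ll] : [/\ inv s', calm s2 s' & me = leader (tc_view t).+1 ->
   has_issued (cur_view s2) s' \/
   exists2 r, recov s' = Some r & (tc_view (rec_tc r)).+1 = cur_view s2].
  case: h3 => [[l k]|[nl ->]]; last by split=> // /nl.
  have l2 : me = leader (cur_view s2) by rewrite ev2.
    have [I3 hh] := inv_propose_tc I2 vt at_ l2 ev2 k.
  by split=> //; exact: calm_propose_tc k.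
have [e3 lq3 g3 _ _] := c3; have [_ gm _] := g3.
split=> //; last by rewrite e3 ev2.
- split; rewrite /lead_ok /entry_ok e3 ev2.
    move=> _ l; have := ll l; rewrite ev2 => -[|h]; [by left | right; split=> //].
    by rewrite lq3 (x_lqc x2) -ev1.
  move=> _; apply: (relay_entry I3 vt at_) => //.
  by case: (relay_tc_sent h2) => /gm; [left | right].
- by apply: (quiet_trans (enter_quiet h1)); apply: calm_quiet; exact: calm_trans c2 c3.
- by apply: (committed_calm (calm_trans c2 c3)); exact: committed_enter_tc h1 C0.
Qed.

(* A request that changes the view comes from another validator: a leader has
   entered its view when it sends one. *)
Lemma entered_request src (t : tc) s s1 s' : inv s -> cur_view s = cur_view s0 ->
  grows s0 s -> src = leader (tc_view t).+1 -> cur_view s <= (tc_view t).+1 ->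
  rc src (MProposalRequest t) \/ rc src (MNERequest t) ->
  enter clk (CTC t) s s1 -> inv s' -> calm s1 s' -> entered_ok s'.
Proof.
move=> I ecv g0 esrc le hrc h1 I' c.
have [e _ _ _ _] := c.
have [_ ev1] := enter_view h1; have {}ev1 := ev1 le.
have [same|ne] := eqVneq (cur_view s') (cur_view s0).
  apply: (entered_same I') => //.
  by apply: (grows_trans g0); apply: (grows_trans (grows_enter h1)); exact: calm_grows c.
split; rewrite /lead_ok /entry_ok e ev1; last first.
  by move=> _; apply: (@EntryRequest _ _ t); rewrite -?esrc.
move=> _ l; exfalso; rewrite -l in esrc; subst src.
have : tc_view t < cur_view s0.
  case: hrc => /rc_own h; first exact: (i_preq inv0 (or_introl h)).
  by case: (i_req inv0 (or_introl h)).
rewrite -ecv => lt; have es1 := enter_past (c := CTC t) h1 lt.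
by move/eqP: ne; rewrite e es1 ecv.
Qed.

Lemma on_proposal_request_spec src (t : tc) s s' : inv s -> grows s0 s ->
  cur_view s = cur_view s0 -> valid_tc t -> tc_high_tip t <> None ->
  (forall sg, List.In sg (sigs_tc t) -> auth sg) -> rc src (MProposalRequest t) ->
  committed_but None s -> on_proposal_request clk src t s s' ->
  [/\ inv s', entered_ok s', quiet s s', committed_but None s'
    & src = leader (tc_view t).+1 -> [/\ tc_view t < cur_view s',
      forall h, mem s' (VotedFor h) -> mem s (VotedFor h) &
      forall T p, tc_high_tip t = Some T -> stored s p -> p_pid p = tip_pid T ->
        (tc_view t).+1 < cur_view s' \/
        exists p', [/\ valid_proposal p', p_pid p' = tip_pid T
                     & List.In (Send src (MProposal p')) (log s')]]].
Proof.
move=> I g0 ecv vt neT at_ hrc C0 [[[esrc le] [s1 h1 h2]]|[ng ->]]; last first.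
  split=> //; first by apply: (entered_same I).
  move=> e; have lt : (tc_view t).+1 < cur_view s.
    by rewrite ltnNge; apply/negP => h; apply: ng.
  by split=> // [|T p _ _ _]; [exact: ltnW | left].
have I1 := inv_enter (c := CTC t) I vt at_ h1.
have [_ ev1] := enter_view h1; have {}ev1 := ev1 le.
case eT: (tc_high_tip t) neT h2 => [T|] // _ h2.
have vT : valid_tip T.
  have [_ [[q [_ e _ _]]|[T' [_ e vT _]]]] := valid_tcE vt; rewrite e in eT => //.
  by move: eT => [<-].
have [x2 c2] : ext s1 s' /\ calm s1 s'.
  case: h2 => [[p _ k]|[_ ->]]; last by split=> //; exact: ext_refl.
  by split; [apply: (ext_send _ k) | apply: calm_act k].
have I2 := inv_ext I1 x2.
have hin : rc src (MProposalRequest t) \/ rc src (MNERequest t) by left.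
split=> //.
- exact: entered_request I ecv g0 esrc le hin h1 I2 c2.
- by apply: (quiet_trans (enter_quiet h1)); apply: calm_quiet.
- by apply: (committed_calm c2); exact: committed_enter_tc h1 C0.
- move=> _; split; first by rewrite (x_cv x2) ev1.
    by move=> h /(x_new x2)[|//]; case: (enter_fields h1) => ->.
  move=> T1 p [<-] sp ep; right.
  case: h2 => [[p' [sp' ep'] k]|[nk _]]; last first.
    by case: (nk p); split=> //; case: (enter_fields h1) => em _ _ _ _; rewrite /stored em.
  exists p'; split=> //; last by rewrite k /= In_rcons; right.
  have [e|[//]] := i_stored I1 sp'.
  exfalso; have [_ eT2 _ _] := valid_tipE vT; move: ep'; rewrite eT2 e => /pid_inj[_ e0].
  by have := valid_tip_gt0 vT; rewrite -e0.
Qed.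

Lemma on_ne_request_spec src (t : tc) s s' : inv s -> grows s0 s ->
  cur_view s = cur_view s0 -> valid_tc t -> tc_high_tip t <> None ->
  (forall sg, List.In sg (sigs_tc t) -> auth sg) -> rc src (MNERequest t) ->
  committed_but None s -> on_ne_request me clk src t s s' ->
  [/\ inv s', entered_ok s', quiet s s', committed_but None s'
    & src = leader (tc_view t).+1 -> forall T, tc_high_tip t = Some T ->
      [\/ (tc_view t).+1 < cur_view s', mem s' (VotedFor (tip_pid T))
        | mem s' (SentNE (tc_view t).+1)]].
Proof.
move=> I g0 ecv vt neT at_ hrc C0 [[[esrc le] [s1 h1 h2]]|[ng ->]]; last first.
  split=> //; first by apply: (entered_same I).
  move=> e; constructor 1; rewrite ltnNge; apply/negP => h; exact: ng.
have I1 := inv_enter (c := CTC t) I vt at_ h1.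
case eT: (tc_high_tip t) neT h2 => [T|] // _ h2.
have [I2 hh] := inv_answer_ne I1 esrc hrc eT h2.
have c2 : calm s1 s'.
  by case: h2 => [[_ [t1 -> [t2 -> ->]]]|[_ ->]] //=; split=> //=;
    [split=> //= [x|a] ?; [left | rewrite !In_rcons; do 2!left]
    | move=> x hx [|e] //; rewrite e in hx
    | move=> c; rewrite !In_rcons => -[[]|]].
have hin : rc src (MProposalRequest t) \/ rc src (MNERequest t) by right.
split=> //.
- exact: entered_request I ecv g0 esrc le hin h1 I2 c2.
- by apply: (quiet_trans (enter_quiet h1)); apply: calm_quiet.
- by apply: (committed_calm c2); exact: committed_enter_tc h1 C0.
- by move=> _ T1 [<-]; case: hh; [constructor 2 | constructor 3].
Qed.

Hypothesis why_quorum : forall u Ms,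
  timeouts_of (fun M => valid_timeout (signer (to_sig M)) M /\ auth (to_sig M)) u f.+1 Ms ->
  why u.

Definition still (s s' : lstate) : Prop :=
  [/\ cur_view s' = cur_view s, last_qc s' = last_qc s, recov s' = recov s & grows s s'].

Lemma entered_still s s' : still s s' -> entered_ok s -> entered_ok s'.
Proof.
move=> [a b c d] [l e]; have [_ g _] := d; split; rewrite /lead_ok /entry_ok a ?b ?c.
  by move=> c0 l'; case: (l c0 l') => [[p m ev]|h]; [left; exists p; auto | right].
by move=> h; exact: (entry_grows d (e h)).
Qed.

Lemma note_still x s s' : note x s s' -> still s s'.
Proof. by move=> h; have g := grows_note_all h; rewrite h in g *; split. Qed.

Lemma time_out_still s s' : time_out me s s' -> still s s'.
Proof.
move=> h; have [e1 e2 g _ _] := calm_time_out h; split=> //.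
by case: h => s1 -> [s2 ->]; case: ifP => _ [s3] => [-> ->|[s4 -> ->] [s5 -> ->]].
Qed.

(** The part of [on_timeout] that deals with [last_cer], before the message itself is counted.
    Afterwards the validator is exactly in the view of the message. *)
Lemma timeout_prefix_spec (c : cert) s s1 s2 s3 s4 :
  inv s -> grows s0 s -> cur_view s = cur_view s0 -> valid_cert c ->
  (forall sg, List.In sg (sigs_cert c) -> auth sg) ->
  cur_view s <= (cert_view c).+1 -> committed_but None s ->
  (if c is CTC t then relay_tc t else skip) s s1 ->
  enter clk c s1 s2 ->
  when (fun s => me = leader (cert_view c).+1 /\ ~ has_issued (cert_view c).+1 s)
    (match c with CQC q => propose_qc me q | CTC t => propose_tc me clk t end) s2 s3 ->
  (if c is CQC q then
        is_leader me (qc_view q) (broadcast_qc q) ;;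
        send (leader (qc_view q)) (MQC q) ;;
        send (leader (qc_view q).+1) (MQC q) ;;
        commit known q
      else skip) s3 s4 ->
  [/\ inv s4, entered_ok s4, quiet s s4, committed_but None s4
    & cur_view s4 = (cert_view c).+1].
Proof.
move=> I g0 ecv vc ac le C0 hA hB hC hD.
have [x1 c1] : ext s s1 /\ calm s s1.
  case: c vc hA {ac le hB hC hD} => [q _|t vt]; first by move=> ->; split=> //; exact: ext_refl.
  by move=> h; split; [exact: (ext_relay_tc vt h) | exact: calm_relay_tc h].
have I1 := inv_ext I x1.
have I2 := inv_enter I1 vc ac hB.
have le1 : cur_view s1 <= (cert_view c).+1 by rewrite (x_cv x1).
have [_ ev2] := enter_view hB; have {}ev2 := ev2 le1.
have C1 := committed_calm c1 C0.
have [I3 c3 ll] : [/\ inv s3, calm s2 s3 & me = leader (cert_view c).+1 ->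
   has_issued (cert_view c).+1 s3 \/
   exists2 t, c = CTC t & exists2 r, recov s3 = Some r &
     (tc_view (rec_tc r)).+1 = (cert_view c).+1].
  case: hC => [[[l nh] k]|[nn ->]]; last first.
    by split=> // l; left; apply: contrapT => h; apply: nn.
  have l2 : me = leader (cur_view s2) by rewrite ev2.
  case: c vc ac le hA hB hD le1 ev2 l nh k => [q|t] vc ac le hA hB hD le1 ev2 l nh k.
    have [I3 hh] := inv_propose_qc I2 vc l2 ev2 k.
    by split=> //; [exact: calm_issue_new k | move=> _; left; rewrite -ev2].
  have [I3 hh] := inv_propose_tc I2 vc ac l2 ev2 k.
  split=> //; first exact: calm_propose_tc k.
  move=> _; case: hh => [h|h]; [by left; rewrite -ev2 | right; exists t => //].
  by rewrite -ev2.
have [e3 lq3 g3 _ _] := c3.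
have [x4 c4 C4] : [/\ ext s3 s4, calm s3 s4 & committed_but None s4].
  case: c vc hA hB hD {ac le hC le1 ev2 ll I2} => [q|t] vc hA hB.
    have C3 := committed_calm c3 (committed_enter_qc hB C1).
    move=> [t1 k1 [t2 k2 [t3 k3 k4]]].
    have [y1 d1] : ext s3 t1 /\ calm s3 t1.
      case: k1 => [[_ k]|[_ ->]]; last by split=> //; exact: ext_refl.
      by split; [exact: (ext_broadcast_qc k) | exact: calm_broadcast_qc k].
    have y2 : ext t1 t2 by apply: (ext_send _ k2).
    have d2 : calm t1 t2 by apply: calm_act k2.
    have y3 : ext t2 t3 by apply: (ext_send _ k3).
    have d3 : calm t2 t3 by apply: calm_act k3.
    have y := ext_trans (ext_trans y1 y2) y3.
    have d := calm_trans (calm_trans d1 d2) d3.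
    have d4 := calm_commit k4.
    split.
    - exact: (ext_trans y (ext_commit (inv_ext I3 y) k4)).
    - exact: calm_trans d d4.
    - exact: committed_commit k4 (committed_calm d C3).
  move=> ->; split=> //; first exact: ext_refl.
  by apply: (committed_calm c3); exact: committed_enter_tc hB C1.
have I4 := inv_ext I3 x4.
have ev4 : cur_view s4 = (cert_view c).+1 by rewrite (x_cv x4) e3.
have qq : quiet s s4.
  apply: (quiet_trans (calm_quiet c1)); apply: (quiet_trans (enter_quiet hB)).
  by apply: calm_quiet; exact: calm_trans c3 c4.
split=> //.
have [same|ne] := eqVneq (cur_view s4) (cur_view s0).
  by apply: (entered_same I4) => //; apply: (grows_trans g0); case: qq.
have le' : cur_view s <= cert_view c.
  rewrite leqNgt; apply/negP => lt; move/eqP: ne; apply.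
  rewrite ev4 -ecv; apply/eqP; rewrite eqn_leq lt; by rewrite le.
have [e4 lq4 [_ m4 g4] _ _] := c4.
split; rewrite /lead_ok /entry_ok ev4.
  move=> _ /ll[[p m ev]|[t ec [r er etc]]]; first by left; exists p; [exact: m4|].
  right; split; last by exists r; rewrite ?(x_rec x4).
  rewrite lq4 lq3 -ev2; subst c; have [t0 _] := valid_tcE vc.
  by apply: (last_qc_tc I1 _ t0 hB); rewrite (x_cv x1).
have gm : forall x, mem s1 x -> mem s4 x.
  have [[_ h1 _] _] := enter_quiet hB.
  by case: g3 => _ h2 _ x /h1/h2/m4.
case: c vc ac {le} hA {hB hC} hD {le1 ev2 ll I2 ev4 le'} => [q|t] vc ac hA hD _.
  apply: (EntryQC vc) => //.
  case: hD => t1 k1 [t2 k2 [t3 k3 k4]].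
  have d3 : did t3 (Send (leader (qc_view q).+1) (MQC q)).
    by rewrite k3; right; rewrite /= In_rcons; right.
  have [_ _ gl] := calm_grows (calm_commit k4).
  exact: did_mono gl d3.
apply: (relay_entry I4 vc ac) => //.
by case: (relay_tc_sent hA) => /gm; [left | right].
Qed.

Lemma set_of_signers (A : Type) (g : A -> V) (l : seq A) (Q : A -> Prop) (k : nat) :
  size l = k -> uniq [seq g a | a <- l] -> (forall a, List.In a l -> Q a) ->
  exists2 S : {set V}, #|S| = k & forall i, i \in S -> exists2 a, Q a & g a = i.
Proof.
move=> sz un hQ; exists [set i in [seq g a | a <- l]].
  by rewrite cardsE (card_uniqP un) size_map.
by move=> i; rewrite inE => /mem_map_In[a /hQ ? ?]; exists a.
Qed.

Lemma got_timeout_auth M s : inv s -> mem s (GotTimeout M) ->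
  auth (Sig (signer (to_sig M)) (CTimeout (to_view M) (to_tip_view M) (to_qc_view M))).
Proof.
move=> I /(i_gto I)[[_ _ e _] h]; rewrite -e; apply: h; by left.
Qed.

Lemma on_timeout_spec src M s s' : inv s -> grows s0 s -> cur_view s = cur_view s0 ->
  valid_timeout src M ->
  (forall sg, List.In sg (sigs_msg (MTimeout M : msg)) -> auth sg) ->
  committed_but None s -> quorums_ok s -> on_timeout me clk known M s s' ->
  [/\ inv s', entered_ok s', quorums_ok s', committed_but None s'
    & to_view M < cur_view s' \/ mem s' (GotTimeout M)].
Proof.
move=> I g0 ecv vM aM C0 Q0 [[le [s1 hA [s2 hB [s3 hC [s4 hD [s5 hE hF]]]]]]|[ng ->]];
  last first.
  split=> //; first by apply: (entered_same I).
  by left; rewrite ltnNge; apply/negP => h; apply: ng.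
have [vc ec esg vtq] := vM.
have ac sg : List.In sg (sigs_cert (to_last_cer M)) -> auth sg.
  by move=> h; apply: aM; right; rewrite !In_cat; tauto.
have lec : cur_view s <= (cert_view (to_last_cer M)).+1 by rewrite ec.
have [I4 E4 q4 C4 ev4] := timeout_prefix_spec I g0 ecv vc ac lec C0 hA hB hC hD.
rewrite ec in ev4.
have Q4 := quorums_ok_quiet q4 Q0.
have tipv : to_tip M <> None -> exists v, [/\ to_tip_vote M = Some v, valid_vote v,
    signer (v_sig v) = src, v_view v = to_view M & auth (v_sig v)].
  move: vtq; case eT: (to_tip M) => [T|//]; case: (to_qc M) => // -[_ [_ [v ev []]]].
  exists v; split=> //; apply: aM; right; rewrite ev /= !In_cat /=; tauto.
have [x5 st5 log5 tv5] : [/\ ext s4 s5, still s4 s5, log s5 = log s4 &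
   forall x, mem s5 x -> mem s4 x \/
     exists v, [/\ to_tip M <> None, to_tip_vote M = Some v & x = GotTipVote v]].
  case ev: (to_tip_vote M) hE => [v|]; last first.
    by move=> ->; split=> //; [exact: ext_refl | left].
  move=> [[nT h]|[_ ->]]; last by split=> //; [exact: ext_refl | left].
  have [v' [ev' vv _ _ av]] := tipv nT; move: ev'; rewrite ev => -[ev']; subst v'.
  split; [by apply: ext_note h | exact: note_still h | by rewrite h |].
  by rewrite h => x [|->]; [left | right; exists v].
have I5 := inv_ext I4 x5; have E5 := entered_still st5 E4.
have [ev5 _ _ g5] := st5; rewrite ev4 in ev5.
have C5 := committed_log g5 log5 C4.
have Qu u : u != to_view M -> to_view M <= u -> quorum_ok u s5.
  move=> ne leu; have [q1 q2 q3 qq4] := Q4 u (etrans (congr1 (leq ^~ u) ev4) leu).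
  have [_ mm _] := g5.
  split.
  - move=> l bh q fq; apply: (q1 l bh q); apply: forms_qc_sub fq.
    by move=> x /tv5[//|[v []]].
  - move=> Ms ts; apply/mm/(q2 Ms); apply: timeouts_of_sub ts.
    by move=> x /tv5[//|[v []]].
  - move=> Ms ts; apply: (q3 Ms); apply: timeouts_of_sub ts.
    by move=> x /tv5[//|[v []]].
  - move=> x /tv5[/qq4 h /h[M' /mm ? ?]|[v [nT ev [->]]]]; first by exists M'.
    have [v' [ev' _ _ evv _]] := tipv nT; move: ev'; rewrite ev => -[->].
    by rewrite evv => e; rewrite e eqxx in ne.
have [q1w q2w q3w q4w] := Q4 _ (eq_leq ev4).
have asig : auth (Sig src (CTimeout (to_view M) (to_tip_view M) (to_qc_view M))).
  by rewrite -esg; apply: aM; left.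
case: hF => [[q [v [nT ev fq]] [t1 k1 [t2 k2 k3]]]|[nq [s6 h6 [s7 h7 h8]]]].
  have [v' [ev' [epid _] esrc evv _]] := tipv nT; move: ev'; rewrite ev => -[ev']; subst v'.
  rewrite epid evv in fq.
  have [vq eqv aq sq] := forms_qc_valid (i_gtv I5) fq.
  have [[_ [[sz un] _] hq]] := (fq, tt).
  have [S cS hS] := set_of_signers sz un (fun sg h => h).
  have hM i : i \in S -> i = src \/ exists2 M', mem s4 (GotTimeout M') &
      to_view M' = to_view M /\ signer (to_sig M') = i.
    move=> /hS[sg isg <-]; case: (tv5 _ (hq _ isg)) => [m|[v' [_ ev' [ex]]]].
      by right; have [M' ? ?] := q4w _ m eqv; exists M'.
    by left; move: ev'; rewrite ev => -[ev']; rewrite -esrc ev' -ex.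
  (* This QC is not passed on to the next leader, so the entry must be explained by timeouts. Of its
     2f + 1 signers at most [src] has no recorded timeout message; the other 2f are at least f + 1,
     and their messages have already made this validator time out. *)
  have f0 := faults_gt0 P.
  have sent : mem s4 (SentTimeout (to_view M)).
    have [|l [sl ul hl]] := @set_take (S :\ src) f.+1.
      apply: (@leq_trans (2 * f)); first by rewrite mul2n -addnn -addn1 leq_add2l.
      by rewrite -ltnS -cS (cardsD1 src S); exact: (leq_add (leq_b1 _) (leqnn _)).
    have [|Ms eMs hMs] := list_choice (g := fun M' : timeout => signer (to_sig M'))
      (Q := fun M' => mem s4 (GotTimeout M') /\ to_view M' = to_view M) (l := l).
      move=> i /hl; rewrite in_setD1 => /andP[/eqP ni /hM[//|[M' ? [? ?]]]].
      by exists M'.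
    apply: (q2w Ms); split; [ | by rewrite eMs | exact: hMs].
    by rewrite -(size_map (fun M' : timeout => signer (to_sig M'))) eMs.
  have tq : timeout_quorum (to_view M).
    exists S; first by rewrite cS.
    move=> i /hM[->|[M' m [e1 <-]]]; first by eexists _, _; exact: asig.
    by have := got_timeout_auth I4 m; rewrite e1 => h; eexists _, _; exact: h.
  have I6 := inv_enter (c := CQC q) I5 vq aq k1.
  have [_ ev6] := enter_view k1; rewrite /= eqv in ev6.
  have {}ev6 : cur_view t1 = (to_view M).+1 by apply: ev6; rewrite ev5.
  have I7 := inv_ext I6 (ext_commit I6 k2).
  have c7 := calm_commit k2.
  have ev7 : cur_view t2 = (to_view M).+1 by case: c7 => ->.
  have C7 := committed_commit k2 (committed_enter_qc k1 C5).
  have [I8 c8 ll] : [/\ inv s', calm t2 s' &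
      me = leader (to_view M).+1 -> has_issued (to_view M).+1 s'].
    rewrite eqv in k3; case: k3 => [[l k]|[nl ->]]; last by split=> // /nl.
    have [I8 hi] : inv s' /\ has_issued (cur_view t2) s'.
      by apply: (inv_propose_qc I7 vq _ _ k); rewrite ev7 ?eqv.
    by split=> //; [exact: calm_issue_new k | rewrite -ev7].
  have [e8 _ _ _ _] := c8; rewrite ev7 in e8.
  have q8 : quiet s5 s'.
    by apply: (quiet_trans (enter_quiet k1)); apply: calm_quiet; exact: calm_trans c7 c8.
  split=> //; last by left; rewrite e8.
  - split; rewrite /lead_ok /entry_ok e8; first by move=> _ /ll; left.
    move=> _; apply: EntryTimeout => //=.
    by case: q8 => -[_ mm _] _; case: g5 => _ mm5 _; apply/mm/mm5.
  - move=> u; rewrite e8 => ltu; apply: (quorum_ok_quiet q8); apply: Qu; last exact: ltnW.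
    by apply/eqP => e; rewrite e ltnn in ltu.
  - exact: committed_calm c8 C7.
have vM6 : valid_timeout (signer (to_sig M)) M by rewrite esg.
have x6 : ext s5 s6 by apply: ext_note h6.
have I6 := inv_ext I5 x6; have st6 := note_still h6.
have [ev6 _ _ g6] := st6; rewrite ev5 in ev6.
have C6 : committed_but None s6 by apply: (committed_log g6 _ C5); rewrite h6.
have w0 : 0 < to_view M by rewrite -ec.
have Q6 u : u != to_view M -> to_view M <= u -> quorum_ok u s6.
  move=> ne leu; apply: (quorum_note_timeout _ h6); last exact: Qu.
  by move=> e; rewrite e eqxx in ne.
have m6 : mem s6 (GotTimeout M) by rewrite h6; right.
have got6 M' : mem s6 (GotTimeout M') -> valid_timeout (signer (to_sig M')) M' /\
    forall sg, List.In sg (sigs_msg (MTimeout M' : msg)) -> auth sg.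
  by move=> /(i_gto I6).
have [I7 st7 c7 sent7] : [/\ inv s7, still s6 s7, calm s6 s7 &
    forall Ms, timeouts_of (fun M => mem s6 (GotTimeout M)) (to_view M) f.+1 Ms ->
      mem s7 (SentTimeout (to_view M))].
  case: h7 => [[[[Ms ts] _] k]|[nn ->]]; last first.
    split=> // Ms ts; apply: contrapT => ns; apply: nn; split=> //; by exists Ms.
  have wy : why (to_view M).
    apply: (@why_quorum _ Ms); apply: timeouts_of_sub ts => M' /got6[v a].
    by split=> //; apply: a; left.
  have [] := inv_time_out I6 _ _ k; rewrite ?ev6 // => I7 sent.
  by split=> //; [exact: time_out_still k | exact: calm_time_out k].
have [ev7 _ _ g7] := st7; rewrite ev6 in ev7.
have got7 x : is_got x -> mem s7 x -> mem s6 x by case: c7 => _ _ _ h _; apply: h.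
have C7 := committed_calm c7 C6.
have m7 : mem s7 (GotTimeout M) by case: g7 => _ mm _; apply: mm.
have E7 := entered_still st7 (entered_still st6 E5).
have vW M' : mem s7 (GotTimeout M') -> valid_timeout (signer (to_sig M')) M'.
  by move=> /(i_gto I7)[].
case: h8 => [[t ft [t1 k1 k2]]|[nt ->]]; last first.
  split=> //; last by right.
  move=> u; rewrite ev7 => leu; have [e|ne] := eqVneq u (to_view M); last first.
    by apply: (quorum_ok_quiet (calm_quiet c7)); exact: Q6.
  subst u; split.
  - move=> l bh q fq; apply: (q1w l bh q); apply: forms_qc_sub fq => x m.
    have := got7 (GotVote x) Logic.I m; rewrite h6 => -[|//] /tv5[//|[v []]] //.
  - move=> Ms ts; apply: (sent7 Ms); apply: timeouts_of_sub ts => M'; exact: got7.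
  - move=> Ms ts; have [|t ft] := forms_tc_exists ts; last exact: nt ft.
    move=> M' /(let: And3 _ _ h := ts in h) [m _].
    by exists (signer (to_sig M')); apply: vW.
  - move=> x m evx; have := got7 (GotTipVote x) Logic.I m; rewrite h6 => -[|//] /tv5[m4|].
      have [M' mM' ?] := q4w _ m4 evx; exists M' => //.
      case: g7 => _ mm7 _; case: g6 => _ mm6 _; case: g5 => _ mm5 _.
      exact/mm7/mm6/mm5.
    move=> [v [nT ev [->]]]; exists M => //; split=> //.
    have [v' [ev' _ es _ _]] := tipv nT; move: ev'; rewrite ev => -[->].
    by rewrite es esg.
have [vt ewt [Ms [ts esgs hT hq]]] := forms_tc_valid vW ft.
have inMs M' : List.In M' Ms -> mem s7 (GotTimeout M') by case: ts => _ _ h /h[].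
have at_ sg : List.In sg (sigs_tc t) -> auth sg.
  rewrite esgs !In_cat => -[h|[]].
  - by have [M' /inMs/(i_gto I7)[_ a] <-] := In_map_inv h; apply: a; left.
  - case eT: (tc_high_tip t) => [T|//] isg.
    have [M' /inMs/(i_gto I7)[_ a] eM'] := hT _ eT.
    by apply: a; right; rewrite /= eM' !In_cat; tauto.
  - case eq: (tc_high_qc t) => [q|//] isg.
    have [M' /inMs/(i_gto I7)[_ a] eM'] := hq _ eq.
    by apply: a; right; rewrite /= eM' !In_cat; tauto.
have I8 := inv_enter (c := CTC t) I7 vt at_ k1.
have [_ ev8] := enter_view k1; rewrite /= ewt in ev8.
have {}ev8 : cur_view t1 = (to_view M).+1 by apply: ev8; rewrite ev7.
have lq8 : (qc_view (last_qc t1)).+1 < cur_view t1.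
  by apply: (last_qc_tc I7 _ _ k1); rewrite ewt ?ev7.
have [I9 c9 ll] : [/\ inv s', calm t1 s' & me = leader (to_view M).+1 ->
   has_issued (to_view M).+1 s' \/
   exists2 r, recov s' = Some r & (tc_view (rec_tc r)).+1 = (to_view M).+1].
  rewrite ewt in k2; case: k2 => [[l k]|[nl ->]]; last by split=> // /nl.
  have l2 : me = leader (cur_view t1) by rewrite ev8.
  have ew2 : cur_view t1 = (tc_view t).+1 by rewrite ev8 ewt.
  have [I9 hh] := inv_propose_tc I8 vt at_ l2 ew2 k.
  by rewrite ev8 in hh; split=> //; exact: calm_propose_tc k.
have [e9 lq9 _ _ _] := c9; rewrite ev8 in e9.
have q9 : quiet s6 s'.
  apply: (quiet_trans (calm_quiet c7)); apply: (quiet_trans (enter_quiet k1)).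
  exact: calm_quiet.
split=> //; last by left; rewrite e9.
- split; rewrite /lead_ok /entry_ok e9.
    move=> _ /ll[|h]; [by left | right; split=> //].
    by rewrite lq9 -ev8.
  move=> _; apply: EntryTimeout => /=; last by rewrite -ewt; apply: tc_quorum.
  have [[_ mm1 _] _] := enter_quiet k1; have [_ mm2 _] := calm_grows c9.
  apply/mm2/mm1/(sent7 (take f.+1 Ms)).
  apply: (timeouts_of_sub (W := fun M => mem s7 (GotTimeout M))); first by move=> M'; apply: got7.
  by apply: timeouts_of_take ts; lia.
- move=> u; rewrite e9 => ltu; apply: (quorum_ok_quiet q9); apply: Q6; last exact: ltnW.
  by apply/eqP => e; rewrite e ltnn in ltu.
- by apply: (committed_calm c9); exact: committed_enter_tc k1 C7.
Qed.

Hypothesis quor0 : quorums_ok s0.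
Hypothesis log0 : log s0 = [::].

Definition heard (src : V) (m : msg) (s : lstate) : Prop :=
  match m with
  | MProposal p =>
      (src = leader (p_view p) -> p_view p < cur_view s \/
        [/\ cur_view s = p_view p, p_view p <= highest_voted s & commits (p_qc p) s]) /\
      (forall r, recov s0 = Some r -> p_pid p = tip_pid (rec_tip r) ->
        cur_view s0 = (tc_view (rec_tc r)).+1 -> has_issued (cur_view s0) s)
  | MVote x => me = leader (v_view x) \/ me = leader (v_view x).+1 ->
      v_view x < cur_view s \/ mem s (GotVote x)
  | MQC q => me = leader (qc_view q).+1 -> qc_view q < cur_view s
  | MTimeout M => to_view M < cur_view s \/ mem s (GotTimeout M)
  | MTC t => tc_view t < cur_view s
  | MProposalRequest t => src = leader (tc_view t).+1 -> [/\ tc_view t < cur_view s,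
      forall h, mem s (VotedFor h) -> mem s0 (VotedFor h) &
      forall T p, tc_high_tip t = Some T -> stored s0 p -> p_pid p = tip_pid T ->
        (tc_view t).+1 < cur_view s \/
        exists p', [/\ valid_proposal p', p_pid p' = tip_pid T
                     & List.In (Send src (MProposal p')) (log s)]]
  | MNERequest t => src = leader (tc_view t).+1 -> forall T, tc_high_tip t = Some T ->
      [\/ (tc_view t).+1 < cur_view s, mem s (VotedFor (tip_pid T))
        | mem s (SentNE (tc_view t).+1)]
  | MNE _ _ x => mem s (GotNE x) /\
      forall r, recov s0 = Some r -> cur_view s0 = (tc_view (rec_tc r)).+1 ->
      (exists ne : nec, let q := hd_qc (tip_hd (rec_tip r)) in
        [/\ nec_view ne = cur_view s0, nec_high_tip_qc_view ne = qc_view q,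
            aggregates (nec_sigs ne) (CNE (cur_view s0) (qc_view q))
          & forall y, List.In y (nec_sigs ne) -> mem s0 (GotNE y) \/ y = x]) ->
      has_issued (cur_view s0) s
  end.

Definition handled (s : lstate) : Prop :=
  [/\ inv s, entered_ok s, quorums_ok s & committed_but None s].

Lemma handled0 : handled s0.
Proof.
by split=> // q; rewrite log0.
Qed.

Lemma on_deliver_spec src m s' : 0 < cur_view s0 -> valid_msg src m ->
  (forall sg, List.In sg (sigs_msg m) -> auth sg) -> rc src m ->
  on_deliver me clk known src m s0 s' -> handled s' /\ heard src m s'.
Proof.
move=> c0 vm am hrc [[_ [s1 h1 h2]]|[/(_ vm)]] //.
have x1 : ext s0 s1.
  apply: (ext_note_all _ inv0 h1) => s x I [q [p [-> _ ch]]]; split=> //=.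
  by apply: chain_sound ch => r [/known_sound|/(i_stored I)].
have c1 : calm s0 s1 by apply: calm_note_all h1 => s x [q [p [-> _ _]]].
have I1 := inv_ext inv0 x1.
have g1 := calm_grows c1.
have e1 := x_cv x1.
have C0 : committed_but None s0 by move=> q; rewrite log0.
have C1 := committed_calm c1 C0.
have Q1 := quorums_ok_quiet (calm_quiet c1) quor0.
case: m vm am hrc {h1} h2 => [p|x|q|M|t|t|t|w v x] /= vm am hrc h2.
- have [s2 k1 [s3 k2 k3]] := h2.
  have sp : sound p by right; split.
  have x2 : ext s1 s2 by apply: ext_note k1.
  have c2 : calm s1 s2 by apply: calm_note_all k1 => s x ->.
  have I2 := inv_ext I1 x2.
  have [I3 hr] := inv_recover_proposal I2 vm k2.
  have c3 := calm_recover_proposal k2.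
  have c13 := calm_trans (calm_trans c1 c2) c3.
  have [e3 _ g3 _ _] := c13.
  have m3 : stored s3 p by case: (calm_grows c3) => _ h _; apply: h; rewrite k1; right.
  have [I4 E4 q4 C4 H4] := on_proposal_spec I3 g3 e3 vm m3
    hrc am (committed_calm c13 C0) k3.
  split; first by split=> //; exact: quorums_ok_quiet q4 (quorums_ok_quiet (calm_quiet c13) quor0).
  split=> // r er ep ev; rewrite (x_rec x2) (x_rec x1) (x_cv x2) e1 in hr.
  have [p' m' ev'] := hr r er ep ev.
  by exists p' => //; case: q4 => -[_ h _] _; apply: h.
- case: vm => vx esrc.
  have ax : auth (v_sig x) by apply: am; left.
  have [I2 E2 Q2 C2 H2] := on_vote_spec I1 g1 e1 vx ax C1 h2.
  by split=> //; split=> //; apply: Q2.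
- have [I2 E2 q2 C2 H2] := on_qc_spec I1 g1 e1 vm am C1 h2.
  by split=> //; split=> //; exact: quorums_ok_quiet q2 Q1.
- have [I2 E2 Q2 C2 H2] := on_timeout_spec I1 g1 e1
    vm am C1 Q1 h2.
  by split.
- have [I2 E2 q2 C2 H2] := on_tc_spec I1 g1 e1 vm am C1 h2.
  by split=> //; split=> //; exact: quorums_ok_quiet q2 Q1.
- case: vm => vt nT.
  have [I2 E2 q2 C2 H2] := on_proposal_request_spec I1 g1 e1
    vt nT am hrc C1 h2.
  split; first by split=> //; exact: quorums_ok_quiet q2 Q1.
  move=> l; have [? hv H] := H2 l; split=> // [h /hv/(x_new x1)[]|T p eT sp] //; apply: H => //.
  by case: g1 => _ h _; apply: h.
- case: vm => vt nT.
  have [I2 E2 q2 C2 H2] := on_ne_request_spec I1 g1 e1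
    vt nT am hrc C1 h2.
  by split=> //; split=> //; exact: quorums_ok_quiet q2 Q1.
- have [s2 k1 k2] := h2.
  have x2 : ext s1 s2 by apply: ext_note k1.
  have c2 : calm s1 s2 by apply: calm_note_all k1 => s y ->.
  have I2 := inv_ext I1 x2.
  have [I3 hr] := inv_recover_nec I2 k2.
  have c3 := calm_recover_nec k2.
  have c13 := calm_trans (calm_trans c1 c2) c3.
  have [e3 _ g3 _ _] := c13.
  split.
    split=> //; first exact: (entered_same I3).
      exact: quorums_ok_quiet (calm_quiet c13) quor0.
    exact: committed_calm c13 C0.
  split; first by case: (calm_grows c3) => _ h _; apply: h; rewrite k1; right.
  move=> r er ev [ne [n1 n2 n3 n4]].
  rewrite (x_rec x2) (x_rec x1) (x_cv x2) e1 in hr.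
  apply: (hr r er ev); exists ne; split=> // y /n4 [my|->]; rewrite k1; last by right.
  by left; case: g1 => _ h _; apply: h.
Qed.

Lemma valid_genesis_qc : valid_qc (genesis_qc P).
Proof. by left. Qed.

Lemma on_start_spec s' : cur_view s0 = 0 -> on_start me clk s0 s' ->
  handled s' /\ cur_view s' = 1.
Proof.
move=> c0 [s1 h1 h2].
have ag sg : List.In sg (qc_sigs (genesis_qc P)) -> auth sg by [].
have I1 := inv_enter (c := CQC (genesis_qc P)) inv0 valid_genesis_qc ag h1.
have [_ ev1] := enter_view h1; rewrite c0 in ev1; have {}ev1 := ev1 isT.
have [I2 c2 ll] : [/\ inv s', calm s1 s' & me = leader 1 -> has_issued 1 s'].
  case: h2 => [[l k]|[nl ->]]; last by split=> // /nl.
  have [I2 hi] : inv s' /\ has_issued (cur_view s1) s'.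
    by apply: (inv_propose_qc I1 valid_genesis_qc _ _ k); rewrite ev1.
  by rewrite ev1 in hi; split=> //; exact: calm_issue_new k.
have [e2 _ _ _ _] := c2; rewrite ev1 in e2.
split=> //; split=> //.
- by split; rewrite /lead_ok /entry_ok e2 // => _ /ll; left.
- apply: (quorums_ok_quiet _ quor0); apply: (quiet_trans (enter_quiet h1)).
  exact: calm_quiet.
- apply: (committed_calm c2) => q; have [_ _ _ _ hl] := enter_fields h1.
  by move/hl; rewrite log0 => -[//|[->]]; right.
Qed.

Lemma on_timer_spec s' : (timer_due clk s0 -> why (cur_view s0)) ->
  on_timer me clk s0 s' -> handled s'.
Proof.
move=> hw [td h]; have [c0 _ _] := td.
have [I1 _] := inv_time_out inv0 c0 (hw td) h.
have c1 := calm_time_out h; split=> //.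
- apply: (entered_still (time_out_still h)).
  exact: (entered_same inv0 (grows_refl s0) erefl).
- exact: quorums_ok_quiet (calm_quiet c1) quor0.
- by apply: (committed_calm c1) => q; rewrite log0.
Qed.

Lemma on_tick_spec s' : on_tick clk s0 s' -> handled s'.
Proof.
move=> h; have I1 := inv_tick inv0 h.
have [r [A [_ _ [s1 e1 h1]]]] := h; have c1 := calm_send_all h1.
have c0 : calm s0 s1 by rewrite e1.
have c := calm_trans c0 c1; have [e _ g _ _] := c.
split=> //.
- exact: (entered_same I1).
- exact: quorums_ok_quiet (calm_quiet c) quor0.
- by apply: (committed_calm c) => q; rewrite log0.
Qed.

End Validator.

(** * Executions *)

Section Restart.
Variables (me : V) (clk clk' : R) (past past' : action -> Prop)
  (auth auth' : sig -> Prop) (rc rc' : V -> msg -> Prop) (s0 s : lstate)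
  (why why' : nat -> Prop).
Hypothesis past_sub : forall a, past' a <-> past a \/ List.In a (log s).
Hypothesis auth_sub : forall sg, auth sg -> auth' sg.
Hypothesis rc_sub : forall j m, rc j m -> rc' j m.

Local Notation s1 := (set_log [::] s).

Lemma did_restart a : did past' s1 a <-> did past s a.
Proof. by rewrite /did past_sub /=; tauto. Qed.

Lemma inv_restart :
  inv me clk past auth rc s0 why s -> inv me clk' past' auth' rc' s1 why' s1.
Proof.
move=> I; have D a : did past s a -> did past' s1 a by move=> ?; apply/did_restart.
split=> //=; try by case: I.
- by move=> p /(i_stored I)[|[vp h]]; [left | right; split=> // sg /h/auth_sub].
- move=> h0; case: (i_hvs I h0) => [|[bh [/D a /D b /D c]]]; first by left.
  by right; exists bh.
- by move=> x /(i_gv I)[? /auth_sub].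
- by move=> x /(i_gtv I)[? /auth_sub].
- by move=> M /(i_gto I)[? h]; split=> // sg /h/auth_sub.
- by move=> c /did_restart/(i_acc I)[? h ?]; split=> // sg /h/auth_sub.
- by move=> c0; have [c /D ? ?] := i_cur I c0; exists c.
- by move=> sg /did_restart/(i_sgn I).
- by move=> u /(i_to I)[-> [M [? ? h]]]; split=> //; exists M; split=> // j; apply: D.
- by move=> p /(i_iss I)[? ? h]; split=> // j; apply: D.
- by move=> j t /did_restart/(i_req I).
- by move=> j t /did_restart/(i_preq I).
- move=> r /(i_rec I)[? h1 h2 h3 ?]; split=> //; first by move=> sg /h1/auth_sub.
    by move=> j; apply: D.
  by move=> j /h3/D.
- move=> w /(i_ne I)[t [T [? ? ? h]]]; exists t, T; split=> //; first exact: rc_sub.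
  exact: D.
- by move=> j w qv sg /did_restart/(i_mne I).
- by move=> w /(i_stc I)[t [? ? h]]; exists t; split=> // j; apply: D.
- by move=> q /(i_sqc I) h j; apply: D.
- by left.
- by move=> r _ er _; right; exists r; split=> //; left.
- by move=> r er; left.
- by left.
- by left.
Qed.

Lemma entered_restart : entered_ok me past auth rc s -> entered_ok me past' auth' rc' s1.
Proof.
move=> [l e]; split=> //= h.
case: (e h).
- by move=> p vp /rc_sub h1 ev; exact: (EntryProposal _ _ _ _ vp h1 ev).
- move=> t h1 ev; apply: (@EntryRequest _ _ _ _ _ _ t) => //.
  by case: h1 => /rc_sub; [left | right].
- by move=> l'; apply: EntryLeader.
- by move=> q vq ev h1; apply: (EntryQC me auth' rc' vq ev); apply/did_restart.
- by move=> q vq ev h1; apply: (EntryTC me auth' rc' vq ev); apply/did_restart.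
- move=> h1 [A cA hA]; apply: EntryTimeout => //; exists A => // i /hA[a [b /auth_sub h2]].
  by exists a, b.
Qed.

End Restart.

Section Execution.
Variable E : execution P.
Hypothesis HE : is_execution E.
Local Notation correct := (correct E).
Local Notation st := (st E).
Local Notation time := (time E).
Local Notation clock := (clock E).
Local Notation ev := (ev E).

Definition past k i (a : action) : Prop := exists2 k', k' < k & acts E k' i a.
Definition auth k (sg : sig) : Prop := correct (signer sg) -> past k (signer sg) (Sign sg).
Definition rcvd k i j (m : msg) : Prop := exists2 k', k' < k & ev k' = Deliver j i m.
Definition cur k i : lstate := set_log [::] (st k i).
Definition why k i (u : nat) : Prop :=
  (timer_due (clock i (time k)) (cur k i) /\ u = cur_view (cur k i)) \/
  exists Ms, timeouts_of
    (fun M => valid_timeout (signer (to_sig M)) M /\ auth k (to_sig M)) u f.+1 Ms.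

(** The clock reading [0%R] and the reason [fun=> True] are placeholders: the state is compared with
    itself, so the fields that mention them hold trivially. *)
Definition ginv k i : Prop :=
  [/\ inv i 0%R (past k i) (auth k) (rcvd k i) (cur k i) (fun=> True) (cur k i),
      entered_ok i (past k i) (auth k) (rcvd k i) (cur k i)
    & quorums_ok i (cur k i)].

Definition handled_at k i : Prop :=
  handled i (clock i (time k)) (known_at E k) (past k i) (auth k) (rcvd k.+1 i)
    (cur k i) (why k i) (st k.+1 i).

Lemma past_le k k' i a : k <= k' -> past k i a -> past k' i a.
Proof. by move=> le [k1 lt h]; exists k1 => //; apply: leq_trans lt le. Qed.

Lemma auth_le k k' sg : k <= k' -> auth k sg -> auth k' sg.
Proof. by move=> le h c; apply: past_le le (h c). Qed.

Lemma rcvd_le k k' i j m : k <= k' -> rcvd k i j m -> rcvd k' i j m.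
Proof. by move=> le [k1 lt h]; exists k1 => //; apply: leq_trans lt le. Qed.

Lemma transitionE k : transition E k.
Proof. by have [_ [_ h] _ _ _] := HE. Qed.

Lemma sent_past k i j m : correct i -> ev k = Deliver i j m -> past k i (Send j m).
Proof. by move=> ci e; have [_ _ _ _ [[_ h] _]] := HE; have [k'] := h _ _ _ _ ci e; exists k'. Qed.

Lemma delivered_auth k i j m sg :
  ev k = Deliver j i m -> List.In sg (sigs_msg m) -> auth k sg.
Proof.
move=> e isg c; have [_ _ _ _ [_ h]] := HE.
by have [k'] := h _ _ _ _ _ e isg c; exists k'.
Qed.

Lemma initial_state i : correct i -> st 0 i = initial P.
Proof. by have [_ [h _] _ _ _] := HE; apply: h. Qed.

(** The invariant is assumed for all correct validators, because a proposal obtained through a QC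
    may come from any of them. *)
Lemma event_handled k i : (forall j, correct j -> ginv k j) -> correct i ->
  actor (ev k) = Some i -> handled_at k i /\
  (forall j m, ev k = Deliver j i m -> valid_msg j m ->
     heard i (known_at E k) (cur k i) j m (st k.+1 i)).
Proof.
move=> G ci ai.
have [I0 [L0 E0] Q0] := G i ci.
have ks p : known_at E k p -> sound (auth k) p.
  by move=> [j cj sp]; have [I _ _] := G j cj; exact: (i_stored I).
have auth_own sg : auth k sg -> signer sg = i -> past k i (Sign sg).
  by move=> h e; rewrite -{1}e; apply: h; rewrite e.
have rc_own m : rcvd k.+1 i i m -> past k i (Send i m).
  by move=> [k' lt e]; exact: (past_le (k := k') lt (sent_past ci e)).
have inv0 : inv i (clock i (time k)) (past k i) (auth k) (rcvd k.+1 i) (cur k i)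
    (why k i) (cur k i).
  have ps a : past k i a <-> past k i a \/ List.In a (log (cur k i)) by move=> /=; tauto.
  by apply: (inv_restart _ _ ps _ _ I0) => // j m; apply: rcvd_le.
have ent0 : entered_ok i (past k i) (auth k) (rcvd k.+1 i) (cur k i).
  have ps a : past k i a <-> past k i a \/ List.In a (log (cur k i)) by move=> /=; tauto.
  have e0 : entered_ok i (past k i) (auth k) (rcvd k i) (cur k i) by split.
  by apply: (entered_restart ps _ _ e0) => // j m; apply: rcvd_le.
have [_ ent1] := ent0.
have wq u Ms : timeouts_of
    (fun M => valid_timeout (signer (to_sig M)) M /\ auth k (to_sig M)) u f.+1 Ms ->
    why k i u by move=> h; right; exists Ms.
have := transitionE k; rewrite /transition; case e: (ev k) ai => [|a|a|a|j a m] //= [ea];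
  subst a.
- move=> [c0 [_ h _]]; split=> //.
  by have [] := on_start_spec (known_at E k) inv0 Q0 erefl c0 h.
- move=> [_ h _]; split=> //; apply: (on_timer_spec (known_at E k) inv0 L0 ent1 Q0 erefl _ h).
  by move=> td; left.
- move=> [_ h _]; split=> //.
  exact: (on_tick_spec (known_at E k) inv0 L0 ent1 Q0 erefl h).
- move=> [c0 [_ h _]].
  have am sg : List.In sg (sigs_msg m) -> auth k sg by exact: delivered_auth e.
  have rcm : rcvd k.+1 i j m by exists k.
  have [vm|nvm] := pselect (valid_msg j m).
    have [h1 h2] := on_deliver_spec ks auth_own rc_own inv0 L0 ent1 wq Q0 erefl c0 vm am
      rcm h.
    by split=> // j' m' [<- <-].
  have es : st k.+1 i = cur k i by case: h => [[/nvm]|[_]].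
  split; last by move=> j' m' [<- <-] /nvm.
  by rewrite /handled_at es; exact: (handled0 _ inv0 L0 ent1 Q0 erefl).
Qed.

Lemma idle_state k i : actor (ev k) <> Some i -> st k.+1 i = st k i.
Proof.
have ne a : Some a <> Some i -> i != a.
  by move=> h; apply/eqP => e; apply: h; rewrite e.
have := transitionE k; rewrite /transition; case: (ev k) => [|a|a|a|j a m] /=.
- by move=> h _.
- by move=> [_ [_ _ h]] /ne/h.
- by move=> [_ _ h] /ne/h.
- by move=> [_ _ h] /ne/h.
- by move=> [_ [_ _ h]] /ne/h.
Qed.

Lemma ginv_all k i : correct i -> ginv k i.
Proof.
elim: k i => [|k IH] i ci.
  have ini := initial_state.
  have np a : ~ past 0 i a by move=> [k'].
  have nd a : ~ did (past 0 i) (cur 0 i) a by move=> [/np|].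
  rewrite /ginv /cur ini //; rewrite /cur ini // in nd.
  have nm x : mem (initial P) x -> x = Stored (genesis_proposal P) by [].
  split; last 1 first.
  - move=> u _; split.
    + move=> _ bh q [_ [[sz _] _] h]; case: (qc_sigs q) sz h => // sg l _ h.
      by have /= := h sg (or_introl erefl).
    + move=> [|M l] [sz _ h] //; by have [] := h M (or_introl erefl).
    + move=> [|M l] [sz _ h] //; by have [] := h M (or_introl erefl).
    + by [].
  - split=> //=; try by move=> *; exfalso; (eapply nd; eassumption).
    all: try by [].
    + exact: valid_genesis_qc.
    + by left.
    + by move=> p [->]; left.
    + by left.
have [ai|na] := pselect (actor (ev k) = Some i).
  have [[I1 E1 Q1 _] _] := event_handled IH ci ai.
  have ps a : past k.+1 i a <-> past k i a \/ List.In a (log (st k.+1 i)).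
    split=> [[k' lt [ai' h]]|[[k' lt h]|h]].
    - move: lt; rewrite ltnS leq_eqVlt => /orP[/eqP e|lt]; first by subst k'; right.
      by left; exists k'.
    - by exists k' => //; exact: ltnW.
    - by exists k.
  split=> //.
  - by apply: (inv_restart _ _ ps _ _ I1) => // sg; apply: auth_le.
  - by apply: (entered_restart ps _ _ E1) => // sg; apply: auth_le.
have [I1 E1 Q1] := IH i ci.
have ps a : past k.+1 i a <-> past k i a \/ List.In a (log (cur k i)).
  split=> [[k' lt [ai' h]]|[[k' lt h]|//]]; last by exists k' => //; exact: ltnW.
  move: lt; rewrite ltnS leq_eqVlt => /orP[/eqP e|lt]; first by subst k'.
  by left; exists k'.
have ec : cur k.+1 i = cur k i by rewrite /cur idle_state.
rewrite /ginv ec; split=> //.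
- apply: (inv_restart _ _ ps _ _ I1); first by move=> sg; apply: auth_le.
  by move=> j m; apply: rcvd_le.
- apply: (entered_restart ps _ _ E1); first by move=> sg; apply: auth_le.
  by move=> j m; apply: rcvd_le.
Qed.

Lemma handledE k i : correct i -> actor (ev k) = Some i -> handled_at k i.
Proof. by move=> ci ai; have [] := event_handled (@ginv_all k) ci ai. Qed.

Lemma heardE k i j m : correct i -> ev k = Deliver j i m -> valid_msg j m ->
  heard i (known_at E k) (cur k i) j m (st k.+1 i).
Proof.
move=> ci e vm; have [|_ h] := event_handled (@ginv_all k) ci (i := i).
  by rewrite e.
exact: h e vm.
Qed.

Lemma step_mono k i : correct i ->
  cur_view (st k i) <= cur_view (st k.+1 i) /\
  forall x, mem (st k i) x -> mem (st k.+1 i) x.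
Proof.
move=> ci; have [ai|na] := pselect (actor (ev k) = Some i); last by rewrite idle_state.
by have [I _ _ _] := handledE ci ai; split; [exact: m_cv I | exact: m_mem I].
Qed.

Lemma view_mono k k' i : correct i -> k <= k' -> cur_view (st k i) <= cur_view (st k' i).
Proof.
move=> ci /subnK <-; elim: (k' - k) => [|d IH] //; rewrite addSn.
by apply: leq_trans IH _; case: (step_mono (d + k) ci).
Qed.

Lemma mem_mono k k' i x : correct i -> k <= k' -> mem (st k i) x -> mem (st k' i) x.
Proof.
move=> ci /subnK <-; elim: (k' - k) => [|d IH] // /IH; rewrite addSn.
by case: (step_mono (d + k) ci) => _; apply.
Qed.

Lemma invE k i : correct i ->
  inv i 0%R (past k i) (auth k) (rcvd k i) (cur k i) (fun=> True) (cur k i).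
Proof. by move=> ci; have [] := ginv_all k ci. Qed.

Lemma didE k i a : did (past k i) (cur k i) a -> past k i a.
Proof. by case. Qed.

Lemma time_mono k k' : k <= k' -> (time k <= time k')%R.
Proof.
have [_ _ _ [[h _ _] _] _] := HE.
move=> /subnK <-; elim: (k' - k) => [|d IH] //.
by rewrite addSn; apply: le_trans IH (h _).
Qed.

(** Turns a time into an event index: [st K] is the state once all events up to time T have
    occurred. Such an index exists because time is unbounded along the execution. *)
Definition horizon T K := forall k, k < K <-> (time k <= T)%R.

Lemma horizon_exists T : exists K, horizon T K.
Proof.
have [_ _ _ [[_ h _] _] _] := HE.
have ex : exists k, `[< (T < time k)%R >].
  by have [k hk] := h (T + 1)%R; exists k; apply/asboolP; lra.
exists (ex_minn ex); case: ex_minnP => K /asboolP lt min k; split=> h'.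
  rewrite leNgt; apply/negP => h2; have := min k (asboolT h2); lia.
rewrite ltnNge; apply/negP => le; have := time_mono le; lra.
Qed.

Lemma horizon_le T T' K K' : horizon T K -> horizon T' K' -> (T <= T')%R -> K <= K'.
Proof.
move=> h h' le; case: K h => [|K] h //.
by apply/h'; apply: le_trans le; apply/h.
Qed.

Lemma entered_at k i : correct i -> 0 < cur_view (st k i) ->
  exists k', [/\ k' < k, timer (st k i) = clock i (time k'),
    cur_view (st k'.+1 i) = cur_view (st k i)
    & exists2 c, accepts E k' i c & (cert_view c).+1 = cur_view (st k i)].
Proof.
move=> ci; elim: k => [|k IH].
  by rewrite initial_state.
have [ai|na] := pselect (actor (ev k) = Some i); last first.
  rewrite (idle_state na) => /IH[k' [lt ? ? ?]]; exists k'; split=> //; exact: ltnW.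
have [I _ _ _] := handledE ci ai.
case: (m_time I) => [[e1 e2]|[lt e1 [c hc ec]]] c0.
  rewrite e1 e2; rewrite e1 in c0; have [k' [lt ? ? ?]] := IH c0.
  by exists k'; split=> //; exact: ltnW.
by exists k; split=> //; exists c.
Qed.

Lemma accept_info k i c : correct i -> accepts E k i c ->
  [/\ valid_cert c, forall sg, List.In sg (sigs_cert c) -> auth k sg,
      cert_view c < cur_view (st k.+1 i) & cur_view (st k i) <= cert_view c].
Proof.
move=> ci [ai hc]; have [I _ _ _] := handledE ci ai.
have [? ? ?] := i_acc I (or_intror hc).
by split=> //; have [|] := m_acc I hc.
Qed.

(** * Correct signers of certificates *)

Lemma byz_le : #|byz E| <= f. Proof. by have [[]] := HE. Qed.

Lemma past_signed k i c : correct i -> past k i (Sign (Sig i c)) ->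
  exists k', [/\ k' < k, signed_ok (cur k'.+1 i) c & past k'.+1 i (Sign (Sig i c))].
Proof.
move=> ci [k' lt h]; have p1 : past k'.+1 i (Sign (Sig i c)) by exists k'.
by exists k'; split=> //; have [_] := i_sgn (invE k'.+1 ci) (or_introl p1).
Qed.

Lemma qc_signers k q : valid_qc q -> 0 < qc_view q ->
  (forall sg, List.In sg (qc_sigs q) -> auth k sg) ->
  exists A : {set V}, f < #|A| /\ forall i, i \in A -> correct i /\
    past k i (Sign (Sig i (CVote (qc_view q) (qc_block_hash q) (qc_pid q)))).
Proof.
move=> [->//|[_ [dq sg]]] _ aq.
have [A [cA hA]] := quorum_correct byz_le dq.
exists A; split=> // i /hA[ci [s isg es]]; split=> //.
have c' : correct (signer s) by rewrite es.
have := aq _ isg c'; rewrite es.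
have := nseq_In sg isg; case: s es {isg c'} => i' c' /= -> ->; exact.
Qed.

Lemma tc_signers k (t : tc) : valid_tc t ->
  (forall sg, List.In sg (sigs_tc t) -> auth k sg) ->
  exists A : {set V}, f < #|A| /\ forall i, i \in A -> correct i /\
    exists a b, past k i (Sign (Sig i (CTimeout (tc_view t) a b))).
Proof.
case: t => w ts T qs q ss /= [dq _ esg _] at_.
have [A [cA hA]] := quorum_correct byz_le dq.
exists A; split=> // i /hA[ci [s isg es]]; split=> //.
have : List.In (signed s) [seq signed sg | sg <- ss] by apply: In_map.
rewrite esg => h; have [[a b] _ e] := In_map_inv h; exists a, b.
have a1 : auth k s by apply: at_; rewrite In_cat; left.
rewrite -es in ci; have := a1 ci; rewrite es.
by rewrite /= in e; rewrite e -es; case: s {es isg h e a1 ci}.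
Qed.

Lemma some_in (A : {set V}) : f < #|A| -> exists i, i \in A.
Proof. by move=> h; apply/set0Pn; rewrite -card_gt0; apply: leq_ltn_trans h. Qed.

Lemma past_timeout k i u a b : correct i -> past k i (Sign (Sig i (CTimeout u a b))) ->
  mem (st k i) (SentTimeout u).
Proof. by move=> ci h; have [_] := i_sgn (invE k ci) (or_introl h). Qed.

(* Views are entered one after the other: f + 1 correct validators have been in
   the view of a certificate before it is formed. *)
Lemma view_entered k i w : correct i -> 0 < w <= cur_view (st k i) ->
  exists k' j, [/\ k' < k, correct j & enters E k' j w].
Proof.
elim: k {-2}k (leqnn k) i => [|K IH] k leK i ci /andP[w0 lew].
  have c0 : 0 < cur_view (st k i) by apply: leq_trans lew.
  by have [k' [lt _ _ _]] := entered_at ci c0; lia.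
have c0 : 0 < cur_view (st k i) by apply: leq_trans lew.
have [k1 [lt1 _ _ [c hc ec]]] := entered_at ci c0.
have [e|ne] := eqVneq w (cur_view (st k i)).
  by exists k1, i; split=> //; exists c => //; rewrite e.
have [vc ac _ _] := accept_info ci hc.
have w1 : w <= cert_view c by lia.
have c1 : 0 < cert_view c by apply: leq_trans w1.
have [k2 [j [lt2 cj lej]]] : exists k2 j, [/\ k2 < k1, correct j &
    cert_view c <= cur_view (st k2.+1 j)].
  case: c {hc ec w1} vc ac c1 => [q|t] /= vc ac c1.
    have [A [cA hA]] := qc_signers vc c1 ac; have [j /hA[cj pj]] := some_in cA.
    have [k2 [lt2 [_ [/andP[_ le2] _]] _]] := past_signed cj pj.
    by exists k2, j.
  have [A [cA hA]] := tc_signers vc ac; have [j /hA[cj [a [b pj]]]] := some_in cA.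
  have [k2 [lt2 so _]] := past_signed cj pj.
  by have [/andP[_ le2] _] := i_to (invE k2.+1 cj) so; exists k2, j.
have [||k3 [j' [lt3 ? ?]]] := IH k2.+1 _ j cj; first by lia.
  by rewrite w0; apply: leq_trans w1 lej.
by exists k3, j'; split=> //; lia.
Qed.

Lemma tau_le w t k i : is_tau E w t -> correct i -> 0 < w <= cur_view (st k i) ->
  exists2 k', k' < k & (t <= time k')%R.
Proof.
move=> [_ ht] ci h; have [k' [j [lt cj en]]] := view_entered ci h.
by exists k' => //; apply: ht en.
Qed.

Lemma accurate i T U : correct i -> (gst E <= T)%R -> (T <= U)%R ->
  (clock i U - clock i T = U - T)%R.
Proof. by move=> ci h1 h2; have [_ _ _ [[_ _ h] _] _] := HE; have [_ h'] := h i ci; apply: h'. Qed.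

(* A correct validator times out because its timer elapsed, or because another
   correct validator did so before. *)
Lemma timeout_late v t0 : 0 < v -> is_tau E v t0 -> (gst E <= t0)%R ->
  forall k j u, correct j -> v <= u -> mem (st k j) (SentTimeout u) ->
  exists2 k', k' < k & (t0 + theta_view P <= time k')%R.
Proof.
move=> v0 tau g0; elim/ltn_ind=> k IH j u cj vu.
case: k IH => [|k] IH.
  by rewrite initial_state.
have [old|new] := pselect (mem (st k j) (SentTimeout u)).
  by have [k' lt h] := IH k (ltnSn _) j u cj vu old; exists k' => //; exact: ltnW.
have [aj|na] := pselect (actor (ev k) = Some j); last by rewrite (idle_state na).
have [I _ _ _] := handledE cj aj.
move=> /(m_tout I)[//|[leu [[[c0 _ due] eu]|[Ms [sz un hM]]]]].
  have [k' [lt et ev' _]] := entered_at cj c0.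
  have h1 : 0 < v <= cur_view (st k'.+1 j) by rewrite v0 ev' -[cur_view _]eu.
  have [k2 lt2 le2] := tau_le tau cj h1.
  have le3 : (time k2 <= time k')%R by apply: time_mono.
  have le4 : (time k' <= time k)%R by apply: time_mono; exact: ltnW.
  exists k => //; have := accurate cj (le_trans g0 (le_trans le2 le3)) le4.
  rewrite /= et in due; move: due le2 le3.
  set a := clock j _; set b := clock j _; lra.
(* Otherwise f + 1 validators have signed timeouts of view u; one of them is correct and timed out
   at an earlier event, to which the induction hypothesis applies. *)
pose A := [set i in [seq signer (to_sig M) | M <- Ms]].
have cA : #|A| = f.+1 by rewrite cardsE (card_uniqP un) size_map sz.
have [i iA ci] : exists2 i, i \in A & correct i.
  apply: contrapT => h; have : A \subset byz E.
    apply/subsetP => i iA; apply: contrapT => /negP ci; apply: h; by exists i.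
  by move/subset_leq_card => h1; have := leq_trans h1 byz_le; rewrite cA ltnn.
move: iA; rewrite inE => /mem_map_In[M MM es].
have [[[_ _ esg _] am] ew] := hM _ MM.
rewrite -es in ci; have pM := am ci; rewrite esg ew /= in pM.
have ci' : correct (signer (to_sig M)) by [].
have [k1 [lt1 so _]] := past_signed ci' pM.
have [|k' lt h] := IH k1.+1 _ _ u ci' vu so; first by lia.
by exists k' => //; lia.
Qed.

Definition no_timeout u k := forall j, correct j -> ~ mem (st k j) (SentTimeout u).

Lemma no_timeout_le u k k' : k <= k' -> no_timeout u k' -> no_timeout u k.
Proof. by move=> le h j cj m; apply: (h j cj); apply: (mem_mono cj le m). Qed.

Lemma no_timeout_horizon v t0 T K u : 0 < v -> is_tau E v t0 -> (gst E <= t0)%R ->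
  horizon T K -> (T < t0 + theta_view P)%R -> v <= u -> no_timeout u K.
Proof.
move=> v0 tau g0 hK lt vu j cj m; have [k' /hK h1 h2] := timeout_late v0 tau g0 cj vu m.
lra.
Qed.

Lemma proposal_issued k p : valid_proposal p -> correct (leader (p_view p)) ->
  auth k (p_sig p) ->
  exists p', [/\ mem (st k (leader (p_view p))) (Issued p'), p_view p' = p_view p
    & p_pid p' = p_pid p].
Proof.
move=> vp cl a; have [_ epid esg _ _] := valid_proposalE vp.
rewrite esg in a; have ps := a cl.
have [_ [p' m' e']] := i_sgn (invE k cl) (or_introl ps).
exists p'; split=> //; have [vp' _ _] := i_iss (invE k cl) m'.
by have [_ epid' _ _ _] := valid_proposalE vp'; move: e'; rewrite epid' epid => /pid_inj[].
Qed.

Lemma stored_auth k i p : correct i -> stored (st k i) p -> valid_proposal p ->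
  forall sg, List.In sg (sigs_tip (tip_of p)) -> auth k sg.
Proof.
move=> ci sp vp; have [e|[_ h] //] := i_stored (invE k ci) (sp : stored (cur k i) p).
by have := valid_proposal_pos vp; rewrite e.
Qed.

Lemma vote_stored k i u bh h : correct i -> no_timeout u k ->
  past k i (Sign (Sig i (CVote u bh h))) ->
  exists p, [/\ stored (st k i) p, valid_proposal p, p_view p = u & p_pid p = h].
Proof.
move=> ci nt ps; have [_ [_ [_ [m|//]]]] := i_sgn (invE k ci) (or_introl ps).
by case: (nt i ci).
Qed.

(** A correct signer of the QC has not timed out in its view, so its vote is not a tip vote but was
    cast on a stored proposal. *)
Lemma qc_stored k q : valid_qc q -> 0 < qc_view q ->
  (forall sg, List.In sg (qc_sigs q) -> auth k sg) -> no_timeout (qc_view q) k ->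
  exists p, [/\ known_at E k p, valid_proposal p, p_view p = qc_view q,
    p_pid p = qc_pid q & forall sg, List.In sg (sigs_tip (tip_of p)) -> auth k sg].
Proof.
move=> vq q0 aq nt; have [A [cA hA]] := qc_signers vq q0 aq.
have [j /hA[cj pj]] := some_in cA; have [p [sp vp evp ep]] := vote_stored cj nt pj.
by exists p; split=> //; [exists j | exact: stored_auth cj sp vp].
Qed.

Lemma tc_timeout k (t : tc) : valid_tc t ->
  (forall sg, List.In sg (sigs_tc t) -> auth k sg) -> ~ no_timeout (tc_view t) k.
Proof.
move=> vt at_ nt; have [A [cA hA]] := tc_signers vt at_.
have [j /hA[cj [a [b pj]]]] := some_in cA.
by apply: (nt j cj); apply: past_timeout pj.
Qed.

(** Without timeouts in u, view u + 1 is entered by a QC of u. One of its correct voters stores a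
    proposal of u, and only the correct leader can have signed that. *)
Lemma passed_issued k i u : correct i -> 0 < u < cur_view (st k i) ->
  correct (leader u) -> no_timeout u k -> has_issued u (st k (leader u)).
Proof.
move=> ci /andP[u0 lt] cl nt.
have [k' [j [lt' cj [c hc [ec]]]]] := view_entered (w := u.+1) ci lt.
have [vc ac _ _] := accept_info cj hc; subst u.
have nt' : no_timeout (cert_view c) k' by apply: no_timeout_le nt; exact: ltnW.
case: c {hc lt} vc ac u0 cl nt nt' => [q|t] /= vc ac u0 cl nt nt'; last first.
  by case: (tc_timeout vc ac).
have [p [_ vp evp ep ap]] := qc_stored vc u0 ac nt'.
rewrite -evp in cl *; have [|p' [m' ? _]] := @proposal_issued k' p vp cl.
  by apply: ap; left.
by exists p' => //; apply: (mem_mono cl (ltnW lt') m').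
Qed.

Lemma issued_view k i u : correct i -> has_issued u (st k i) -> u <= cur_view (st k i).
Proof. by move=> ci [p m <-]; have [_ le _] := i_iss (invE k ci) m. Qed.

(** * Delivery within [delta] after GST *)

Lemma delta_bounds : (0 < delta E /\ delta E <= bigDelta P)%R.
Proof. by have [[_ /andP[? ?]] _ _ _ _] := HE. Qed.

Lemma delivered T k K1 K2 i j m : correct i -> correct j -> horizon T K1 ->
  (gst E <= T)%R -> horizon (T + delta E)%R K2 -> k < K1 -> acts E k i (Send j m) ->
  exists2 k', k < k' < K2 & ev k' = Deliver i j m.
Proof.
move=> ci cj h1 gT h2 /h1 le a; have [_ _ _ _ [[rel _] _]] := HE.
have [k' [lt e le']] := rel _ _ _ _ ci cj a; exists k' => //.
rewrite lt /=; apply/h2.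
by apply: (le_trans le'); rewrite lerD2r ge_max le gT.
Qed.

Section At.
Variables (T : R) (K1 K2 : nat).
Hypothesis h1 : horizon T K1.
Hypothesis gT : (gst E <= T)%R.
Hypothesis h2 : horizon (T + delta E)%R K2.

Lemma heard_by k i j m : correct i -> correct j -> valid_msg i m -> k < K1 ->
  acts E k i (Send j m) -> exists k', [/\ k < k' < K2, ev k' = Deliver i j m &
    heard j (known_at E k') (cur k' j) i m (st k'.+1 j)].
Proof.
move=> ci cj vm lt a; have [k' lt' e] := delivered ci cj h1 gT h2 lt a.
by exists k'; split=> //; apply: (heardE).
Qed.

Lemma got_timeout i j M : correct i -> correct j -> valid_timeout i M ->
  past K1 i (Send j (MTimeout M)) ->
  to_view M < cur_view (st K2 j) \/ mem (st K2 j) (GotTimeout M).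
Proof.
move=> ci cj vM [k0 l0 a0].
have [k [/andP[_ lt] _ [h|h]]] := heard_by (m := MTimeout M) ci cj vM l0 a0.
  by left; apply: leq_trans h (view_mono cj lt).
by right; apply: (mem_mono cj lt).
Qed.

Lemma got_vote i j x : correct i -> correct j -> valid_vote x -> signer (v_sig x) = i ->
  j = leader (v_view x) \/ j = leader (v_view x).+1 ->
  past K1 i (Send j (MVote x)) ->
  v_view x < cur_view (st K2 j) \/ mem (st K2 j) (GotVote x).
Proof.
move=> ci cj vx sx lj [k0 l0 a0].
have [k [/andP[_ lt] _ h]] := heard_by (m := MVote x) ci cj (conj vx sx) l0 a0.
have [h'|h'] := h lj; first by left; apply: leq_trans h' (view_mono cj lt).
by right; apply: (mem_mono cj lt).
Qed.

Lemma got_qc i j q : correct i -> correct j -> valid_qc q -> j = leader (qc_view q).+1 ->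
  past K1 i (Send j (MQC q)) -> qc_view q < cur_view (st K2 j).
Proof.
move=> ci cj vq lj [k0 l0 a0].
have [k [/andP[_ lt] _ h]] := heard_by (m := MQC q) ci cj vq l0 a0.
exact: leq_trans (h lj) (view_mono cj lt).
Qed.

Lemma got_tc i j t : correct i -> correct j -> valid_tc t ->
  past K1 i (Send j (MTC t)) -> tc_view t < cur_view (st K2 j).
Proof.
move=> ci cj vt [k0 l0 a0].
have [k [/andP[_ lt] _ h]] := heard_by (m := MTC t) ci cj vt l0 a0.
exact: leq_trans h (view_mono cj lt).
Qed.

End At.

Lemma timeouts_list (S : {set V}) w k s : k <= #|S| ->
  (forall i, i \in S -> exists M, [/\ mem s (GotTimeout M), to_view M = w &
     signer (to_sig M) = i]) ->
  exists Ms, timeouts_of (fun M => mem s (GotTimeout M)) w k Ms.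
Proof.
move=> le h; have [l [sl ul hl]] := @set_take S k le.
have [|Ms eMs hMs] := list_choice (g := fun M' : timeout => signer (to_sig M'))
  (Q := fun M' => mem s (GotTimeout M') /\ to_view M' = w) (l := l).
  by move=> i /hl/h[M [? ? ?]]; exists M.
exists Ms; split; [ | by rewrite eMs | exact: hMs].
by rewrite -(size_map (fun M' : timeout => signer (to_sig M'))) eMs.
Qed.

Lemma sent_timeout k i u : correct i -> mem (st k i) (SentTimeout u) ->
  exists M, [/\ valid_timeout i M, to_view M = u & forall j, past k i (Send j (MTimeout M))].
Proof.
move=> ci m; have [_ [M [? ? h]]] := i_to (invE k ci) m.
by exists M; split=> // j; apply: (didE (h j)).
Qed.

Lemma valid_timeout_signer i (M : timeout) : valid_timeout i M -> signer (to_sig M) = i.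
Proof. by move=> [_ _ -> _]. Qed.

Lemma issued_mono k k' i u : correct i -> k <= k' ->
  has_issued u (st k i) -> has_issued u (st k' i).
Proof. by move=> ci le [p m e]; exists p => //; apply: (mem_mono ci le). Qed.

Section Propagate.
Variables (v : nat) (t0 : R).
Hypothesis v1 : 1 < v.
Hypothesis tau : is_tau E v t0.
Hypothesis g0 : (gst E <= t0)%R.
Hypothesis cl : correct (leader v).

Let v0 : 0 < v. Proof. exact: ltnW. Qed.

(** If [j] is past v, the leader has issued its proposal already. If [j] is in v, its [entry]
    decides: either the leader sent the message that brought [j] there, or it is [j], or a
    certificate is on its way to it and arrives within [delta]. Only an entry by timeouts gives no
    such hold. *)
Lemma entered_leader T K K2 j : (gst E <= T)%R -> (T < t0 + theta_view P)%R ->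
  horizon T K -> horizon (T + delta E)%R K2 -> correct j -> v <= cur_view (st K j) ->
  v <= cur_view (st K2 (leader v)) \/
  (mem (st K j) (SentTimeout v.-1) /\ timeout_quorum (auth K) v.-1).
Proof.
move=> gT lT hK hK2 cj; have [d0 _] := delta_bounds.
have le12 : K <= K2 by apply: (horizon_le hK hK2); lra.
have vl := view_mono cl le12.
have nt : no_timeout v K by apply: (no_timeout_horizon v0 tau g0 hK).
rewrite leq_eqVlt => /orP[/eqP ev|lt]; last first.
  left; apply: leq_trans vl; apply: (issued_view cl).
  by apply: (passed_issued cj _ cl nt); rewrite v0.
have [_ [_ en] _] := ginv_all K cj.
have := en; rewrite /entry_ok /= -ev => /(_ v1); case.
- move=> p vp [k lt e] evp; left; apply: leq_trans vl; apply: (issued_view cl).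
  have ap : auth K (p_sig p).
    by apply: auth_le (ltnW lt) (delivered_auth e _); left.
  have cl' : correct (leader (p_view p)) by rewrite evp.
  by have [p' [m' e' _]] := proposal_issued vp cl' ap; exists p'; rewrite -?evp.
- move=> t h et; left; apply: leq_trans vl.
  suff : tc_view t < cur_view (st K (leader v)) by rewrite et.
  case: h => -[k lt e]; have pk := past_le (ltnW lt) (sent_past cl e).
    exact: (i_preq (invE K cl) (or_introl pk)).
  by case: (i_req (invE K cl) (or_introl pk)).
- by move=> l; left; apply: leq_trans vl; rewrite -l ev.
- move=> q vq eq /didE ps; left.
  by have := got_qc hK gT hK2 cj cl vq _ ps; rewrite eq; apply.
- move=> t vt et /didE ps; left.
  by have := got_tc hK gT hK2 cj cl vt ps; rewrite et.
- by right.
Qed.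

Lemma leader_enters K2 : horizon (t0 + delta E + delta E)%R K2 ->
  (t0 + delta E < t0 + theta_view P)%R ->
  v <= cur_view (st K2 (leader v)).
Proof.
move=> hK2 lt; have [d0 _] := delta_bounds.
have [K0 hK0] := horizon_exists t0.
have [K1 hK1] := horizon_exists (t0 + delta E)%R.
have le01 : K0 <= K1 by apply: (horizon_le hK0 hK1); lra.
have le12 : K1 <= K2 by apply: (horizon_le hK1 hK2); lra.
apply: contrapT => nl.
have [[k0 [j0 [cj0 [c ac ec] et0]]] _] := tau.
have lt0 : k0 < K0 by apply/hK0; rewrite et0.
have [_ _ vc _] := accept_info cj0 ac.
have vj0 : v <= cur_view (st K0 j0).
  by rewrite -ec; apply: leq_trans vc (view_mono cj0 lt0).
have lt00 : (t0 < t0 + theta_view P)%R by lra.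
have [h|[_ [A cA hA]]] := entered_leader g0 lt00 hK0 hK1 cj0 vj0.
  by apply: nl; apply: leq_trans h (view_mono cl le12).
pose A' := A :\: byz E.
have cA' : f < #|A'|.
  rewrite cardsD; have := subset_leq_card (subsetIr A (byz E)).
  have := byz_le; move: cA; set a := #|A|; set b := #|_ :&: _|; set c' := #|byz E|.
  lia.
have hA' i : i \in A' -> correct i /\ mem (st K0 i) (SentTimeout v.-1).
  rewrite in_setD => /andP[ci /hA[a [b sa]]]; split=> //.
  exact: (past_timeout ci (sa ci)).
have g1 : (gst E <= t0 + delta E)%R by apply: (le_trans g0); rewrite lerDl; exact: ltW.
(* A correct validator that is in v by then can only have entered by timeouts, having timed out
   itself; one still below v has received the timeout messages of all of [A']. *)
have sent j : correct j -> mem (st K1 j) (SentTimeout v.-1).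
  move=> cj; have [vj|nvj] := leqP v (cur_view (st K1 j)).
    by have [h|[h _]] := entered_leader g1 lt hK1 hK2 cj vj; first by case: nl.
  have [_ _ Q] := ginv_all K1 cj.
  have [|_ q2 _ _] := Q v.-1; first by rewrite /= -ltnS prednK.
  have [|Ms ts] := timeouts_list (S := A') (w := v.-1) (s := st K1 j) cA'; last exact: q2 ts.
  move=> i /hA'[ci /(sent_timeout ci)[M [vM ev ps]]].
  have [lt'|g] := got_timeout hK0 g0 hK1 ci cj vM (ps j); last first.
    by exists M; split=> //; exact: valid_timeout_signer vM.
  by move: lt'; rewrite ev; lia.
(* The timeout messages of all correct validators have reached the leader: a quorum that it cannot
   hold in a view below v. *)
have [_ _ Q] := ginv_all K2 cl.
have [|_ _ q3 _] := Q v.-1; first by rewrite /= -ltnS prednK // ltnNge; apply/negP.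
have [|Ms ts] := timeouts_list (S := ~: byz E) (w := v.-1) (s := st K2 (leader v))
  (correct_quorum (byz_le)); last exact: q3 ts.
move=> i; rewrite inE => ci; have [M [vM ev ps]] := sent_timeout ci (sent i ci).
have [lt'|g] := got_timeout hK1 g1 hK2 ci cl vM (ps _); last first.
  by exists M; split=> //; exact: valid_timeout_signer vM.
by case: nl; move: lt'; rewrite ev; lia.
Qed.

End Propagate.

(** * Recover terminates *)

(** The rounded-up quotient of [n] by [kappa], minus one: the number of batches of requests after
    the first. *)
Definition ticks : nat := ((n + kappa P).-1 %/ kappa P).-1.

Lemma ticks_enough : n <= ticks.+1 * kappa P.
Proof.
have k0 := kappa_gt0 P; rewrite /ticks; set m := n.
have m0 : 0 < m by [].
have h := ltn_ceil (m + kappa P).-1 k0.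
have q1 : 0 < (m + kappa P).-1 %/ kappa P by rewrite divn_gt0 //; lia.
rewrite prednK //; move: h; rewrite mulSn; lia.
Qed.

Lemma theta_viewE : theta_view P = (ticks%:R * interval P + 8 * bigDelta P)%R.
Proof. by rewrite /theta_view /theta_recovery -/ticks; ring. Qed.

Lemma rec_tick_event k i r : correct i -> recov (st k i) = Some r ->
  exists2 k', k' < k & rec_tick r = clock i (time k').
Proof.
move=> ci; elim: k => [|k IH].
  by rewrite initial_state.
have [ai|na] := pselect (actor (ev k) = Some i); last first.
  by rewrite (idle_state na) => /IH[k' ? ?]; exists k' => //; exact: ltnW.
have [I _ _ _] := handledE ci ai.
move=> /(m_tick I)[/= /IH[k' ? ?]|e]; first by exists k' => //; exact: ltnW.
by exists k.
Qed.

Section Leader.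
Variables (v : nat) (t0 T : R) (K Ke : nat).
Hypothesis v0 : 0 < v.
Hypothesis tau : is_tau E v t0.
Hypothesis g0 : (gst E <= t0)%R.
Hypothesis cl : correct (leader v).
Hypothesis gT : (gst E <= T)%R.
Hypothesis hK : horizon T K.
Hypothesis vK : v <= cur_view (st K (leader v)).
Hypothesis hKe : horizon (T + ticks%:R * interval P + delta E + delta E)%R Ke.
Hypothesis early : (T + ticks%:R * interval P + delta E + delta E < t0 + theta_view P)%R.
(** Refuted in this section. Together with [early], which puts [Ke] before any timeout of v, it pins
    the situation down: nobody passes v before [Ke], and once in v the leader keeps running Recover
    for one and the same TC. *)
Hypothesis not_issued : ~ has_issued v (st Ke (leader v)).

Let L := leader v.
Let d0 : (0 < delta E)%R. Proof. by case: (delta_bounds). Qed.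
Let i0 : (0 <= interval P)%R. Proof. exact: interval_ge0. Qed.

Lemma no_timeout_yet : no_timeout v Ke.
Proof. exact: (no_timeout_horizon v0 tau g0 hKe early). Qed.

Lemma not_passed k i : k <= Ke -> correct i -> cur_view (st k i) <= v.
Proof.
move=> le ci; rewrite leqNgt; apply/negP => lt; apply: not_issued.
apply: (issued_mono cl le); apply: (passed_issued ci _ cl).
  by rewrite v0.
exact: no_timeout_le no_timeout_yet.
Qed.

Lemma recovering k : k <= Ke -> v <= cur_view (st k L) ->
  cur_view (st k L) = v /\
  exists r, [/\ recov (st k L) = Some r, (tc_view (rec_tc r)).+1 = v
    & tc_high_tip (rec_tc r) = Some (rec_tip r)].
Proof.
move=> le lev; have ev : cur_view (st k L) = v.
  by apply/eqP; rewrite eqn_leq lev (not_passed le cl).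
split=> //; have [I [l _] _] := ginv_all k cl.
have := l; rewrite /lead_ok /= -/L ev => /(_ v0 erefl)[h|[_ [r er etc]]].
  by case: not_issued; apply: (issued_mono cl le h).
by exists r; split=> //; have [[]] := i_rec I er.
Qed.

Lemma persists k k' r : k <= k' <= Ke -> v <= cur_view (st k L) ->
  recov (st k L) = Some r -> (tc_view (rec_tc r)).+1 = v ->
  exists r', [/\ recov (st k' L) = Some r', rec_tc r' = rec_tc r, rec_tip r' = rec_tip r
    & r' = r \/ minn (#|rec_asked r| + kappa P) n <= #|rec_asked r'|].
Proof.
move=> /andP[/subnK <-] + vk er etc; elim: (k' - k) => [|d IH] le.
  by exists r; split=> //; left.
rewrite addSn in le *; have [r1 [er1 e1 e2 h1]] := IH (ltnW le).
have [ai|na] := pselect (actor (ev (d + k)) = Some L); last first.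
  by rewrite (idle_state na); exists r1.
have [I _ _ _] := handledE cl ai.
have vd : v <= cur_view (st (d + k) L).
  by apply: leq_trans vk (view_mono cl (leq_addl _ _)).
have ed : cur_view (st (d + k) L) = v.
  by apply/eqP; rewrite eqn_leq vd (not_passed (ltnW le) cl).
have ed1 : cur_view (st (d + k).+1 L) = v.
  apply/eqP; rewrite eqn_leq (not_passed le cl) /=.
  exact: leq_trans vd (view_mono cl (leqnSn _)).
have [||h|[r2 [er2 e3 e4 h2]]] := m_lead I _ er1.
- by rewrite ed1 /= ed.
- by rewrite e1 etc /= ed.
- by rewrite ed1 in h; case: not_issued; apply: (issued_mono cl le h).
exists r2; split; rewrite ?e3 ?e4 //.
case: h1 h2 => [->//|h1] [->|h2]; first by right.
right; apply: leq_trans h1 (leq_trans _ h2).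
rewrite leq_min -[X in _ && (_ <= X)](card_ord n) max_card andbT.
exact: leq_addr.
Qed.

(* After [m] ticks, [m + 1] batches of validators have been asked. *)
Lemma asked_batches m Hm : horizon (T + m%:R * interval P)%R Hm -> Hm <= Ke ->
  exists r, [/\ recov (st Hm L) = Some r, (tc_view (rec_tc r)).+1 = v
    & minn (m.+1 * kappa P) n <= #|rec_asked r|].
Proof.
have i1 := i0; have d1 := d0; have gT1 := gT.
elim: m Hm => [|m IH] Hm hm le.
  have leK : K <= Hm by apply: (horizon_le hK hm); rewrite mul0r addr0.
  have [ev [r [er etc _]]] := recovering le (leq_trans vK (view_mono cl leK)).
  exists r; split=> //; rewrite mul1n.
  by have [_ _ _ _] := i_rec (invE Hm cl) er.
have [H0 h0] := horizon_exists (T + m%:R * interval P)%R.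
have mS : (m.+1%:R = m%:R + 1 :> R)%R by rewrite -natr1.
have le0 : H0 <= Hm by apply: (horizon_le h0 hm); rewrite mS; lra.
have m0 : (0 <= m%:R * interval P)%R by rewrite mulr_ge0.
have leK0 : K <= H0 by apply: (horizon_le hK h0); lra.
have vH0 := leq_trans vK (view_mono cl leK0).
have [r [er etc ask]] := IH H0 h0 (leq_trans le0 le).
have [|r' [er' e1 _ grown]] := persists (k := H0) (k' := Hm) _ vH0 er etc; first by rewrite le0.
exists r'; split; rewrite ?e1 //.
have goal a b : minn (m.+1 * kappa P) n <= a -> minn (a + kappa P) n <= b ->
    minn (m.+2 * kappa P) n <= b.
  by rewrite !mulSn; set c := m * kappa P; set N := n; lia.
case: grown => [er'r|h]; last exact: goal ask h.
have [full|nfull] := eqVneq (rec_asked r) setT.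
  by rewrite er'r full cardsT card_ord geq_minr.
(* No batch was added although not everybody has been asked. The tick set by time T + m * [interval]
   is then due at T + (m + 1) * [interval]; due ticks are served before time passes, so event [Hm]
   would still lie within its own horizon. *)
exfalso; subst r'.
have [k1 lt1 et] := rec_tick_event cl er.
have hm0 : 0 < Hm by apply: leq_trans le0; apply: leq_ltn_trans lt1.
have tp : (time Hm.-1 <= T + m.+1%:R * interval P)%R by apply/hm; rewrite prednK.
have : (time Hm <= T + m.+1%:R * interval P)%R.
  have [_ _ _ [_ served] _] := HE.
  rewrite -{1}(prednK hm0); apply: (served _ L) => //.
  right; exists r; rewrite prednK //; split=> //.
  have [_ _ _ [[_ _ acc] _] _] := HE; have [cm ca] := acc L cl.
  have c1 : (clock L (time k1) <= clock L (T + m%:R * interval P))%R.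
    by apply: cm; apply/h0.
  have c2 : (clock L (T + m.+1%:R * interval P) - clock L (T + m%:R * interval P)
     = interval P)%R.
    rewrite ca; [by rewrite mS; lra | lra | by rewrite mS; lra].
  by rewrite et; lra.
by move/hm; rewrite ltnn.
Qed.

Lemma asked_all : exists (r : recovery) Hc, [/\ horizon (T + ticks%:R * interval P)%R Hc,
  recov (st Hc L) = Some r, (tc_view (rec_tc r)).+1 = v
  & forall j, past Hc L (Send j (MProposalRequest (rec_tc r)))].
Proof.
have i1 := i0; have d1 := d0.
have [Hc hc] := horizon_exists (T + ticks%:R * interval P)%R.
have le : Hc <= Ke by apply: (horizon_le hc hKe); lra.
have [r [er etc ask]] := asked_batches hc le.
exists r, Hc; split=> // j; have [_ _ _ h _] := i_rec (invE Hc cl) er.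
have full : rec_asked r = setT.
  apply/eqP; rewrite eqEcard subsetT /= cardsT card_ord.
  by apply: leq_trans ask; rewrite leq_min ticks_enough leqnn.
by apply: didE; apply: h; rewrite full inE.
Qed.

(** Both runs persist up to [Ke], where there is only one. *)
Lemma same_recovery k k' r r' : k <= Ke -> k' <= Ke ->
  recov (st k L) = Some r -> (tc_view (rec_tc r)).+1 = v ->
  recov (st k' L) = Some r' -> (tc_view (rec_tc r')).+1 = v ->
  rec_tc r' = rec_tc r /\ rec_tip r' = rec_tip r.
Proof.
move=> le le' er etc er' etc'.
have vw k1 r1 : recov (st k1 L) = Some r1 -> (tc_view (rec_tc r1)).+1 = v ->
    v <= cur_view (st k1 L).
  by move=> er1 <-; have [[lt _ _ _] _ _ _ _] := i_rec (invE k1 cl) er1.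
have [|r1 [e1 <- <- _]] := persists (k := k) (k' := Ke) _ (vw _ _ er etc) er etc.
  by rewrite le /=.
have [|r2 [e2 <- <- _]] := persists (k := k') (k' := Ke) _ (vw _ _ er' etc') er' etc'.
  by rewrite le' /=.
by move: e2; rewrite e1 => -[->].
Qed.

Lemma request_sent k j t : k <= Ke -> past k L (Send j (MNERequest t)) ->
  (tc_view t).+1 = v -> exists r, [/\ recov (st k L) = Some r, rec_tc r = t
    & cur_view (st k L) = v].
Proof.
move=> le ps et; have [lt h] := i_req (invE k cl) (or_introl ps).
have vk : v <= cur_view (st k L) by rewrite -et.
have [ev _] := recovering le vk.
have [|hi|[r er ert]] := h; rewrite ?et /= ?ev //; last by exists r.
by case: not_issued; apply: (issued_mono cl le); move: hi; rewrite /= ev.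
Qed.

Lemma recovery_contradiction : False.
Proof.
have i1 := i0; have d1 := d0; have gT1 := gT.
have m0 : (0 <= ticks%:R * interval P)%R by rewrite mulr_ge0.
have [rc [Hc [hc erc etc asks]]] := asked_all.
have le_c : Hc <= Ke by apply: (horizon_le hc hKe); lra.
have [[ltc vtc eTc _] _ ne_sent _ _] := i_rec (invE Hc cl) erc.
have vT : valid_tip (rec_tip rc).
  have [_ [[q [_ e _ _]]|[T' [_ e vT' _]]]] := valid_tcE vtc; rewrite e in eTc => //.
  by move: eTc => [<-].
have tipv : tip_view (rec_tip rc) <= tc_view (rec_tc rc).
  have [_ [[q [_ e _ _]]|[T' [_ e _ le']]]] := valid_tcE vtc; rewrite e in eTc => //.
  by move: eTc => [<-].
have lK : K <= Hc by apply: (horizon_le hK hc); lra.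
have [_ [rK [erK etK eTK]]] := recovering (leq_trans lK le_c) vK.
have [etcK etipK] := same_recovery le_c (leq_trans lK le_c) erc etc erK etK.
have [_ _ ne_sentK _ _] := i_rec (invE K cl) erK.
have [Ka ha] := horizon_exists (T + delta E)%R.
have [Kb hb] := horizon_exists (T + delta E + delta E)%R.
have [Kd hd'] := horizon_exists (T + ticks%:R * interval P + delta E)%R.
have le_a : Ka <= Ke by apply: (horizon_le ha hKe); lra.
have le_ab : Ka <= Kb by apply: (horizon_le ha hb); lra.
have le_b : Kb <= Ke by apply: (horizon_le hb hKe); lra.
have le_d : Kd <= Ke by apply: (horizon_le hd' hKe); lra.
have gTc : (gst E <= T + ticks%:R * interval P)%R by lra.
have gTd : (gst E <= T + ticks%:R * interval P + delta E)%R by lra.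
have gTa : (gst E <= T + delta E)%R by lra.
have vmsg : valid_tc (rec_tc rc) /\ tc_high_tip (rec_tc rc) <> None by rewrite eTc.
(* By [Ka] the NE requests that the leader sent by time T have been handled, so whoever has no vote
   for the tip at that point has answered them. *)
have [[j [cj voted]]|novote] := pselect (exists j, correct j /\
    mem (st Ka j) (VotedFor (tip_pid (rec_tip rc)))).
  (* A validator that voted for the tip has its block. *)
  have [k1 lt1 a1] := asks j.
  have [k2 [/andP[lt12 lt2] ev2 H2]] := heard_by hc gTc hd'
    (m := MProposalRequest (rec_tc rc)) cl cj vmsg lt1 a1.
  have [|ltv nv H3] := H2; first by rewrite etc.
  (* The request may be handled before [Ka], at which the vote is known. But handling it casts no
     vote, and later votes are of view v or higher, whereas the id of the tip encodes a view below
     v. So the vote precedes the request. *)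
  have voted2 : mem (st k2 j) (VotedFor (tip_pid (rec_tip rc))).
    have [le2a|lta] := leqP Ka k2; first exact: (mem_mono cj le2a).
    apply: contrapT => nvoted.
    pose Q d := mem (st (k2 + d) j) (VotedFor (tip_pid (rec_tip rc))).
    have [||d [_ nQ QS]] := @first_flip Q (Ka - k2).
    - by rewrite /Q addn0.
    - by rewrite /Q subnKC // ltnW.
    case: d nQ QS => [|d]; first by rewrite /Q addn1 => _ /nv.
    rewrite /Q !addnS => nQ QS.
    have [ai|na] := pselect (actor (ev (k2 + d).+1) = Some j); last first.
      by move: QS; rewrite (idle_state na).
    have [I _ _ _] := handledE cj ai.
    have [//|[bh [u [e leu]]]] := m_voted I QS.
    have [_ eT2 _ _] := valid_tipE vT; move: e; rewrite eT2 => /pid_inj[_ eu].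
    have : cur_view (st k2.+1 j) <= cur_view (st (k2 + d).+1 j).
      by apply: (view_mono cj); rewrite ltnS leq_addr.
    by move=> h; have := leq_trans ltv (leq_trans h leu); rewrite -eu ltnNge tipv.
  have [p sp ep] := i_voted (invE k2 cj) voted2 vT erefl.
  have [lt3|[p' [vp' ep' lp']]] := H3 _ _ eTc sp ep.
    by have := not_passed (leq_trans lt2 le_d) cj; rewrite leqNgt -etc lt3.
  have a2 : acts E k2 j (Send L (MProposal p')).
    by split; [rewrite ev2 | move: lp'; rewrite ?etc].
  have [k4 [/andP[lt24 lt4] ev4 [_ H4]]] := heard_by hd' gTd hKe
    (m := MProposal p') cj cl vp' lt2 a2.
  have vk4 : v <= cur_view (st k4 L).
    have p4 : past k4 L (Send j (MProposalRequest (rec_tc rc))).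
      by exists k1 => //; exact: ltn_trans lt24.
    by rewrite -etc; exact: (i_preq (invE k4 cl) (or_introl p4)).
  have [evk4 [r4 [er4 et4 eT4]]] := recovering (ltnW lt4) vk4.
  have [_ etip4] := same_recovery le_c (ltnW lt4) erc etc er4 et4.
  apply: not_issued; apply: (issued_mono cl lt4).
  have := H4 r4 er4; rewrite /= evk4 etip4 et4 => h; exact: h.
(* Nobody voted for the tip, so every correct validator sends an NE message. *)
pose qv := qc_view (hd_qc (tip_hd (rec_tip rc))).
pose reply j : msg := MNE v qv (Sig j (CNE v qv)).
have sent_ne k j : k <= Ke -> correct j -> mem (st k j) (SentNE v) ->
    past k j (Send L (reply j)) /\ exists r, [/\ recov (st k L) = Some r,
      rec_tc r = rec_tc rc, rec_tip r = rec_tip rc & cur_view (st k L) = v].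
  move=> le cj m; have [t [T' [[k0 lt0 e0] et eT' ps]]] := i_ne (invE k cj) m.
  (* A validator sends one NE message per view, perhaps in answer to another request; but in view v
     the leader runs Recover for a single TC, so the signed content is the same. *)
  have [r [er ert evk]] := request_sent le (past_le (ltnW lt0) (sent_past cl e0)) et.
  have [e1 e2] : rec_tc r = rec_tc rc /\ rec_tip r = rec_tip rc.
    by apply: (same_recovery le_c le) => //; rewrite ert.
  split; last by exists r.
  have eTT : T' = rec_tip rc.
    by move: eT'; rewrite -ert e1 eTc => -[].
  by move: (didE ps); rewrite /= eTT.
have all_sent j : correct j -> rcvd Kb L j (reply j).
  move=> cj; have := didE (ne_sentK j); rewrite etcK => -[k1 lt1 a1].
  have [k2 [/andP[_ lt2] _ H2]] := heard_by hK gT ha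
    (m := MNERequest (rec_tc rc)) cl cj vmsg lt1 a1.
  have sent : mem (st Ka j) (SentNE v).
    have [|lt3|m|m] := H2 _ _ eTc; first by rewrite etc.
    - by have := not_passed (leq_trans lt2 le_a) cj; rewrite leqNgt -etc lt3.
    - by case: novote; exists j; split=> //; apply: (mem_mono cj lt2).
    - by apply: (mem_mono cj lt2); rewrite -etc.
  have [[k3 lt3 a3] _] := sent_ne Ka j le_a cj sent.
  have [k4 /andP[_ lt4] e4] := delivered cj cl ha gTa hb lt3 a3.
  by exists k4.
have [l [sl ul hl]] := set_take (correct_quorum (byz_le)).
have hl' i : i \in l -> correct i by move=> /hl; rewrite inE.
(* Event [k] delivers the last NE message missing from a correct validator. With it the leader holds
   the signatures of all of [l], which form the NEC. *)
have [||k [ltk nQ Qk]] := @first_flip (fun k => forall j, correct j -> rcvd k L j (reply j)) Kb.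
- move=> h; case: l sl hl' {hl ul} => // i l _ hl'.
  by have [k0] := h i (hl' i (mem_head _ _)).
- exact: all_sent.
have [j [cj nj]] : exists j, correct j /\ ~ rcvd k L j (reply j).
  by apply: contrapT => h; apply: nQ => j cj; apply: contrapT => h2; apply: h; exists j.
have ej : ev k = Deliver j L (reply j).
  have [k1 lt1 e1] := Qk j cj; move: lt1; rewrite ltnS leq_eqVlt => /orP[/eqP <- //|lt1].
  by case: nj; exists k1.
have lek : k < Ke by exact: leq_trans ltk le_b.
have sent : mem (st k j) (SentNE v).
  exact: (i_mne (invE k cj) (or_introl (sent_past cj ej))).
have [_ [r [er e1 e2 evk]]] := sent_ne k j (ltnW lek) cj sent.
have [_ H] := heardE cl ej (erefl : valid_msg j (reply j)).
apply: not_issued; apply: (issued_mono cl lek).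
rewrite -[v in has_issued v]evk; apply: (H r er).
  by rewrite /= evk e1 etc.
rewrite /= e2 evk; exists (NEC v qv [seq Sig i (CNE v qv) | i <- l]); split=> //.
  split; last by rewrite size_map -map_comp; apply: map_nseq_const.
  by split; rewrite ?size_map // -map_comp map_id_in.
move=> y iy; have [i il <-] := In_map_inv iy; have ci := hl' i (proj1 (In_mem _ _) il).
have [k1 lt1 ek1] := Qk i ci; move: lt1; rewrite ltnS leq_eqVlt => /orP[/eqP e|lt1].
  by right; subst k1; move: ek1; rewrite ej => -[->].
left; have [g _] := heardE cl ek1 (erefl : valid_msg i (reply i)).
exact: (mem_mono cl lt1).
Qed.

End Leader.

Lemma recovery_issues v t0 T K Ke : 0 < v -> is_tau E v t0 -> (gst E <= t0)%R ->
  correct (leader v) -> (gst E <= T)%R -> horizon T K ->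
  v <= cur_view (st K (leader v)) ->
  horizon (T + ticks%:R * interval P + delta E + delta E)%R Ke ->
  (T + ticks%:R * interval P + delta E + delta E < t0 + theta_view P)%R ->
  has_issued v (st Ke (leader v)).
Proof.
by move=> *; apply: contrapT => ni; apply: (recovery_contradiction (v := v)) ni; eassumption.
Qed.

(** * One view of fast progress *)

Definition issued_by w T := exists2 K, horizon T K & has_issued w (st K (leader w)).

Lemma issued_by_horizon w T K : correct (leader w) -> issued_by w T -> horizon T K ->
  has_issued w (st K (leader w)).
Proof.
move=> cl [K' h' hi] hK; apply: (issued_mono cl _ hi).
exact: horizon_le h' hK (lexx _).
Qed.

Lemma tau_exists w k i : correct i -> 0 < w <= cur_view (st k i) ->
  exists t, is_tau E w t.
Proof.
move=> ci /(view_entered ci)[k0 [j [_ cj en]]].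
have ex : exists k, `[< exists2 j, correct j & enters E k j w >].
  by exists k0; apply/asboolP; exists j.
exists (time (ex_minn ex)); case: ex_minnP => k1 /asboolP[j1 cj1 en1] min.
split; first by exists k1, j1.
by move=> k2 j2 cj2 en2; apply: (time_mono); apply: min; apply/asboolP; exists j2.
Qed.

Lemma tau_mono w w' t t' : 0 < w -> w <= w' -> is_tau E w t -> is_tau E w' t' ->
  (t <= t')%R.
Proof.
move=> w0 le tau [[k [i [ci [c ac ec] <-]]] _].
have [_ _ lt _] := accept_info ci ac.
have [|k' lt' h] := tau_le tau ci (k := k.+1).
  by rewrite w0; apply: leq_trans lt; rewrite ec.
by apply: (le_trans h); apply: (time_mono).
Qed.

(** The reason for counting from tau(v + 1) in (2): however long view w takes, its proposal exists
    when the first correct validator leaves it. *)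
Lemma issued_before_tau w t' T K : correct (leader w) -> 0 < w -> is_tau E w.+1 t' ->
  (t' <= T)%R -> horizon T K -> no_timeout w K -> issued_by w t'.
Proof.
move=> cl w0 [[k [i [ci [c ac [ec]] et]]] _] le hK nt.
have [K' hK'] := horizon_exists t'; exists K' => //.
have ltk : k < K' by apply/hK'; rewrite et.
have [_ _ lt _] := accept_info ci ac.
have nt' : no_timeout w K' := no_timeout_le (horizon_le hK' hK le) nt.
apply: (passed_issued ci _ cl nt').
by rewrite w0 -ec; apply: leq_trans lt (view_mono ci ltk).
Qed.

Section Step.
Variables (w : nat) (t T : R) (K0 K1 K2 : nat).
Hypothesis w0 : 0 < w.
Hypothesis tau : is_tau E w t.
Hypothesis gt : (gst E <= t)%R.
Hypothesis cl : correct (leader w).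
Hypothesis iss : issued_by w T.
Hypothesis gT : (gst E <= T)%R.
Hypothesis h0 : horizon T K0.
Hypothesis h1 : horizon (T + delta E)%R K1.
Hypothesis h2 : horizon (T + delta E + delta E)%R K2.
Hypothesis early : (T + delta E + delta E < t + theta_view P)%R.

Let d0 : (0 < delta E)%R. Proof. by case: (delta_bounds). Qed.
Let gT1 : (gst E <= T + delta E)%R.
Proof. by have := d0; have := gT; lra. Qed.
Let le01 : K0 <= K1. Proof. by apply: (horizon_le h0 h1); have := d0; lra. Qed.
Let le12 : K1 <= K2. Proof. by apply: (horizon_le h1 h2); have := d0; lra. Qed.

Lemma no_timeout_step u : w <= u -> no_timeout u K2.
Proof. exact: (no_timeout_horizon w0 tau gt h2 early). Qed.

(** A validator may have voted in w before this delivery. As nobody has timed out in w, that vote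
    too was cast on a proposal signed by the leader, who issues only one; so all votes name the same
    block. *)
Lemma all_vote : exists bh, forall j, correct j -> w < cur_view (st K1 j) \/
  let x := make_vote j w bh in
  past K1 j (Send (leader w) (MVote x)) /\ past K1 j (Send (leader w.+1) (MVote x)).
Proof.
have [p mp evp] := issued_by_horizon cl iss h0.
have [vp _ sp] := i_iss (invE K0 cl) mp.
exists (block_hash (hd (p_block p))) => j cj.
have [k lk ak] := didE (sp j).
have [k' [/andP[_ lt] _ [H _]]] := heard_by h0 gT h1 (m := MProposal p) cl cj vp lk ak.
have [|h|[evk hv _]] := H; first by rewrite evp.
  by left; rewrite -evp; apply: leq_trans h (view_mono cj lt).
right; rewrite evp in evk hv.
have ehv : highest_voted (st k'.+1 j) = w.
  by apply/eqP; rewrite eqn_leq hv -{1}evk (i_hv (invE k'.+1 cj)).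
have nt : no_timeout w k'.+1.
  by apply: (no_timeout_le _ (no_timeout_step (leqnn w))); exact: leq_trans lt le12.
have := i_hvs (invE k'.+1 cj); rewrite /= ehv => /(_ w0)[m|]; first by case: (nt j cj).
move=> [bh [/didE sx /didE s1 /didE s2]].
have [p' [sp' vp' evp' ep']] := vote_stored cj nt sx.
have ap' := stored_auth cj sp' vp'.
have cl' : correct (leader (p_view p')) by rewrite evp'.
have [|p2 [m2 ev2 ep2]] := proposal_issued vp' cl' (k := k'.+1); first by apply: ap'; left.
rewrite evp' in m2 ev2.
have e2 : p2 = p.
  apply: (i_uniq (invE K1 cl)); last by rewrite evp.
    exact: (mem_mono cl lt m2).
  exact: (mem_mono cl le01 mp).
have [_ epid _ _ _] := valid_proposalE vp.
have ebh : bh = block_hash (hd (p_block p)).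
  by move: ep'; rewrite -ep2 e2 epid => /pid_inj[].
by rewrite -ebh; split; apply: past_le lt _.
Qed.

(** If nobody has passed w at [K1], all correct validators have sent equal votes by then; by [K2]
    they would be a complete quorum at [l], were [l] still in w or below. A validator that has
    already passed w need not have voted, hence the second alternative. *)
Lemma votes_collected l : correct l -> l = leader w \/ l = leader w.+1 ->
  w < cur_view (st K2 l) \/ exists2 j, correct j & w < cur_view (st K1 j).
Proof.
move=> cll hl; have [bh hv] := all_vote.
have [ex|nex] := pselect (exists2 j, correct j & w < cur_view (st K1 j)); first by right.
left; rewrite ltnNge; apply/negP => le.
have [_ _ Q] := ginv_all K2 cll; have [q1 _ _ _] := Q w le.
have [S [sS uS hS]] := set_take (correct_quorum (byz_le)).
pose sg (j : V) := Sig j (CVote w bh (pid_of bh w)).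
have := q1 hl bh (QC w bh (pid_of bh w) [seq sg j | j <- S]); apply; split=> //=.
  split; last by rewrite size_map -map_comp; apply: map_nseq_const.
  by split; rewrite ?size_map // -map_comp map_id_in.
move=> y iy; have [j jS <-] := In_map_inv iy.
have cj : correct j by have := hS j (proj1 (In_mem _ _) jS); rewrite inE.
have [h|[s1 s2]] := hv j cj; first by case: nex; exists j.
have [//||lt|//] := got_vote h1 gT1 h2 cj cll (x := make_vote j w bh) _ erefl hl.
- by case: hl => ->.
- by move: lt; rewrite /= ltnNge le.
Qed.

Lemma someone_passes : exists2 j, correct j & w < cur_view (st K2 j).
Proof.
have [h|[j cj h]] := votes_collected cl (or_introl erefl); first by exists (leader w).
by exists j => //; apply: leq_trans h (view_mono cj le12).
Qed.

Lemma next_leader : correct (leader w.+1) -> has_issued w.+1 (st K2 (leader w.+1)).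
Proof.
move=> cl'.
have lt : w < cur_view (st K2 (leader w.+1)).
  have [//|[j cj h]] := votes_collected cl' (or_intror erefl).
  have [t' tau'] := tau_exists cj (w := w.+1) (k := K1) h.
  have lett := tau_mono w0 (leqnSn w) tau tau'.
  have lt1 : (T + delta E < t' + theta_view P)%R by have := d0; have := early; lra.
  have [//|[m _]] := entered_leader (v := w.+1) w0 tau' (le_trans gt lett) cl' gT1 lt1 h1 h2
    cj h.
  by case: (no_timeout_le le12 (no_timeout_step (leqnn w)) cj m).
move: lt; rewrite leq_eqVlt => /orP[/eqP e|lt]; last first.
  by apply: (passed_issued cl' _ cl') => //; apply: no_timeout_step.
(* Without a proposal the leader would be running Recover on a TC of w, but nobody has timed out in
   w. *)
have [I [l _] _] := ginv_all K2 cl'.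
have := l; rewrite /lead_ok /= -e => /(_ isT erefl)[//|[_ [r er [etc]]]].
have [[_ vt _ _] at_ _ _ _] := i_rec I er.
by case: (tc_timeout vt at_); rewrite etc; apply: no_timeout_step.
Qed.

End Step.

(* Once the leader of the next view has issued its proposal, nobody stays behind. *)
Lemma never_timeout w t T : 0 < w -> is_tau E w t -> (gst E <= t)%R ->
  correct (leader w.+1) -> issued_by w.+1 T -> (gst E <= T)%R ->
  (T + delta E < t + theta_view P)%R -> forall k, no_timeout w k.
Proof.
move=> w0 tau gt cl iss gT early k j cj m.
have [K0 h0] := horizon_exists T.
have [K1 h1] := horizon_exists (T + delta E)%R.
have nt := no_timeout_horizon w0 tau gt h1 early (leqnn w).
have [p mp evp] := issued_by_horizon cl iss h0.
have [vp _ sp] := i_iss (invE K0 cl) mp.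
have [k0 lk ak] := didE (sp j).
have [k' [/andP[_ lt] _ [H _]]] := heard_by h0 gT h1 (m := MProposal p) cl cj vp lk ak.
have vj : w < cur_view (st K1 j).
  apply: (leq_trans _ (view_mono cj lt)).
  have [|h|[h _ _]] := H; first by rewrite evp.
    by rewrite evp in h; exact: ltnW.
  by rewrite h evp.
have [le|ltk] := leqP k K1; first exact: nt cj (mem_mono cj le m).
pose Q d := mem (st (K1 + d) j) (SentTimeout w).
have [||d [_ nQ QS]] := @first_flip Q (k - K1).
- by rewrite /Q addn0; apply: nt.
- by rewrite /Q subnKC // ltnW.
rewrite /Q addnS in QS.
have [ai|na] := pselect (actor (ev (K1 + d)) = Some j); last first.
  by apply: nQ; rewrite /Q -(idle_state na).
have [I _ _ _] := handledE cj ai.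
have [//|[le _]] := m_tout I QS.
have := view_mono cj (leq_addr d K1); move: le vj; rewrite /=; lia.
Qed.

Lemma theta_slack : (8 * delta E <= theta_view P)%R.
Proof.
have [_ le] := delta_bounds; rewrite theta_viewE.
have := interval_ge0 P; have : (0 <= ticks%:R :> R)%R by exact: ler0n.
move=> a b; have := mulr_ge0 a b; lra.
Qed.

(** The time T carried along bounds the proposal of view v + m in two ways: from the start, for the
    final estimate, and against the timeout of its own view, with 3 [delta] to spare, two for the
    next proposal and one for its delivery. *)
Lemma issued_chain v x T0 t0 : 0 < v ->
  (forall w, v <= w < v + x -> post_gst E w /\ correct (leader w)) ->
  is_tau E v t0 -> (gst E <= t0)%R -> (gst E <= T0)%R -> issued_by v T0 ->
  (T0 + 3 * delta E < t0 + theta_view P)%R ->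
  forall m, m < x -> exists T t,
    [/\ [/\ is_tau E (v + m) t, (gst E <= t)%R & (gst E <= T)%R], issued_by (v + m) T,
        (T + 3 * delta E < t + theta_view P)%R, (T <= T0 + (2 * m)%:R * delta E)%R
      & forall u, v <= u < v + m -> forall k, no_timeout u k].
Proof.
move=> v0 hG tau0 g0 gT0 iss0 early0; have [d0 _] := delta_bounds.
have sl := theta_slack.
elim=> [|m IH] ltm.
  exists T0, t0; rewrite addn0 muln0 mul0r addr0; split=> // u.
  by move=> /andP[a b]; rewrite leqNgt b in a.
have [T [t [[tau gt gT] iss early bound nt]]] := IH (ltnW ltm).
have [_ cl] : post_gst E (v + m) /\ correct (leader (v + m)).
  by apply: hG; rewrite leq_addr ltn_add2l ltnW.
have [[t' tau' gt'] cl'] : post_gst E (v + m).+1 /\ correct (leader (v + m).+1).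
  by apply: hG; rewrite -addnS leq_addr ltn_add2l.
have w0 : 0 < v + m by rewrite addn_gt0 v0.
(* Taking the minimum with tau of the next view renews the deadline: the next proposal is issued by
   t' + 2 [delta], and 2 + 3 stays below the 8 [delta] that [theta_view] provides. *)
pose T1 := Order.min T t'.
have leT : (T1 <= T)%R by rewrite ge_min lexx.
have let' : (T1 <= t')%R by rewrite ge_min lexx orbT.
have gT1 : (gst E <= T1)%R by rewrite le_min gT.
have iss1 : issued_by (v + m) T1.
  rewrite /T1; case: leP => // ltT.
  have [K hK] := horizon_exists T.
  apply: (issued_before_tau cl w0 tau' (ltW ltT) hK).
  by apply: (no_timeout_horizon w0 tau gt hK) => //; lra.
have [K0 h0] := horizon_exists T1.
have [K1 h1] := horizon_exists (T1 + delta E)%R.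
have [K2 h2] := horizon_exists (T1 + delta E + delta E)%R.
have e1 : (T1 + delta E + delta E < t + theta_view P)%R by lra.
have iss2 : issued_by (v + m).+1 (T1 + delta E + delta E)%R.
  by exists K2 => //; apply: (next_leader w0 tau gt cl iss1 gT1 h0 h1 h2 e1).
exists (T1 + delta E + delta E)%R, t'; rewrite addnS; split=> //.
- by split=> //; lra.
- by lra.
- have -> : ((2 * m.+1)%:R = (2 * m)%:R + 2 :> R)%R by rewrite mulnS natrD addrC.
  by lra.
- move=> u /andP[vu]; rewrite ltnS leq_eqVlt => /orP[/eqP->|ltu]; last first.
    by apply: nt; rewrite vu.
  by apply: (never_timeout w0 tau gt cl' iss2); lra.
Qed.

(** * Commits *)

(** The alternative is a TC of view y, which needs correct validators that have timed out in y. *)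
Lemma consecutive k p y : valid_proposal p -> p_view p = y.+1 ->
  (forall sg, List.In sg (sigs_tip (tip_of p)) -> auth k sg) -> no_timeout y k ->
  qc_view (p_qc p) = y.
Proof.
move=> vp evp ap nt; have := valid_proposal_cert vp; case et: (p_tc p) => [t|].
  move=> [vt]; rewrite evp => -[ey]; subst y; exfalso.
  apply: (tc_timeout vt _ nt) => sg isg; apply: ap; right.
  by rewrite /= et !In_cat; tauto.
by rewrite evp => -[].
Qed.

Lemma proposal_qc_auth k p :
  (forall sg, List.In sg (sigs_tip (tip_of p)) -> auth k sg) ->
  forall sg, List.In sg (qc_sigs (p_qc p)) -> auth k sg.
Proof. by move=> ap sg isg; apply: ap; right; rewrite /= !In_cat; tauto. Qed.

Lemma qc_chain k w : 0 < w -> forall d q, qc_view q = w + d -> valid_qc q ->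
  (forall sg, List.In sg (qc_sigs q) -> auth k sg) ->
  (forall u, w <= u <= w + d -> no_timeout u k) ->
  exists p, [/\ chain (known_at E k) (qc_pid q) p, valid_proposal p, p_view p = w
    & forall sg, List.In sg (sigs_tip (tip_of p)) -> auth k sg].
Proof.
move=> w0; elim=> [|d IH] q eq vq aq nt.
  have [||p [kp vp evp ep ap]] := qc_stored vq _ aq _.
  - by rewrite eq addn0.
  - by apply: nt; rewrite eq addn0 leqnn.
  by exists p; split=> //; [exact: chain_here | rewrite evp eq addn0].
have [||p [kp vp evp ep ap]] := qc_stored vq _ aq _.
- by rewrite eq; lia.
- by apply: nt; rewrite eq; lia.
have ey : qc_view (p_qc p) = w + d.
  apply: (consecutive vp _ ap); first by rewrite evp eq addnS.
  by apply: nt; lia.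
have [_ _ _ _ vq'] := valid_proposalE vp.
have [|p' [ch ? ? ?]] := IH _ ey vq' (proposal_qc_auth ap).
  by move=> u hu; apply: nt; lia.
exists p'; split=> //; apply: chain_trans ch; exact: chain_here.
Qed.

(** The proposal that [q] points to carries a QC of the preceding view, so Commit takes its second
    branch, and following QCs down from there reaches a proposal of w. Its signature makes it the
    one that the leader issued. The strict bound on w is there because Commit starts one proposal
    below the one that [q] points to. *)
Lemma commits_issued k i w p q : 0 < w -> correct (leader w) -> issued_in E w p ->
  valid_qc q -> w < qc_view q -> (forall sg, List.In sg (qc_sigs q) -> auth k sg) ->
  (forall u, w <= u <= qc_view q -> no_timeout u k) ->
  commits (known_at E k) q (st k.+1 i) -> mem (st k.+1 i) (Committed (p_block p)).
Proof.
move=> w0 cl [evp [kp mp]] vq lt aq nt hc.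
have [||pa [kpa vpa evpa epa apa]] := qc_stored vq _ aq _.
- exact: ltn_trans lt.
- by apply: nt; lia.
have ey' : qc_view (p_qc pa) = (qc_view q).-1.
  apply: (consecutive vpa _ apa); first by rewrite evpa; lia.
  by apply: nt; lia.
have [_ _ _ _ vqa] := valid_proposalE vpa.
have ed : qc_view (p_qc pa) = w + ((qc_view q).-1 - w) by rewrite ey'; lia.
have [|pw [ch vpw evpw apw]] := qc_chain w0 ed vqa (proposal_qc_auth apa).
  by move=> u hu; apply: nt; lia.
have [vp _ _] := i_iss (invE kp cl) mp.
have clw : correct (leader (p_view pw)) by rewrite evpw.
have [|p' [mp' evp' epp']] := proposal_issued vpw clw (k := k); first by apply: apw; left.
rewrite evpw in mp' evp'.
have epp : p' = p.
  apply: (i_uniq (invE (maxn k kp) cl)); last by rewrite evp'.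
    exact: (mem_mono cl (leq_maxl _ _) mp').
  exact: (mem_mono cl (leq_maxr _ _) mp).
subst p'.
have [vb epid _ _ _] := valid_proposalE vp.
have [vbw epidw _ _ _] := valid_proposalE vpw.
have [ebh _] : block_hash (hd (p_block p)) = block_hash (hd (p_block pw)) /\
    p_view p = p_view pw by apply: pid_inj; rewrite -epid -epidw.
have -> : p_block p = p_block pw.
  apply: block_inj => //; apply: header_inj ebh; by [case: vb | case: vbw].
by apply: (hc pa) => //; rewrite ey'; lia.
Qed.

Lemma receives w T : correct (leader w) -> issued_by w T -> (gst E <= T)%R ->
  forall i, correct i -> exists t k p,
    [/\ receives_proposal E i w t, time k = t, (t <= T + delta E)%R,
        issued_in E w p & ev k = Deliver (leader w) i (MProposal p)].
Proof.
move=> cl iss gT i ci.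
have [K0 h0] := horizon_exists T.
have [K1 h1] := horizon_exists (T + delta E)%R.
have [p mp evp] := issued_by_horizon cl iss h0.
have [vp _ sp] := i_iss (invE K0 cl) mp.
have [k0 lk ak] := didE (sp i).
have [k' /andP[_ lt] e] := delivered cl ci h0 gT h1 lk ak.
pose rcv k := exists2 p, issued_in E w p & ev k = Deliver (leader w) i (MProposal p).
have rk' : rcv k' by exists p => //; split=> //; exists K0.
have ex : exists k, `[< rcv k >] by exists k'; apply/asboolP.
case: (ex_minnP ex) => k /asboolP rk min; have [p1 ip1 e1] := rk.
exists (time k), k, p1; split=> //; last first.
  apply: (le_trans (time_mono (min k' (asboolT rk')))); exact/h1.
split; first by exists k.
by move=> k2 rk2; apply: (time_mono); apply: min; apply/asboolP.
Qed.

(** All correct validators start, and so enter view 1, before GST. This excludes the view for which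
    [entry_ok] says nothing. *)
Lemma post_gst_gt1 v : 0 < v -> post_gst E v -> correct (leader v) -> 1 < v.
Proof.
case: v => [|[|v]] // _ [t tau gt] cl; exfalso.
have [_ _ starts _ _] := HE; have [k ek lt] := starts _ cl.
have c1 : 0 < 1 <= cur_view (st k.+1 (leader 1)).
  have := transitionE k; rewrite /transition ek => -[_ [_ [s1 h1 h2] _]].
  have [lt1 _] := enter_view h1; apply: leq_trans lt1 _.
  case: h2 => [[_ h2]|[_ ->]] //.
  by have [-> _ _ _ _] := calm_issue_new h2.
have [k' lt' le] := tau_le tau cl c1.
have := time_mono (lt' : k' <= k); lra.
Qed.

(** * The sequence G of good views *)

Section Main.

Variables (v x : nat).
Hypothesis v0 : 0 < v.
Hypothesis x0 : 0 < x.
Hypothesis good : forall w, v <= w < v + x -> post_gst E w /\ correct (leader w).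

(** Two [delta] for the leader to enter v, [ticks] intervals until everybody has been asked, and two
    [delta] for the last request and its answer. *)
Lemma slow_issue t0 : is_tau E v t0 -> (gst E <= t0)%R ->
  issued_by v (t0 + delta E + delta E + ticks%:R * interval P + delta E + delta E)%R.
Proof.
move=> tau g0; have [pg cl] : post_gst E v /\ correct (leader v) by apply: good; lia.
have v1 := post_gst_gt1 v0 pg cl.
have [d0 dD] := delta_bounds; have th := theta_viewE.
have i0 := interval_ge0 P; have n0 : (0 <= ticks%:R :> R)%R by exact: ler0n.
have m0 := mulr_ge0 n0 i0.
have [K2 h2] := horizon_exists (t0 + delta E + delta E)%R.
have [Ke he] := horizon_exists
  (t0 + delta E + delta E + ticks%:R * interval P + delta E + delta E)%R.
exists Ke => //; apply: (recovery_issues v0 tau g0 cl _ h2 _ he); rewrite ?th; try lra.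
by apply: (leader_enters v1 tau g0 cl h2); rewrite th; lra.
Qed.

(** The leader is in v by t0 + 2 [delta], so it has accepted [q] by then. At that event [last_qc]
    becomes [q], which rules out the Recover case of [lead_ok]: the proposal is issued at once,
    unless the leader is already past v and has issued it too. *)
Lemma qc_issue t0 k q : is_tau E v t0 -> (gst E <= t0)%R ->
  accepts E k (leader v) (CQC q) -> (qc_view q).+1 = v ->
  issued_by v (t0 + delta E + delta E)%R.
Proof.
move=> tau g0 ac eq; have [pg cl] : post_gst E v /\ correct (leader v) by apply: good; lia.
have v1 := post_gst_gt1 v0 pg cl.
have [d0 dD] := delta_bounds; have th := theta_slack.
have [K2 h2] := horizon_exists (t0 + delta E + delta E)%R; exists K2 => //.
have lev : v <= cur_view (st K2 (leader v)).
  by apply: (leader_enters v1 tau g0 cl h2); lra.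
have [_ _ ltk lek] := accept_info cl ac.
have ltK : k < K2.
  rewrite ltnNge; apply/negP => le.
  by have := leq_trans lev (view_mono cl le); move: lek eq => /=; lia.
apply: (issued_mono cl ltK).
have nt : no_timeout v k.+1.
  apply: (no_timeout_le ltK); apply: (no_timeout_horizon v0 tau g0 h2) => //; lra.
have [I [l _] _] := ginv_all k.+1 cl.
move: ltk; rewrite /= eq leq_eqVlt => /orP[/eqP ev|lt]; last first.
  by apply: (passed_issued cl _ cl nt); rewrite v0.
have := l; rewrite /lead_ok /= -ev => /(_ v0 erefl)[//|[lt _]].
have [ai hq] := ac; have [I' _ _ _] := handledE cl ai.
have [//|e] := m_accq I' hq.
by move: lt; rewrite e ?eq // ltnn.
Qed.

Lemma passed_tau t0 T : is_tau E v t0 -> (gst E <= t0)%R -> issued_by v T ->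
  (gst E <= T)%R -> (T + delta E + delta E < t0 + theta_view P)%R ->
  exists t1, is_tau E v.+1 t1.
Proof.
move=> tau g0 iss gT early; have [pg cl] : post_gst E v /\ correct (leader v) by apply: good; lia.
have [K0 h0] := horizon_exists T.
have [K1 h1] := horizon_exists (T + delta E)%R.
have [K2 h2] := horizon_exists (T + delta E + delta E)%R.
have [j cj lt] := someone_passes v0 tau g0 cl iss gT h0 h1 h2 early.
exact: (tau_exists cj (w := v.+1) (k := K2) lt).
Qed.

Lemma last_proposal_commits t T i k p : is_tau E (v + x).-1 t -> (gst E <= t)%R ->
  (time k <= T + delta E)%R -> (T + 3 * delta E < t + theta_view P)%R ->
  (forall u, v <= u < (v + x).-1 -> forall k, no_timeout u k) ->
  correct i -> ev k = Deliver (leader (v + x).-1) i (MProposal p) ->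
  issued_in E (v + x).-1 p ->
  forall w pw, v <= w -> w.+2 < v + x -> issued_in E w pw ->
    commits_by E i (time k) (p_block pw).
Proof.
move=> tau gt lek early nt ci ek [evp [kp mp]] w pw vw wx ipw.
have [d0 dD] := delta_bounds.
have [_ cl] : post_gst E (v + x).-1 /\ correct (leader (v + x).-1) by apply: good; lia.
have [_ clw] : post_gst E w /\ correct (leader w) by apply: good; lia.
have w0 : 0 < w by lia.
have l0 : 0 < (v + x).-1 by lia.
have [K1 h1] := horizon_exists (T + delta E)%R.
have ltk : k < K1 by apply/h1.
have NT u : v <= u -> no_timeout u K1.
  move=> vu; have [lt|ge] := ltnP u (v + x).-1; first by apply: nt; rewrite vu.
  by apply: (no_timeout_horizon l0 tau gt h1) => //; lra.
have NT' u k' : v <= u -> k' <= k -> no_timeout u k'.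
  by move=> vu le; apply: (no_timeout_le _ (NT u vu)); apply: ltnW (leq_ltn_trans le ltk).
have [vp _ _] := i_iss (invE kp cl) mp.
have [H _] := heardE ci ek (vp : valid_msg _ (MProposal p)).
have [|lt|[evi _ hc]] := H; first by rewrite evp.
(* The proposal arrives after the validator has left the last view. It left by a QC, since nobody
   has timed out, and the Commit that followed the acceptance of this QC, at an event [k1] before
   [k], covers the blocks. *)
- rewrite evp in lt.
  have c0 : 0 < cur_view (st k.+1 i) by apply: leq_ltn_trans lt.
  have [k1 [lt1 _ _ [c ac ec]]] := entered_at ci c0.
  have [vc sc _ _] := accept_info ci ac.
  have lc : (v + x).-1 <= cert_view c by rewrite -ltnS ec.
  case: c ac ec vc sc lc => [q|t'] /= ac ec vc sc lc; last first.
    by case: (tc_timeout vc sc); apply: NT' => //; lia.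
  have [ai hq] := ac; have [_ _ _ C] := handledE ci ai.
  have [//|hc] := C q hq.
  exists k1; first by apply: (time_mono).
  apply: (commits_issued w0 clw ipw vc _ sc _ hc); first by lia.
  by move=> u hu; apply: NT' => //; lia.
- exists k => //.
  have ap sg : List.In sg (sigs_tip (tip_of p)) -> auth k sg by exact: delivered_auth ek.
  have ey : qc_view (p_qc p) = (v + x).-1.-1.
    by apply: (consecutive vp _ ap); [rewrite evp; lia | apply: NT' => //; lia].
  have [_ _ _ _ vq] := valid_proposalE vp.
  apply: (commits_issued w0 clw ipw vq _ (proposal_qc_auth ap) _ hc).
    by rewrite ey; lia.
  by move=> u hu; apply: NT' => //; lia.
Qed.

End Main.
End Execution.

End MonadBFT.

Local Open Scope ring_scope.

Theorem theorem5 (R : realType) :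
  exists C : R, forall (P : protocol R) (E : execution P),
    is_execution E ->
    forall v x : nat, (0 < v)%N -> (0 < x)%N ->
    (forall w : nat, (v <= w < v + x)%N -> post_gst E w /\ correct E (leader P w)) ->
    forall i : 'I_(3 * faults P).+1, correct E i ->
    exists2 tau_i : R, receives_proposal E i (v + x).-1 tau_i &
      [/\ (* (1) *)
          forall w p, (v <= w)%N -> (w.+2 < v + x)%N -> issued_in E w p ->
            commits_by E i tau_i (p_block p),
          (* (2) *)
          exists2 tau : R, is_tau E v.+1 tau &
            tau_i - tau <= C * x%:R * delta E
        & (* (3) *)
          (exists k q, accepts E k (leader P v) (CQC q) /\ (qc_view q).+1 = v) ->
          exists2 tau : R, is_tau E v tau &
            tau_i - tau <= C * x%:R * delta E].
Proof.
(* 2 [delta] for each view after the first and [delta] for the last delivery; in (3) also 2 [delta]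
   before the first proposal. The sum 2 + 2 (x - 1) + 1 is at most 3 x. *)
exists 3 => P E HE v x v0 x0 good i ci.
have [d0 dD] := delta_bounds HE; have th := theta_viewE P; have sl := theta_slack HE.
have i0 := interval_ge0 P; have n0 : 0 <= (ticks P)%:R :> R by exact: ler0n.
have m0 := mulr_ge0 n0 i0.
have [[t0 tau0 g0] cl] : post_gst E v /\ correct E (leader P v) by apply: good; lia.
have [m ex] : exists m, x = m.+1 by exists x.-1; rewrite prednK.
have elast : (v + x).-1 = (v + m)%N by rewrite ex addnS.
have ltm : (m < x)%N by rewrite ex.
have xR : x%:R = m%:R + 1 :> R by rewrite ex -natr1.
have mR : (2 * m)%:R = 2 * m%:R :> R by rewrite natrM.
have mR0 : 0 <= m%:R :> R by exact: ler0n.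
have md0 := mulr_ge0 mR0 (ltW d0).
have [_ cll] : post_gst E (v + m)%N /\ correct E (leader P (v + m)) by apply: good; lia.
have slow := slow_issue HE v0 x0 good tau0 g0.
set S := (t0 + _ + _ + _ + _ + _) in slow.
have eS : S = t0 + (ticks P)%:R * Defs.interval P + 4 * delta E by rewrite /S; ring.
have gS : gst E <= S by lra.
have eaS : S + delta E + delta E < t0 + theta_view P by lra.
have [t1 tau1] := passed_tau HE v0 x0 good tau0 g0 slow gS eaS.
(* [S] keeps the first proposal ahead of the timeouts of v, and [t1], which is tau(v + 1), is the
   point from which (2) counts. *)
pose T0 := Order.min S t1.
have leS : T0 <= S by rewrite ge_min lexx.
have le1 : T0 <= t1 by rewrite ge_min lexx orbT.
have t01 : t0 <= t1 by apply: (tau_mono HE v0 (leqnSn v) tau0 tau1).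
have gT0 : gst E <= T0 by rewrite le_min gS /=; lra.
have iss0 : issued_by E v T0.
  rewrite /T0; case: leP => // lt.
  have [K hK] := horizon_exists HE S.
  apply: (issued_before_tau HE cl v0 tau1 (ltW lt) hK).
  by apply: (no_timeout_horizon HE v0 tau0 g0 hK) => //; lra.
have ea0 : T0 + 3 * delta E < t0 + theta_view P by lra.
have [T [t [[tau gt gT] iss early bound nt]]] :=
  issued_chain HE v0 good tau0 g0 gT0 iss0 ea0 ltm.
have [ti [k [p [rec ek le ip edel]]]] := receives HE cll iss gT ci.
exists ti; first by rewrite elast.
split.
- have lek : time E k <= T + delta E by rewrite ek.
  rewrite -elast in tau ip edel nt; rewrite -ek.
  exact: (last_proposal_commits HE v0 x0 good tau gt lek early nt ci edel ip).
- exists t1 => //; rewrite xR; rewrite mR in bound.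
  by have := mulr_ge0 mR0 (ltW d0); lra.
- move=> [k3 [q [ac eq]]]; exists t0 => //.
  (* A second chain, started at t0 + 2 [delta]. It bounds the same reception time, because
     [receives_proposal] singles out the earliest one. *)
  have iss3 := qc_issue HE v0 x0 good tau0 g0 ac eq.
  have [||T3 [t3 [[_ _ gT3] iss3' _ bound3 _]]] :=
    issued_chain HE v0 good tau0 g0 _ iss3 _ ltm; try lra.
  have [ti3 [k4 [p4 [rec3 _ le3 _ _]]]] := receives HE cll iss3' gT3 ci.
  have eti : ti <= ti3.
    by have [[k5 r5 <-] _] := rec3; have [_ h] := rec; exact: h.
  by rewrite xR; rewrite mR in bound3; lra.
Qed.
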